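(* Let $r\ge2$, $k\ge1$, and let $F_1,\ldots,F_k$ be color-critical graphs with $\chi(F_i)=r+1\ge3$ for each $i\in\{1,\ldots,k\}$. For sufficiently large $n$, the unique graph (up to isomorphism) in ${\rm SPEX}\big(n,\mathbb{G}(F_1,\ldots,F_k)\big)$ is obtained from $T_{n,r}$ by embedding a subgraph $H$ with $k-1$ edges into a partite set $V_i$ of $T_{n,r}$ with $|V_i|=\lfloor\frac nr\rfloor$, where $H$ is a triangle if $k=4$ and $H$ is a star (with $k-1$ edges) otherwise.
   Context: All graphs are finite and simple. A graph $H$ is color-critical if there is an edge $e\in E(H)$ with $\chi(H-e)<\chi(H)$. $\mathbb{G}(F_1,\ldots,F_k)$ denotes the family of graphs consisting of $k$ pairwise edge-disjoint copies of $F_1,\ldots,F_k$. A graph is $\mathcal{H}$-free if it contains no member of $\mathcal{H}$ as a subgraph. $\rho(G)$ is the spectral radius of the adjacency matrix of $G$; ${\rm SPEX}(n,\mathcal{H})$ is the set of $n$-vertex $\mathcal{H}$-free graphs with maximum spectral radius among all $n$-vertex $\mathcal{H}$-free graphs. $T_{n,r}$ is the $r$-partite Turán graph on $n$ vertices. *)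

(* Defs.v *)
From mathcomp Require Import all_boot all_order all_algebra.
From mathcomp Require Import classical_sets reals complex.

Set Implicit Arguments.
Unset Strict Implicit.
Unset Printing Implicit Defensive.

Import Order.TTheory GRing.Theory Num.Theory.

Record sgraph := SGraph {
  svertex : finType;
  sedge : rel svertex;
  sedge_sym : symmetric sedge;
  sedge_irrefl : irreflexive sedge
}.
Coercion svertex : sgraph >-> finType.

Notation "x -- y" := (sedge x y) (at level 30).

Definition edges (G : sgraph) : {set {set G}} :=
  [set [set p.1; p.2] | p : G * G & p.1 -- p.2].

Definition graph_iso (G H : sgraph) : Prop :=
  exists2 f : G -> H, bijective f & forall x y : G, (f x -- f y) = (x -- y).

(** Copies: subgraphs are not required to be induced. *)

Definition embedding (H G : sgraph) (f : H -> G) : Prop :=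
  injective f /\ (forall x y : H, x -- y -> f x -- f y).

Definition contains (G H : sgraph) : Prop :=
  exists f : H -> G, embedding f.

Definition free (P : sgraph -> Prop) (G : sgraph) : Prop :=
  forall M : sgraph, P M -> ~ contains G M.

Definition copy_edges (H G : sgraph) (f : H -> G) : {set {set G}} :=
  [set f @: e | e : {set H} in edges H].

(* The copies may share vertices, but not edges, and nothing of [M] lies
   outside the copies. *)
Definition edge_disjoint_copies (k : nat) (F : 'I_k -> sgraph) (M : sgraph) :
    Prop :=
  exists f : forall i, F i -> M,
    [/\ forall i, embedding (f i),
        forall i j, i != j -> [disjoint copy_edges (f i) & copy_edges (f j)],
        forall x : M, exists i, exists u : F i, f i u = x
      & edges M = \bigcup_(i < k) copy_edges (f i)].

(** Colourings *)

Definition colorable (G : sgraph) (c : nat) : bool :=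
  [exists f : {ffun G -> 'I_c},
    [forall x, [forall y, (x -- y) ==> (f x != f y)]]].

Lemma colorable_card (G : sgraph) : exists c, colorable G c.
Proof.
exists #|G|; apply/existsP; exists [ffun x => enum_rank x].
apply/forallP => x; apply/forallP => y; apply/implyP => xy; rewrite !ffunE.
by apply: contraTneq xy => /enum_rank_inj ->; rewrite sedge_irrefl.
Qed.

Definition chi (G : sgraph) : nat := ex_minn (colorable_card G).

Section DelEdge.
Variables (G : sgraph) (u v : G).

Definition del_edge_rel : rel G :=
  fun x y => (x -- y) && ([set x; y] != [set u; v]).

Lemma del_edge_sym : symmetric del_edge_rel.
Proof. by move=> x y; rewrite /del_edge_rel sedge_sym finset.setUC. Qed.

Lemma del_edge_irrefl : irreflexive del_edge_rel.
Proof. by move=> x; rewrite /del_edge_rel sedge_irrefl. Qed.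

Definition del_edge : sgraph := SGraph del_edge_sym del_edge_irrefl.
End DelEdge.

Definition color_critical (H : sgraph) : Prop :=
  exists u v : H, u -- v /\ chi (del_edge u v) < chi H.

(** Spectral radius *)

Definition adjacency (K : nzRingType) (G : sgraph) : 'M[K]_#|G| :=
  \matrix_(i, j) (enum_val i -- enum_val j)%:R%R.

(* The largest modulus of a complex eigenvalue, as an element of [R]. The set
   is finite, and it is nonempty as soon as [0 < n], so that [sup] is then a
   maximum. *)
Definition spectral_radius (R : realType) (n : nat) (A : 'M[R[i]]_n) : R :=
  sup [set x : R | exists2 z : R[i], eigenvalue A z & x = Normc.normc z]%classic.

Definition rho (R : realType) (G : sgraph) : R :=
  spectral_radius (adjacency R[i] G).

Definition SPEX (R : realType) (n : nat) (P : sgraph -> Prop) (G : sgraph) :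
    Prop :=
  [/\ #|G| = n, free P G
    & forall G' : sgraph, #|G'| = n -> free P G' -> (rho R G' <= rho R G)%R].

(** Turan graphs, triangle and stars *)

(* Residue classes mod [r] split [0, ..., n-1] into [r] parts whose sizes are
   each the floor or the ceiling of [n / r]. *)
Section Turan.
Variables n r : nat.

Definition turan_rel : rel 'I_n := fun x y => x %% r != y %% r.

Lemma turan_sym : symmetric turan_rel.
Proof. by move=> x y; rewrite /turan_rel eq_sym. Qed.

Lemma turan_irrefl : irreflexive turan_rel.
Proof. by move=> x; rewrite /turan_rel eqxx. Qed.

Definition turan : sgraph := SGraph turan_sym turan_irrefl.

Definition turan_part (c : 'I_r) : {set turan} :=
  [set x : 'I_n | x %% r == c].
End Turan.

Section Complete.
Variable m : nat.

Definition complete_rel : rel 'I_m := fun x y => x != y.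

Lemma complete_sym : symmetric complete_rel.
Proof. by move=> x y; rewrite /complete_rel eq_sym. Qed.

Lemma complete_irrefl : irreflexive complete_rel.
Proof. by move=> x; rewrite /complete_rel eqxx. Qed.

Definition complete : sgraph := SGraph complete_sym complete_irrefl.
End Complete.

(* The star with [m] edges; its centre is [ord0]. *)
Section Star.
Variable m : nat.

Definition star_rel : rel 'I_m.+1 := fun x y => (x == ord0) != (y == ord0).

Lemma star_sym : symmetric star_rel.
Proof. by move=> x y; rewrite /star_rel eq_sym. Qed.

Lemma star_irrefl : irreflexive star_rel.
Proof. by move=> x; rewrite /star_rel eqxx. Qed.

Definition star : sgraph := SGraph star_sym star_irrefl.
End Star.

(* Up to the isomorphism [phi], [G] is [T] together with the edges of a copy of
   [H] placed on vertices of [A]. *)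
Definition obtained_by_embedding (T : sgraph) (A : {set T}) (H G : sgraph) :
    Prop :=
  exists (phi : T -> G) (h : H -> T),
    [/\ bijective phi, injective h, forall u, h u \in A
      & forall x y : T, phi x -- phi y <->
          x -- y \/ exists u v : H, [/\ u -- v, h u = x & h v = y]].

(* Main.v *)
(* Each F_i has a colouring with r colours having a single monochromatic edge, so it sits
   inside a large complete r-partite graph plus one edge, while in any graph with an
   r-colouring every copy of F_i uses a monochromatic ("inner") edge.  Hence k suitable
   inner edges of an almost complete r-partite graph give a forbidden configuration, and
   fewer than k inner edges never do.

   Let x be the Perron vector of an extremal graph G, scaled so that the sum of its squares
   is n.  The Erdos-Stone theorem for the weights x gives an x close to 1 in the mean and a
   large complete r-partite subgraph A whose vertices have degree about (1 - 1/r) n.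
   Classifying vertices by the part of A in which they have few neighbours, and reconnecting
   a vertex v to everything outside the smallest class (which creates no forbidden graph,
   since v can be replaced by a vertex of A), extremality bounds x v and then the degree of
   v from below.  So G has an r-colouring with fewer than k inner edges, and by extremality
   G is complete r-partite plus exactly m = k - 1 inner edges.

   For such a graph, with class sizes N_i and lam = rho G, the eigenvalue equation becomes
   sum_i 1 / (lam + N_i + b_i) = (r - 1) / lam, where b_i is the excess due to the inner edges,
   sum_i b_i = 2 m / lam + (sum_v d_v ^ 2) / lam ^ 2 + O(lam ^ -3), d_v being inner degrees.
   Convexity of 1 / t forces balanced sizes, inner edges in the smaller classes, and
   sum_v d_v ^ 2 = m ^ 2 + m, its maximum, attained only when the inner edges pairwise meet:
   a star or a triangle.  For m = 3 the triangle wins at order lam ^ -3. *)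
From mathcomp Require Import boolp classical_sets reals complex.
From mathcomp Require Import all_boot all_order all_algebra.
From mathcomp Require Import fingroup perm.
From mathcomp Require Import ring lra zify.
Require Import Defs.

Set Implicit Arguments.
Unset Strict Implicit.
Unset Printing Implicit Defensive.
Import Order.TTheory GRing.Theory Num.Theory.

(** * The spectral radius of an adjacency matrix *)

(** A large spectral radius bounds the quadratic form of [x] from below, not the number of edges,
    and a priori [x] may nearly vanish at some vertices. Running the Erdos-Stone argument with the
    weights [x] uses that form directly; degrees are recovered afterwards, because [x] close to 1 in
    the mean makes weight and cardinality of a vertex set almost equal. The final comparison treats
    the two graphs asymmetrically. For the extremal graph, dividing [x] on a class by the weight
    outside that class gives an exact solution of lam z = 1 + (inner adjacency) z, which turns the
    eigenvalue equation into one identity between reciprocals. For the target, a subsolution at the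
    same lam is enough: were its sum of reciprocals smaller, Rayleigh's principle would give it a
    radius above lam. Sizes are measured against a chord of 1 / t, and squared degrees are integers,
    so a total defect below 1/2 in units of lam ^ -2 settles sizes, location and shape at once. That
    the target is extremal is never computed: an extremal graph exists by finiteness, and every one
    is isomorphic to the target. *)

Section SpectralRadius.
Local Open Scope ring_scope.
Variables (R : realType) (n : nat) (A : 'M[R[i]]_n).
Hypothesis n_gt0 : (0 < n)%N.
Hypothesis Aherm : A \is hermsymmx.

Let P := spectralmx A.
Let d := spectral_diag A.

Let Adiag : A = invmx P *m diag_mx d *m P.
Proof. exact/orthomx_spectralP/hermitian_normalmx. Qed.

Lemma eigenvalue_spectral_diag z : eigenvalue A z <-> exists i, z = d 0 i.
Proof.
have Pu : P \in unitmx by apply: spectral_unit.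
split.
  case/eigenvalueP => v vA vN0; have [w wE] : exists w, w = v *m invmx P by eexists.
  have wD : w *m diag_mx d = z *: w.
    have := congr1 (mulmx^~ (invmx P)) vA.
    by rewrite wE Adiag !mulmxA mulmxK // -scalemxAl.
  have /rV0Pn[i wi] : w != 0.
    apply: contraNneq vN0 => w0.
    by rewrite -[v](mulmxKV Pu) -wE w0 mul0mx.
  exists i; have /rowP/(_ i) := wD.
  by rewrite mul_mx_diag !mxE mulrC => /(mulIf wi).
case=> i ->; apply/eigenvalueP; exists (delta_mx 0 i *m P).
  rewrite Adiag !mulmxA mulmxK // scalemxAl; congr (_ *m _).
  apply/rowP => j; rewrite mul_mx_diag !mxE eqxx mulrC /=.
  by case: eqP => [->|]; rewrite ?mulr0 ?mulr1.
apply/negP => /eqP/(congr1 (mulmx^~ (invmx P))).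
rewrite mulmxK // mul0mx => /rowP/(_ i); rewrite !mxE !eqxx.
by move/eqP; rewrite oner_eq0.
Qed.

Lemma normc_spectral_diag_le i : Normc.normc (d 0 i) <= spectral_radius A.
Proof.
have bnd : has_sup [set x : R | exists2 z : R[i], eigenvalue A z &
    x = Normc.normc z]%classic.
  split; first by exists (Normc.normc (d 0 i)), (d 0 i) => //;
    apply/eigenvalue_spectral_diag; exists i.
  (* [sup] dominates a set only if the set is bounded; the sum of all moduli is a crude bound. *)
  exists (\sum_j Normc.normc (d 0 j)) => x [z /eigenvalue_spectral_diag[j ->] ->].
  by rewrite (bigD1 j) //= lerDl sumr_ge0 // => l _; case: (d _ _) => a b;
    apply: Num.Theory.sqrtr_ge0.
apply: sup_upper_bound => //=; exists (d 0 i) => //.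
by apply/eigenvalue_spectral_diag; exists i.
Qed.

Lemma spectral_radius_attained :
  exists2 z, eigenvalue A z & spectral_radius A = Normc.normc z.
Proof.
pose i0 := Ordinal n_gt0.
pose i := [arg max_(j > i0) Normc.normc (d 0 j)]%O.
have imax j : Normc.normc (d 0 j) <= Normc.normc (d 0 i).
  by rewrite /i; case: arg_maxP => //= l _; apply.
exists (d 0 i); first by apply/eigenvalue_spectral_diag; exists i.
apply/eqP; rewrite eq_le normc_spectral_diag_le andbT.
apply: ge_sup.
  by exists (Normc.normc (d 0 i)), (d 0 i) => //;
    apply/eigenvalue_spectral_diag; exists i.
by move=> x [z /eigenvalue_spectral_diag[j ->] ->].
Qed.

(** Rayleigh's inequality. In the coordinates [w] of a unitary eigenbasis both sides are
    combinations of the squared moduli of the [w 0 i], and each eigenvalue, being real, is at most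
    its modulus. *)
Lemma spectral_radius_quad (v : 'rV[R[i]]_n) :
  (v *m A *m (map_mx Num.conj v)^T) 0 0 <=
  (spectral_radius A)%:C%C * (v *m (map_mx Num.conj v)^T) 0 0.
Proof.
pose w := v *m map_mx Num.conj P^T.
have Pi : invmx P = map_mx Num.conj P^T by rewrite invmx_unitary ?spectral_unitarymx.
have wE : map_mx Num.conj w^T = P *m (map_mx Num.conj v)^T.
  rewrite /w trmx_mul map_mxM /= map_trmx trmxK; congr (_ *m _); last by rewrite map_trmx.
  by rewrite -map_mx_comp map_mx_id // => x; apply: conjCK.
have -> : v *m A *m (map_mx Num.conj v)^T = w *m diag_mx d *m map_mx Num.conj w^T.
  by rewrite wE Adiag Pi !mulmxA.
have -> : v *m (map_mx Num.conj v)^T = w *m map_mx Num.conj w^T.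
  by rewrite wE /w -Pi mulmxA mulmxKV // spectral_unit.
clear wE; clearbody w; rewrite mul_mx_diag !mxE mulr_sumr; apply: ler_sum => i _.
rewrite !mxE [w 0 i * d 0 i]mulrC -mulrA; apply: ler_wpM2r.
  by rewrite -normCK exprn_ge0.
have dreal : d 0 i \is Num.real by move/mxOverP: (hermitian_spectral_diag_real Aherm).
apply: le_trans (real_ler_norm dreal) _.
by rewrite -[`|_|]/((Normc.normc (d 0 i))%:C%C) lecR normc_spectral_diag_le.
Qed.

End SpectralRadius.

(** * Rayleigh's inequality for graphs and a nonnegative eigenvector *)

Section Perron.
Local Open Scope ring_scope.
Variables (R : realType) (G : sgraph).
Hypothesis G_gt0 : (0 < #|G|)%N.

Lemma sum_enum_val (V : nmodType) (f : G -> V) :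
  \sum_(i < #|G|) f (enum_val i) = \sum_x f x.
Proof. by rewrite (reindex _ (onW_bij _ (@enum_val_bij G))). Qed.

Lemma adjacency_herm : adjacency R[i] G \is hermsymmx.
Proof.
apply: realsym_hermsym.
  by apply/is_hermitianmxP/matrixP => i j; rewrite !mxE expr0 mul1r sedge_sym.
by apply/mxOverP => i j; rewrite mxE realn.
Qed.

Lemma rho_quad (y : G -> R) :
  \sum_u y u * (\sum_(v | u -- v) y v) <= rho R G * \sum_u y u ^+ 2.
Proof.
pose v : 'rV[R[i]]_#|G| := \row_i (y (enum_val i))%:C%C.
have vJ : map_mx Num.conj v = v.
  by apply/rowP => i; rewrite !mxE -[RHS]conjc_real.
have := spectral_radius_quad adjacency_herm v; rewrite vJ.
rewrite -[spectral_radius _]/(rho R G).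
have -> : (v *m v^T) 0 0 = (\sum_u y u ^+ 2)%:C%C.
  rewrite mxE -sum_enum_val rmorph_sum /=; apply: eq_bigr => i _.
  by rewrite !mxE expr2 rmorphM.
suff -> : (v *m adjacency R[i] G *m v^T) 0 0 =
    (\sum_u y u * (\sum_(v | u -- v) y v))%:C%C by rewrite -rmorphM lecR.
rewrite mxE -(sum_enum_val (fun u => y u * (\sum_(v | u -- v) y v))) rmorph_sum /=; apply: eq_bigr => i _.
rewrite !mxE rmorphM /= mulrC; congr (_ * _).
rewrite [in RHS]big_mkcond -(sum_enum_val (fun u => if enum_val i -- u then y u else 0)) rmorph_sum /=; apply: eq_bigr => j _.
by rewrite !mxE sedge_sym; case: ifP; rewrite ?mulr1 ?mulr0.
Qed.

(** The moduli [y] of an eigenvector whose eigenvalue has modulus rho satisfy rho y <= A y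
    entrywise, and Rayleigh's inequality forces equality. Without connectedness only nonnegativity
    results; extremality supplies positivity later. *)
Lemma rho_perron : exists x : G -> R,
  [/\ forall v, 0 <= x v, 0 < \sum_v x v ^+ 2
    & forall v, \sum_(u | v -- u) x u = rho R G * x v].
Proof.
have [z /eigenvalueP[w wA wN0] zE] := spectral_radius_attained G_gt0 adjacency_herm.
pose y (u : G) := Normc.normc (w 0 (enum_rank u)).
have normc_ge0 (c : R[i]) : 0 <= Normc.normc c by case: c => a b; apply: sqrtr_ge0.
have y0 u : 0 <= y u by apply: normc_ge0.
have normc_sum (I : finType) (f : I -> R[i]) :
    Normc.normc (\sum_i f i) <= \sum_i Normc.normc (f i).
  elim/big_rec2: _ => [|i a b _ ab]; first by rewrite Normc.normc0.
  by apply: le_trans (le_normcD _ _) _; rewrite lerD2l.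
have dom v : rho R G * y v <= \sum_(u | v -- u) y u.
  rewrite /rho zE /y -Normc.normcM.
  have -> : z * w 0 (enum_rank v) = (z *: w) 0 (enum_rank v) by rewrite mxE.
  rewrite -wA mxE; apply: le_trans (normc_sum _ _) _.
  rewrite [leRHS]big_mkcond -(sum_enum_val (fun u => if v -- u then y u else 0)); apply: ler_sum => i _.
  rewrite !mxE enum_rankK sedge_sym Normc.normcM.
  case: ifP => _; rewrite ?enum_valK ?Normc.normc1 ?mulr1 //.
    by rewrite /y enum_valK.
  by rewrite Normc.normc0 mulr0.
set lam := rho R G in dom *.
pose del v := \sum_(u | v -- u) y u - lam * y v.
have del0 v : 0 <= del v by rewrite subr_ge0.
have sym (f g : G -> R) : \sum_u f u * (\sum_(v | u -- v) g v) =
    \sum_u g u * (\sum_(v | u -- v) f v).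
  under eq_bigr do rewrite mulr_sumr.
  rewrite (exchange_big_dep predT) //=; apply: eq_bigr => u _.
  by rewrite mulr_sumr; apply: eq_big => [v|v _]; rewrite 1?sedge_sym // mulrC.
pose D := \sum_v del v ^+ 2.
(* The form [q] of lam - A is nonnegative and vanishes at [y], so [y] minimises it. Its derivative
   at [y] in the direction [del] is - 2 D, hence D = 0. *)
pose q (f : G -> R) := lam * \sum_u f u ^+ 2 - \sum_u f u * (\sum_(v | u -- v) f v).
have q_ge0 f : 0 <= q f by rewrite subr_ge0 rho_quad.
have qy : q y = 0.
  apply/eqP; rewrite eq_le q_ge0 andbT subr_le0 mulr_sumr; apply: ler_sum => u _.
  by rewrite expr2 mulrCA ler_wpM2l.
have qyt t : q (fun v => y v + t * del v) = - (2 * t * D) + t ^+ 2 * q del.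
  have e1 : \sum_u (y u + t * del u) ^+ 2 =
      \sum_u y u ^+ 2 + 2 * t * (\sum_u y u * del u) + t ^+ 2 * \sum_u del u ^+ 2.
    rewrite !mulr_sumr -!big_split /=; apply: eq_bigr => u _; ring.
  have e2 : \sum_u (y u + t * del u) * (\sum_(v | u -- v) (y v + t * del v)) =
      \sum_u y u * (\sum_(v | u -- v) y v) +
      2 * t * (\sum_u del u * (\sum_(v | u -- v) y v)) +
      t ^+ 2 * \sum_u del u * (\sum_(v | u -- v) del v).
    have -> : 2 * t * (\sum_u del u * (\sum_(v | u -- v) y v)) =
       t * (\sum_u y u * (\sum_(v | u -- v) del v)) +
       t * (\sum_u del u * (\sum_(v | u -- v) y v)) by rewrite (sym y del); ring.
    rewrite !mulr_sumr -!big_split /=; apply: eq_bigr => u _.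
    rewrite big_split /= -mulr_sumr; ring.
  have e3 : D = \sum_u del u * (\sum_(v | u -- v) y v) - lam * \sum_u y u * del u.
    rewrite /D mulr_sumr -sumrB; apply: eq_bigr => u _; rewrite expr2 {2}/del; ring.
  rewrite /q e1 e2 e3; move: qy; rewrite /q; lra.
have D0 : D = 0.
  have D_ge0 : 0 <= D by apply: sumr_ge0 => v _; apply: exprn_ge0.
  apply/eqP; rewrite eq_le D_ge0 andbT leNgt; apply/negP => Dp.
  have qp : 0 < q del + 1 by rewrite ltr_wpDl.
  (* With t (q del + 1) = D the quadratic term t^2 q(del) stays below t D, so the form would be
     negative; the summand 1 keeps the denominator positive. *)
  have := q_ge0 (fun v => y v + (D / (q del + 1)) * del v); rewrite qyt.
  set t := D / _; have tE : t * (q del + 1) = D by rewrite mulfVK ?gt_eqF.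
  have tp : 0 < t by rewrite divr_gt0.
  have q0 := q_ge0 del; nra.
exists y; split => //.
  have /rV0Pn[i wi] := wN0.
  rewrite (bigD1 (enum_val i)) //= ltr_pwDl //; last first.
    by apply: sumr_ge0 => u _; apply: exprn_ge0.
  rewrite exprn_gt0 // lt_neqAle y0 andbT eq_sym /y enum_valK.
  by apply: contraNneq wi => /Normc.eq0_normc/eqP.
move=> v; apply/eqP; rewrite -subr_eq0 -/(del v) -sqrf_eq0.
by apply/eqP; apply: (psumr_eq0P _ D0) => // u _; apply: exprn_ge0.
Qed.

End Perron.

(** * Packings of edge-disjoint copies *)

(* [k] edge-disjoint copies, with disjointness spelled out on ordered pairs. *)
Definition packs (k : nat) (F : 'I_k -> sgraph) (G : sgraph) : Prop :=
  exists phi : forall i, F i -> G, (forall i, embedding (phi i)) /\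
    forall i j, i != j -> forall (a b : F i) (c d : F j), a -- b -> c -- d ->
      phi i a = phi j c -> phi i b = phi j d -> False.

Lemma edgesP (G : sgraph) (e : {set G}) :
  reflect (exists a b, a -- b /\ e = [set a; b]) (e \in edges G).
Proof.
apply: (iffP imsetP) => [[[a b]] /=|[a [b [ab ->]]]].
  by rewrite inE /= => ab ->; exists a, b.
by exists (a, b); rewrite ?inE.
Qed.

Lemma copy_edgesP (H G : sgraph) (f : H -> G) (e : {set G}) :
  reflect (exists a b, a -- b /\ e = [set f a; f b]) (e \in copy_edges f).
Proof.
apply: (iffP imsetP) => [[x /edgesP[a [b [ab ->]]] ->]|[a [b [ab ->]]]].
  by exists a, b; rewrite imsetU1 imset_set1.
by exists [set a; b]; [apply/edgesP; exists a, b | rewrite imsetU1 imset_set1].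
Qed.

Lemma set2_eqP (T : finType) (a b c d : T) :
  [set a; b] = [set c; d] <-> (a = c /\ b = d) \/ (a = d /\ b = c).
Proof.
split; last by move=> [[-> ->]|[-> ->]] //; rewrite finset.setUC.
move=> E; have := set21 a b; have := set22 a b; rewrite E !inE.
have := set21 c d; have := set22 c d; rewrite -E !inE.
do 4!(case/orP=> /eqP ?); subst; auto.
Qed.

Lemma copy_edges_disjoint (H H' G : sgraph) (f : H -> G) (g : H' -> G) :
  (forall a b c d, a -- b -> c -- d -> f a = g c -> f b = g d -> False) ->
  [disjoint copy_edges f & copy_edges g].
Proof.
move=> dis; rewrite disjoint_subset; apply/subsetP => e.
move=> /copy_edgesP[a [b [ab ->]]]; apply/negP => /copy_edgesP[c [d [cd]]].
case/set2_eqP => -[]; first exact: dis.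
by apply: dis; rewrite // sedge_sym.
Qed.

Section Packs.
Variables (k : nat) (F : 'I_k -> sgraph).

Lemma packs_edge_disjoint_copies G (M : sgraph) :
  edge_disjoint_copies F M -> contains G M -> packs F G.
Proof.
move=> [f [femb fdis _ _]] [g [ginj gE]].
exists (fun i u => g (f i u)); split=> [i|i j ij a b c d ab cd /ginj e1 /ginj e2].
  have [fi fe] := femb i; split; first by move=> x y /ginj/fi.
  by move=> x y /fe/gE.
have /pred0P/(_ [set f i a; f i b]) := fdis _ _ ij; move/negP; apply => /=.
by apply/andP; split; apply/copy_edgesP; [exists a, b | exists c, d; rewrite e1 e2].
Qed.

(** The witness is the union of the copies instead of [G]: a member of the family may have neither
    vertices nor edges outside its copies. *)
Lemma contains_packs G : packs F G ->
  exists2 M : sgraph, edge_disjoint_copies F M & contains G M.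
Proof.
move=> [phi [emb dis]].
pose U := [set x : G | [exists i, [exists u : F i, phi i u == x]]].
pose V := {x : G | x \in U}.
pose rel : rel V := fun x y => [exists i, [exists a : F i, [exists b : F i,
  [&& a -- b, phi i a == val x & phi i b == val y]]]].
have relP x y : reflect (exists i (a b : F i), [/\ a -- b, phi i a = val x &
    phi i b = val y]) (rel x y).
  apply: (iffP existsP) => [[i /existsP[a /existsP[b /and3P[ab /eqP ea /eqP eb]]]]|].
    by exists i, a, b.
  move=> [i [a [b [ab ea eb]]]]; exists i; apply/existsP; exists a; apply/existsP.
  by exists b; rewrite ab ea eb !eqxx.
have rsym : symmetric rel.
  by move=> x y; apply/relP/relP => -[i [a [b [ab ea eb]]]]; exists i, b, a;
    rewrite sedge_sym.
have rirr : irreflexive rel.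
  move=> x; apply/negbTE/negP => /relP[i [a [b [ab ea eb]]]].
  have [/(_ a b)] := emb i; rewrite ea eb => /(_ erefl) abE _.
  by rewrite abE sedge_irrefl in ab.
have inU i u : phi i u \in U by rewrite inE; apply/existsP; exists i; apply/existsP; exists u.
pose M := SGraph rsym rirr.
pose f i (u : F i) : M := exist _ (phi i u) (inU i u).
exists M; last first.
  exists (val : M -> G); split; first exact: val_inj.
  by move=> x y /relP[i [a [b [ab <- <-]]]]; have [_] := emb i; apply.
exists f; split.
- move=> i; have [ei ee] := emb i; split; first by move=> x y [] /ei.
  by move=> x y xy; apply/relP; exists i, x, y.
- move=> i j ij; apply: copy_edges_disjoint => a b c d ab cd [e1] [e2].
  exact: (dis i j ij a b c d).
- move=> [x xU]; have := xU; rewrite inE => /existsP[i /existsP[u /eqP e]].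
  by exists i, u; apply: val_inj.
- apply/setP => e; apply/edgesP/bigcupP.
    move=> [x [y [/relP[i [a [b [ab ea eb]]]] ->]]]; exists i => //.
    by apply/copy_edgesP; exists a, b; split=> //; congr [set _; _]; apply: val_inj.
  move=> [i _ /copy_edgesP[a [b [ab ->]]]]; exists (f i a), (f i b); split => //.
  by apply/relP; exists i, a, b.
Qed.

Lemma free_packs G : free (edge_disjoint_copies F) G <-> ~ packs F G.
Proof.
split=> [fr /contains_packs[M MP]|np M MP cM]; first exact: fr.
exact/np/(packs_edge_disjoint_copies MP).
Qed.

End Packs.

(** * Colourings with few monochromatic edges *)

Lemma colorableP (G : sgraph) c :
  reflect (exists f : G -> 'I_c, forall x y, x -- y -> f x != f y) (colorable G c).
Proof.
apply: (iffP existsP) => [[f /forallP fP]|[f fP]].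
  by exists f => x y xy; have /forallP/(_ y)/implyP := fP x; apply.
exists (finfun f); apply/forallP => x; apply/forallP => y; apply/implyP => xy.
by rewrite !ffunE fP.
Qed.

Lemma colorable_leq (G : sgraph) c d : c <= d -> colorable G c -> colorable G d.
Proof.
move=> cd /colorableP[f fP]; apply/colorableP; exists (widen_ord cd \o f) => x y /fP.
by apply: contra => /eqP/(congr1 val) /= /val_inj ->.
Qed.

Lemma colorable_chi (G : sgraph) c : colorable G c = (chi G <= c).
Proof.
rewrite /chi; case: ex_minnP => m mc mmin; apply/idP/idP; first exact: mmin.
by move/colorable_leq; apply.
Qed.

Lemma monochromatic_edge (H : sgraph) r (c : H -> 'I_r) : r < chi H ->
  exists a b, a -- b /\ c a = c b.
Proof.
rewrite ltnNge -colorable_chi => /negP nc.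
have [/existsP[a /existsP[b /andP[ab /eqP cab]]]|nex] :=
    boolP [exists a, [exists b, (a -- b) && (c a == c b)]]; first by exists a, b.
case: nc; apply/colorableP; exists c => x y xy; apply: contra nex => cxy.
by apply/existsP; exists x; apply/existsP; exists y; rewrite xy.
Qed.

(** Colour [H] minus its critical edge with r colours. As r colours do not suffice for [H], some
    edge is monochromatic, and only the removed one can be. *)
Lemma critical_coloring (H : sgraph) r : color_critical H -> chi H = r.+1 ->
  exists (u v : H) (c : H -> 'I_r), [/\ u -- v, c u = c v &
    forall a b, a -- b -> c a = c b -> [set a; b] = [set u; v]].
Proof.
move=> [u [v [uv]]] lt E; rewrite E ltnS -colorable_chi in lt.
have /colorableP[c cP] := lt; exists u, v, c.
have main (a b : H) : a -- b -> c a = c b -> [set a; b] = [set u; v].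
  move=> ab cab; apply/eqP; apply: contraT => nab.
  have /cP : @sedge (del_edge u v) a b by apply/andP.
  by rewrite cab eqxx.
split=> //; have [a [b [ab cab]]] := @monochromatic_edge H r c (eq_leq (esym E)).
by have /set2_eqP[[<- <-]|[<- <-]] := main _ _ ab cab.
Qed.

Definition inner (G : sgraph) r (c : G -> 'I_r) : {set {set G}} :=
  [set [set p.1; p.2] | p : G * G & (p.1 -- p.2) && (c p.1 == c p.2)].

Lemma innerP (G : sgraph) r (c : G -> 'I_r) (e : {set G}) :
  reflect (exists a b, [/\ a -- b, c a = c b & e = [set a; b]]) (e \in inner c).
Proof.
apply: (iffP imsetP) => [[[a b]] /=|[a [b [ab cab ->]]]].
  by rewrite inE /= => /andP[ab /eqP cab] ->; exists a, b.
by exists (a, b); rewrite // inE ab cab eqxx.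
Qed.

(** Pulling [c] back to a copy leaves a monochromatic edge there, since r colours are too few;
    edge-disjointness makes the k inner edges so obtained distinct. *)
Lemma inner_lt_not_packs k (F : 'I_k -> sgraph) (G : sgraph) r (c : G -> 'I_r) :
  (forall i, r < chi (F i)) -> #|inner c| < k -> ~ packs F G.
Proof.
move=> chiF lt [phi [emb dis]].
have /(_ _)/sigW ex i : exists p : F i * F i,
    (p.1 -- p.2) && (c (phi i p.1) == c (phi i p.2)).
  have [a [b [ab cab]]] := monochromatic_edge (fun u => c (phi i u)) (chiF i).
  by exists (a, b); rewrite ab cab eqxx.
pose g i := [set phi i (sval (ex i)).1; phi i (sval (ex i)).2].
have ginj : injective g.
  move=> i j /set2_eqP; apply: contraPeq => ij.
  have /andP[abi _] := svalP (ex i); have /andP[abj _] := svalP (ex j).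
  case=> -[]; first exact: dis abi abj.
  by rewrite sedge_sym in abj; apply: dis abi abj.
suff : k <= #|inner c| by rewrite leqNgt lt.
rewrite -[k in k <= _]card_ord -(card_imset _ ginj); apply/subset_leq_card/subsetP => e /imsetP[i _ ->].
have /andP[ab /eqP cab] := svalP (ex i); apply/innerP; do 2 eexists; split; [|exact: cab|by []].
by have [_] := emb i; apply.
Qed.

(** * Greedy construction of edge-disjoint copies *)

Definition nbr (G : sgraph) (v : G) : {set G} := [set u | v -- u].

Lemma exists_subset_card (T : finType) (A : {set T}) h : h <= #|A| ->
  exists2 B : {set T}, B \subset A & #|B| = h.
Proof.
move=> hA; exists [set x in take h (enum A)].
  by apply/subsetP => x; rewrite inE => /mem_take; rewrite mem_enum.
by rewrite cardsE (card_uniqP _) ?take_uniq ?enum_uniq // size_take_min -cardE; apply/minn_idPl.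
Qed.

Lemma card_bigcup_leq (I T : finType) (P : pred I) (A : I -> {set T}) :
  #|\bigcup_(i | P i) A i| <= \sum_(i | P i) #|A i|.
Proof.
elim/big_rec2: _ => [|i m B _ le]; first by rewrite cards0.
by apply: leq_trans (leq_card_setU _ _) _; rewrite leq_add2l.
Qed.

(** The classes are chosen one at a time. The at most r * h vertices already chosen rule out at most
    mu candidates each, [X] rules out at most N, and h candidates remain. *)
Lemma greedy_multipartite (G : sgraph) r h N mu (Z : 'I_r -> {set G}) (X : {set G}) :
  #|X| <= N -> (forall j, N + r * (h * mu) + h <= #|Z j|) ->
  (forall j j' w, j != j' -> w \in Z j -> #|Z j' :\: nbr w| <= mu) ->
  exists Q : 'I_r -> {set G},
    (forall j, [/\ #|Q j| = h, Q j \subset Z j & [disjoint Q j & X]]) /\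
    (forall j j', j != j' -> forall x y, x \in Q j -> y \in Q j' -> x -- y).
Proof.
move=> leX leZ miss.
suff: forall s, s <= r -> exists Q : 'I_r -> {set G},
    (forall j : 'I_r, j < s -> [/\ #|Q j| = h, Q j \subset Z j & [disjoint Q j & X]]) /\
    (forall j j' : 'I_r, j < s -> j' < s -> j != j' ->
       forall x y, x \in Q j -> y \in Q j' -> x -- y).
  move/(_ r (leqnn r)) => [Q [H1 H2]]; exists Q; split=> [j|j j' jj']; first exact: H1.
  exact: H2.
elim=> [_|s IH sr]; first by exists (fun _ => set0); split.
have [Q [H1 H2]] := IH (ltnW sr); pose j0 := Ordinal sr.
pose Bad := \bigcup_(j : 'I_r | j < s) \bigcup_(w in Q j) (Z j0 :\: nbr w).
have leB : #|Bad| <= r * (h * mu).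
  apply: leq_trans (card_bigcup_leq _ _) _.
  apply: (@leq_trans (\sum_(j < r | j < s) h * mu)); last first.
    rewrite sum_nat_const leq_mul2r; apply/orP; right.
    by apply: leq_trans (max_card _) _; rewrite card_ord.
  apply: leq_sum => j js; have [Qj QZ _] := H1 j js.
  apply: leq_trans (card_bigcup_leq _ _) _; rewrite -Qj -sum_nat_const.
  apply: leq_sum => w wQ; apply: (miss j); last exact: (subsetP QZ).
  by apply: contraTneq js => ->; rewrite ltnn.
have [Y YS Yh] : exists2 B : {set G}, B \subset Z j0 :\: (X :|: Bad) & #|B| = h.
  apply: exists_subset_card; rewrite cardsD.
  have := leZ j0; have := subset_leq_card (subsetIr (Z j0) (X :|: Bad)).
  have := (leq_card_setU X Bad).1; lia.
have YP x : x \in Y -> [/\ x \in Z j0, x \notin X & x \notin Bad].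
  by move/(subsetP YS); rewrite !inE negb_or => /andP[/andP[-> ->] ->].
exists (fun j => if j == j0 then Y else Q j); split.
  move=> j js; case: eqP => [->|nj].
    split=> //; first by apply/subsetP => x /YP[].
    by rewrite disjoint_subset; apply/subsetP => x /YP[].
  apply: H1; move: js; rewrite ltnS leq_eqVlt => /orP[/eqP js|//].
  by case: nj; apply: val_inj.
have new (j : 'I_r) x y : j < s -> x \in Q j -> y \in Y -> x -- y.
  move=> js xQ /YP[yZ _]; apply: contraNT => nxy.
  by apply/bigcupP; exists j => //; apply/bigcupP; exists x; rewrite // !inE nxy.
have small (j : 'I_r) : j < s.+1 -> j <> j0 -> j < s.
  rewrite ltnS leq_eqVlt => /orP[/eqP js|//] nj.
  by case: nj; apply: val_inj.
move=> j j' js js' jj' x y; case: eqP => [ej|nj]; case: eqP => [ej'|nj'].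
- by rewrite ej ej' eqxx in jj'.
- by move=> xY yQ; rewrite sedge_sym; apply: new yQ xY; apply: small.
- by move=> xQ yY; apply: new xQ yY; apply: small.
- by apply: H2 => //; apply: small.
Qed.

Section PackBlocks.
Variables (k r : nat) (F : 'I_k -> sgraph).
Hypothesis F_critical : forall i, color_critical (F i) /\ chi (F i) = r.+1.

Let h := \sum_(i < k) #|F i|.
(** The summands count, in a class of candidates: the ends of the k distinguished edges, the
    vertices of earlier blocks, the non-neighbours of the vertices already chosen for the current
    block, and the h vertices still to be chosen. *)
Definition pack_bound mu := 2 * k + k * (r * h) + r * (h * mu) + h.

(** The critical edge of [F i] goes to uv and every other vertex of colour j goes injectively into
    [Q j]. All edges but the critical one join different colours, so only adjacency across classes
    is needed, and u, v need no neighbours in class j0. *)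
Lemma embed_block (G : sgraph) (i : 'I_k) (u v : G) (j0 : 'I_r) (Q : 'I_r -> {set G}) :
  u -- v -> (forall j, h <= #|Q j|) ->
  (forall j j', j != j' -> forall x y, x \in Q j -> y \in Q j' -> x -- y) ->
  (forall j, (u \notin Q j) /\ (v \notin Q j)) ->
  (forall j x, j != j0 -> x \in Q j -> u -- x /\ v -- x) ->
  exists2 f : F i -> G, embedding f &
    forall w, f w \in [set u; v] \/ exists j, f w \in Q j.
Proof.
move=> uv Qh Qc Qn Qj; have [crit chiF] := F_critical i.
have [a [b [c [ab cab cP]]]] := critical_coloring crit chiF.
(* Colours are swapped so that the critical edge gets the prescribed colour j0. *)
pose g w := tperm (c a) j0 (c w).
have ga : g a = j0 by rewrite /g tpermL.
have gb : g b = j0 by rewrite /g -cab tpermL.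
have ltw w : enum_rank w < #|Q (g w)|.
  apply: leq_trans (ltn_ord _) (leq_trans _ (Qh _)).
  by rewrite /h (bigD1 i) //= leq_addr.
pose q w := nth u (enum (Q (g w))) (enum_rank w).
have qQ w : q w \in Q (g w) by rewrite -mem_enum mem_nth // -cardE.
have Qdis j j' x : x \in Q j -> x \in Q j' -> j = j'.
  move=> xj xj'; apply: contraTeq isT => jj'.
  by have := Qc _ _ jj' _ _ xj xj'; rewrite sedge_irrefl.
have qinj w w' : q w = q w' -> w = w'.
  move=> e; have ge : g w = g w' by apply: Qdis (qQ w) _; rewrite e.
  apply/enum_rank_inj/val_inj/eqP.
  rewrite -(nth_uniq u _ _ (enum_uniq (mem (Q (g w))))) -?cardE ?ltw //; last first.
    by rewrite ge ltw.
  by rewrite [X in _ == nth _ (enum (Q X)) _]ge; apply/eqP.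
pose f w := if w == a then u else if w == b then v else q w.
have nuv : u != v by apply: contraTneq uv => ->; rewrite sedge_irrefl.
have nab : a != b by apply: contraTneq ab => ->; rewrite sedge_irrefl.
have nuq w : u != q w by apply: contraNneq (proj1 (Qn (g w))) => ->.
have nvq w : v != q w by apply: contraNneq (proj2 (Qn (g w))) => ->.
have fsym w w' : w -- w' -> g w != g w' -> f w -- f w'.
  move=> ww' ng; rewrite /f.
  have gj y : y <> j0 -> forall x, x \in Q y -> u -- x /\ v -- x.
    by move=> /eqP yj x; apply: Qj.
  have [ea|na] := eqVneq w a; have [ea'|na'] := eqVneq w' a.
  - by rewrite ea ea' eqxx in ng.
  - have [eb|nb] := eqVneq w' b; first by rewrite ea eb ga gb eqxx in ng.
    by case: (gj (g w') _ (q w')) => //; move=> e; rewrite ea e ga eqxx in ng.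
  - have [eb|nb] := eqVneq w b; first by rewrite ea' eb ga gb eqxx in ng.
    rewrite sedge_sym; case: (gj (g w) _ (q w)) => //.
    by move=> e; rewrite ea' e ga eqxx in ng.
  - have [eb|nb] := eqVneq w b; have [eb'|nb'] := eqVneq w' b.
    + by rewrite eb eb' eqxx in ng.
    + case: (gj (g w') _ (q w')) => //.
      by move=> e; rewrite eb e gb eqxx in ng.
    + rewrite sedge_sym; case: (gj (g w) _ (q w)) => //.
      by move=> e; rewrite eb' e gb eqxx in ng.
    + exact: Qc ng _ _ (qQ _) (qQ _).
exists f; last first.
  move=> w; rewrite /f; case: eqP => _; first by left; rewrite set21.
  by case: eqP => _; [left; rewrite set22 | right; exists (g w)].
split.
  move=> w w'; rewrite /f.
  have [->|na] := eqVneq w a; have [->|na'] := eqVneq w' a => //.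
  - by case: ifP => _ /eqP; rewrite ?(negPf nuv) ?(negPf (nuq _)).
  - by case: ifP => _ /eqP; rewrite eq_sym ?(negPf nuv) ?(negPf (nuq _)).
  - have [->|nb] := eqVneq w b; have [->|nb'] := eqVneq w' b => //.
    + by move/eqP; rewrite (negPf (nvq _)).
    + by move/eqP; rewrite eq_sym (negPf (nvq _)).
    + exact: qinj.
move=> w w' ww'; have [e|ne] := eqVneq (g w) (g w'); last exact: fsym.
have /set2_eqP[[-> ->]|[-> ->]] := cP _ _ ww' (perm_inj e).
  by rewrite /f eqxx eq_sym (negPf nab) eqxx.
by rewrite /f eqxx eq_sym (negPf nab) eqxx sedge_sym.
Qed.

(** The distinguished edges may share ends. The blocks are pairwise disjoint and avoid the ends of
    all distinguished edges, so two copies meet only in such ends, and a common edge would be a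
    common distinguished edge. *)
Lemma pack_blocks (G : sgraph) mu (u v : 'I_k -> G) (j0 : 'I_k -> 'I_r)
    (Z : 'I_k -> 'I_r -> {set G}) :
  (forall i, u i -- v i) ->
  (forall i i', [set u i; v i] = [set u i'; v i'] -> i = i') ->
  (forall i j, pack_bound mu <= #|Z i j|) ->
  (forall i j j' w, j != j' -> w \in Z i j -> #|Z i j' :\: nbr w| <= mu) ->
  (forall i j w, j != j0 i -> w \in Z i j -> u i -- w /\ v i -- w) ->
  packs F G.
Proof.
move=> uv uvinj Zb Zmiss Zn.
pose UV := \bigcup_(i : 'I_k) [set u i; v i].
have leUV : #|UV| <= 2 * k.
  apply: leq_trans (card_bigcup_leq _ _) _.
  apply: (@leq_trans (\sum_(i < k) 2)); last by rewrite sum_nat_const card_ord mulnC.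
  by apply: leq_sum => i _; rewrite cards2; case: (_ != _).
suff: forall s, s <= k -> exists Q : 'I_k -> 'I_r -> {set G},
    [/\ forall i : 'I_k, i < s -> forall j,
          [/\ #|Q i j| = h, Q i j \subset Z i j & [disjoint Q i j & UV]],
        forall i : 'I_k, i < s -> forall j j', j != j' ->
          forall x y, x \in Q i j -> y \in Q i j' -> x -- y
      & forall i i' : 'I_k, i < i' < s -> forall j j', [disjoint Q i' j' & Q i j]].
  move/(_ k (leqnn k)) => [Q [H1 H2 H3]].
  have blk i : exists f : F i -> G, embedding f /\
      forall w, f w \in [set u i; v i] \/ exists j, f w \in Q i j.
    have [||||f fe fP] := @embed_block G i (u i) (v i) (j0 i) (Q i) (uv i).
    - by move=> j; have [-> _ _] := H1 i (ltn_ord i) j.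
    - exact: H2.
    - move=> j; have [_ _] := H1 i (ltn_ord i) j; rewrite disjoint_sym disjoint_subset.
      move/subsetP => d; split; apply: d; apply/bigcupP; exists i; rewrite // ?set21 ?set22 //.
    - move=> j x jj xQ; apply: (Zn i j) => //.
      by have [_ /subsetP QZ _] := H1 i (ltn_ord i) j; apply: QZ.
    - by exists f.
  pose f i := sval (cid (blk i)).
  have fP i : embedding (f i) /\
      forall w, f i w \in [set u i; v i] \/ exists j, f i w \in Q i j.
    exact: svalP (cid (blk i)).
  have QUV j x (l l' : 'I_k) : x \in [set u l; v l] -> x \in Q l' j -> False.
    have [_ _ d] := H1 l' (ltn_ord l') j.
    move=> xl xQ; have : x \in UV by apply/bigcupP; exists l.
    by rewrite (disjointFr d xQ).
  have Qdis (i i' : 'I_k) j j' x : i != i' -> x \in Q i j -> x \in Q i' j' -> False.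
    wlog lt : i i' j j' / i < i'.
      move=> wl ii' xi xi'; case: (ltngtP i i') => [lt|lt|/val_inj e].
      - exact: wl lt ii' xi xi'.
      - by rewrite eq_sym in ii'; apply: wl lt ii' xi' xi.
      - by rewrite e eqxx in ii'.
    move=> _ xi xi'; have d : [disjoint Q i' j' & Q i j] by apply: H3; rewrite lt ltn_ord.
    by rewrite (disjointFr d xi') in xi.
  have key (i i' : 'I_k) (a : F i) (c : F i') : i != i' -> f i a = f i' c ->
      f i a \in [set u i; v i] /\ f i a \in [set u i'; v i'].
    move=> ii' e; have [_ /(_ a) Pa] := fP i; have [_ /(_ c)] := fP i'.
    rewrite -e => Pc; case: Pa Pc => [ua|[j ja]] [ua'|[j' ja']].
    - by [].
    - by case: (QUV _ _ _ _ ua ja').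
    - by case: (QUV _ _ _ _ ua' ja).
    - by case: (Qdis _ _ _ _ _ ii' ja ja').
  exists f; split=> [i|i i' ii' a b c d ab cd e1 e2]; first by have [] := fP i.
  have [[finj fe] _] := fP i.
  have fab : f i a != f i b.
    by apply: contraTneq (fe _ _ ab) => ->; rewrite sedge_irrefl.
  have [a1 a2] := key _ _ _ _ ii' e1; have [b1 b2] := key _ _ _ _ ii' e2.
  have two (x y p q : G) : x != y -> x \in [set p; q] -> y \in [set p; q] ->
      [set x; y] = [set p; q].
    rewrite !inE => xy /orP[]/eqP ex /orP[]/eqP ey; rewrite ex ey in xy *.
    - by rewrite eqxx in xy.
    - by [].
    - by rewrite finset.setUC.
    - by rewrite eqxx in xy.
  have E := two _ _ _ _ fab a1 b1; have E' := two _ _ _ _ fab a2 b2.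
  by rewrite E in E'; rewrite (uvinj _ _ E') eqxx in ii'.
elim=> [_|s IH sk]; first by exists (fun _ _ => set0); split=> // i i'; rewrite ltn0 andbF.
have [Q [H1 H2 H3]] := IH (ltnW sk); pose i0 := Ordinal sk.
pose X := UV :|: \bigcup_(i : 'I_k | i < s) \bigcup_(j : 'I_r) Q i j.
have leX : #|X| <= 2 * k + k * (r * h).
  apply: leq_trans (leq_card_setU _ _) _; apply: leq_add leUV _.
  apply: leq_trans (card_bigcup_leq _ _) _.
  apply: (@leq_trans (\sum_(i < k | i < s) r * h)); last first.
    rewrite sum_nat_const leq_mul2r; apply/orP; right.
    by apply: leq_trans (max_card _) _; rewrite card_ord.
  apply: leq_sum => i is_; apply: leq_trans (card_bigcup_leq _ _) _.
  rewrite -[r in r * h]card_ord -sum_nat_const; apply: leq_sum => j _.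
  by have [-> _ _] := H1 i is_ j.
have [Y [Y1 Y2]] := greedy_multipartite leX (Zb i0) (Zmiss i0).
have small (i : 'I_k) : i < s.+1 -> i <> i0 -> i < s.
  rewrite ltnS leq_eqVlt => /orP[/eqP is_|//] ni.
  by case: ni; apply: val_inj.
exists (fun i => if i == i0 then Y else Q i); split.
- move=> i is_ j; case: eqP => [->|ni]; last exact: H1 (small _ is_ ni) j.
  have [-> YZ p] := Y1 j; split=> //; move: p; rewrite !disjoint_subset => /subsetP d.
  by apply/subsetP => x /d; rewrite !inE negb_or => /andP[].
- move=> i is_; case: eqP => [_|ni] //; apply: H2; apply: small => //.
- move=> i i' /andP[ii' i's] j j'.
  have ni : i <> i0 by move/(congr1 val) => /= ei; move: ii' i's; rewrite ei; lia.
  have is_ : i < s by apply: small => //; lia.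
  case: (i' =P i0) => [_|ni']; case: eqP => // _; last first.
    by apply: H3; rewrite ii' small.
  have [_ _] := Y1 j'; rewrite !disjoint_subset => /subsetP d.
  apply/subsetP => x /d; rewrite !inE negb_or => /andP[_]; apply: contra => xQ.
  by apply/bigcupP; exists i => //; apply/bigcupP; exists j.
Qed.

End PackBlocks.

(** * A weighted Erdos-Stone theorem *)

(** Indexing by [nat] lets an induction on s append a class without a change of type. Classes are
    automatically disjoint, as a common vertex would be adjacent to itself; edges inside a class are
    allowed. *)
Definition multipartite (G : sgraph) s T (A : nat -> {set G}) (U : {set G}) : Prop :=
  (forall j, j < s -> #|A j| = T /\ A j \subset U) /\
  (forall i j, i < s -> j < s -> i != j ->
     forall x y, x \in A i -> y \in A j -> x -- y).

Section WeightedErdosStone.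
Local Open Scope ring_scope.
Variable R : realType.

Section Weights.
Variables (G : sgraph) (y : G -> R).
Implicit Types (U V : {set G}) (u v : G).

Definition wt (U : {set G}) : R := \sum_(u in U) y u.
Definition wdeg (U : {set G}) (v : G) : R := \sum_(u in U | v -- u) y u.
Definition wquad (U : {set G}) : R := \sum_(v in U) y v * wdeg U v.

Lemma wdegD1 U v w : v \in U -> wdeg U w = (if w -- v then y v else 0) + wdeg (U :\ v) w.
Proof.
move=> vU; rewrite /wdeg big_mkcondr (big_setD1 _ vU) /= -big_mkcondr; congr (_ + _).
Qed.

Lemma wquadD1 U v : v \in U -> wquad U = wquad (U :\ v) + 2 * y v * wdeg U v.
Proof.
move=> vU; rewrite /wquad (big_setD1 _ vU) /=.
have dv : wdeg (U :\ v) v = wdeg U v by rewrite (wdegD1 v vU) sedge_irrefl add0r.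
have -> : \sum_(w in U :\ v) y w * wdeg U w =
    y v * wdeg (U :\ v) v + \sum_(w in U :\ v) y w * wdeg (U :\ v) w.
  rewrite /wdeg mulr_sumr [X in _ = X + _]big_mkcondr -big_split /=.
  apply: eq_bigr => w _; rewrite -/(wdeg U w) (wdegD1 w vU) sedge_sym mulrDr.
  by case: ifP => _; rewrite /wdeg ?mulr0 // mulrC.
by rewrite dv; ring.
Qed.

Lemma wdeg_le U v : (forall u, u \in U -> 0 <= y u) -> wdeg U v <= wt U.
Proof.
move=> y0; rewrite /wdeg /wt big_mkcondr; apply: ler_sum => u uU.
by case: ifP => // _; apply: y0.
Qed.

Lemma wquad_le U : (forall u, u \in U -> 0 <= y u) -> wquad U <= wt U ^+ 2.
Proof.
move=> y0; rewrite expr2 {1}/wt mulr_suml; apply: ler_sum => v vU.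
by apply: ler_wpM2l; [apply: y0 | apply: wdeg_le].
Qed.

Lemma wt_support U : wt [set v in U | y v != 0] = wt U.
Proof.
rewrite /wt [RHS](bigID (fun v => y v != 0)) /= [X in _ + X]big1 ?addr0.
  by apply: eq_bigl => v; rewrite inE.
by move=> v /andP[_ /negPn/eqP].
Qed.

Lemma wdeg_support U v : wdeg [set v in U | y v != 0] v = wdeg U v.
Proof.
rewrite /wdeg [RHS](bigID (fun v => y v != 0)) /= [X in _ + X]big1 ?addr0.
  by apply: eq_bigl => u; rewrite inE andbAC.
by move=> u /andP[_ /negPn/eqP].
Qed.

Lemma wquad_support U : wquad [set v in U | y v != 0] = wquad U.
Proof.
rewrite /wquad [RHS](bigID (fun v => y v != 0)) /= [X in _ + X]big1 ?addr0.
  by apply: eq_big => [v|v _]; rewrite ?inE ?wdeg_support.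
by move=> v /andP[_ /negPn/eqP->]; rewrite mul0r.
Qed.

(* Passing to a maximiser of [wquad V - b * wt V ^+ 2] plays the role of deleting vertices of small degree one by one. *)
Lemma prune (U : {set G}) (b : R) : (forall u, u \in U -> 0 <= y u) -> 0 <= b ->
  exists V : {set G}, [/\ V \subset U,
    forall v, v \in V -> 0 < y v /\ b * (wt V - y v) <= wdeg V v
    & wquad U - b * wt U ^+ 2 <= wquad V - b * wt V ^+ 2].
Proof.
move=> y0 b0; pose U0 := [set v in U | y v != 0].
pose Phi (V : {set G}) := wquad V - b * wt V ^+ 2.
pose V := [arg max_(V > U0 | V \subset U0) Phi V]%O.
have [VU0 Vmax] : V \subset U0 /\ forall W : {set G}, W \subset U0 -> Phi W <= Phi V.
  by rewrite /V; case: arg_maxP => // W WU Wmax; split=> // W' /Wmax.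
have V_pos v : v \in V -> 0 < y v.
  by move/(subsetP VU0); rewrite inE => /andP[vU yv]; rewrite lt_neqAle eq_sym yv y0.
exists V; split.
- by apply: fintype.subset_trans VU0 _; apply/subsetP => v; rewrite inE => /andP[].
- move=> v vV; split; first exact: V_pos.
  have := Vmax (V :\ v) (fintype.subset_trans (subsetDl _ _) VU0).
  have yv := V_pos v vV.
  rewrite /Phi (wquadD1 vV); set q := wquad _; set d := wdeg _ _.
  have -> : wt V = y v + wt (V :\ v) by rewrite /wt (big_setD1 _ vV).
  set w := wt _ => H.
  have {}H : b * (2 * (y v * w) + y v ^+ 2) <= 2 * y v * d by nra.
  rewrite [y v + w]addrC addrK -(ler_pM2l (_ : 0 < 2 * y v)) ?mulr_gt0 //.
  nra.
- have := Vmax U0 (subxx _); rewrite /Phi /U0.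
  by rewrite wt_support wquad_support.
Qed.

End Weights.

Lemma archi_bound (x : R) : exists n : nat, x <= n%:R.
Proof.
exists (Num.bound `|x|); apply: le_trans (ler_norm _) (ltW _).
by apply: archi_boundP.
Qed.

Lemma pigeonhole_set (T : finType) (S : {set T}) (B : {set T}) (f : T -> {set T}) n :
  (forall v, v \in B -> f v \subset S) -> (2 ^ #|S| * n < #|B|)%N ->
  exists2 X : {set T}, X \subset S & (n < #|[set v in B | f v == X]|)%N.
Proof.
move=> fS lt; apply/exists_inP; apply: contraTT lt => /exists_inPn H.
rewrite -leqNgt -card_powerset -sum_nat_const -sum1_card.
rewrite (partition_big f (fun X => X \in powerset S)) /=; last first.
  by move=> v /fS; rewrite powersetE.
apply: leq_sum => X; rewrite powersetE => /H; rewrite -leqNgt; apply: leq_trans.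
by rewrite sum1_card; apply: eq_leq; apply: eq_card => v; rewrite !inE.
Qed.

(** Induction on s. Given classes of a much larger size T', counting weighted edges into them shows
    that the vertices with at least T neighbours in every class carry weight eps / 2 of the whole.
    Small single weights make these vertices numerous, so T of them have the same neighbours in the
    classes and form the new class. *)
Lemma multipartite_min_wdeg (s T : nat) (eps : R) : 0 < eps <= 1 ->
  exists2 delta : R, 0 < delta & forall (G : sgraph) (y : G -> R) (U : {set G}),
    (forall v, v \in U -> 0 <= y v) -> 0 < wt y U ->
    (forall v, v \in U -> y v <= delta * wt y U) ->
    (forall v, v \in U -> (s%:R - 1 + eps) * wt y U <= s%:R * wdeg y U v) ->
    exists A, multipartite s.+1 T A U.
Proof.
case/andP=> e0 e1; elim: s T => [|s IH] T.
  exists (T.+1%:R^-1); first by rewrite invr_gt0 ltr0n.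
  move=> G y U y0 W0 yW _; have [Y YU YT] : exists2 Y : {set G}, Y \subset U & #|Y| = T.
    apply: exists_subset_card; rewrite leqNgt; apply/negP => UT.
    have : wt y U <= #|U|%:R * (T.+1%:R^-1 * wt y U).
      by rewrite /wt mulr_natl -sumr_const; apply: ler_sum.
    have : #|U|%:R < T.+1%:R :> R by rewrite ltr_nat ltnS ltnW.
    have T0 : 0 < T.+1%:R :> R by rewrite ltr0n.
    move=> h1; rewrite mulrA leNgt => /negP[]; rewrite gtr_pMl //.
    by rewrite ltr_pdivrMr // mul1r.
  exists (fun _ => Y); split=> // i j; rewrite !ltnS !leqn0 => /eqP-> /eqP->.
  by rewrite eqxx.
have [T' [TT' T'gt0 hT']] : exists T' : nat,
    [/\ (T <= T')%N, (0 < T')%N & 2 * T%:R <= eps * T'%:R].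
  have [T' hT'] := archi_bound (2 * T%:R / eps).
  have h : 2 * T%:R <= eps * T'.+1%:R.
    by rewrite [leRHS]mulrC -ler_pdivrMr // (le_trans hT') // ler_nat.
  exists T'.+1; split=> //; rewrite -(ler_nat R).
  have := ler0n R T; have := ler0n R T'.+1; nra.
have [del' del'0 {}IH] := IH T'.
(* Among N vertices more than T have the same trace on a set of at most (s + 1) T' vertices. *)
pose N := (2 ^ (s.+1 * T') * T).+1.
have N0 : 0 < N%:R :> R by rewrite ltr0n.
exists (Num.min del' (eps / (2 * N%:R))).
  by rewrite lt_min del'0 divr_gt0 // mulr_gt0.
move=> G y U y0 W0 yW dW; set W := wt y U in W0 yW dW *.
have [A [A1 A2]] : exists A, multipartite s.+1 T' A U.
  apply: IH (y0) (W0) _ _ => v vU.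
    by apply: le_trans (yW v vU) _; rewrite ler_wpM2r ?ge_min ?lexx // ltW.
  have := dW v vU; rewrite -/W; set d := wdeg y U v.
  rewrite -[s.+1]addn1 natrD; have := ler0n R s; set s' := s%:R => s0 H.
  (* The required relative degree 1 - (1 - eps) / s increases with s because eps <= 1, so the
     hypothesis for s + 1 implies the one for s. *)
  have : 0 <= (s' + 1) * (s' * d - (s' - 1 + eps) * W) by nra.
  by rewrite pmulr_rge0 ?ltr_wpDl // subr_ge0.
pose B := [set v in U | [forall j : 'I_s.+1, T <= #|nbr v :&: A j|]%N].
have leA (j : 'I_s.+1) v : (#|nbr v :&: A j| <= T')%N.
  by have [<- _] := A1 j (ltn_ord j); apply: subset_leq_card; apply: subsetIr.
have count : \sum_(j < s.+1) \sum_(w in A j) wdeg y U w =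
    \sum_(v in U) y v * (\sum_(j < s.+1) #|nbr v :&: A j|)%:R.
  under [RHS]eq_bigr do rewrite natr_sum mulr_sumr.
  rewrite [RHS]exchange_big /=; apply: eq_bigr => j _.
  rewrite /wdeg (exchange_big_dep (mem U)) //=; last by move=> v u _ /andP[].
  apply: eq_bigr => v vU; rewrite mulr_natr -sumr_const; apply: eq_bigl => w.
  by rewrite !inE sedge_sym andbC vU.
have cl : T'%:R * (s%:R + eps) * W <= \sum_(j < s.+1) \sum_(w in A j) wdeg y U w.
  have s0 : 0 < s.+1%:R :> R by rewrite ltr0n.
  rewrite -(ler_pM2l s0) [leRHS]mulr_sumr.
  apply: (@le_trans _ _ (\sum_(j < s.+1) T'%:R * ((s%:R + eps) * W))).
    by rewrite sumr_const card_ord -[X in _ <= X]mulr_natl !mulrA.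
  apply: ler_sum => j _; have [<- jU] := A1 j (ltn_ord j).
  rewrite mulr_natl -sumr_const [leRHS]mulr_sumr; apply: ler_sum => w wA.
  have := dW w (subsetP jU w wA); rewrite -/W -natr1; apply: le_trans.
  by rewrite ler_wpM2r ?(ltW W0) //; lra.
(* A vertex outside [B] has fewer than T neighbours in one class and at most T' in each of the s
   others; a vertex of [B] is allowed T' more. *)
have cr : \sum_(v in U) y v * (\sum_(j < s.+1) #|nbr v :&: A j|)%:R <=
    (s * T' + T)%:R * W + T'%:R * wt y B.
  rewrite /wt /B !mulr_sumr.
  under [X in _ <= _ + X]eq_bigl do rewrite inE.
  rewrite [X in _ <= _ + X]big_mkcondr -big_split /=; apply: ler_sum => v vU.
  have yv := y0 v vU; case: ifP => vB.
    rewrite -mulrDl -natrD mulrC ler_wpM2r // ler_nat.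
    apply: (@leq_trans (\sum_(j < s.+1) T')); first by apply: leq_sum.
    by rewrite sum_nat_const card_ord mulSn addnC -addnA leq_add2l leq_addl.
  rewrite addr0 mulrC ler_wpM2r // ler_nat.
  have /forallPn[j jT] := negbT vB; rewrite -ltnNge in jT.
  rewrite (bigD1 j) //= addnC; apply: leq_add; last exact: ltnW.
  apply: (@leq_trans (\sum_(i < s.+1 | i != j) T')); first by apply: leq_sum.
  rewrite sum_nat_const leq_mul2r; apply/orP; right.
  have E : #|predC1 j| = s by rewrite cardC1 card_ord.
  by apply: eq_leq; rewrite -[RHS]E; apply: eq_card.
have wB : eps / 2 * W <= wt y B.
  have T'0 : 0 < T'%:R :> R by rewrite ltr0n.
  have : T'%:R * (s%:R + eps) * W <= (s * T' + T)%:R * W + T'%:R * wt y B.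
    by apply: le_trans cl _; rewrite count.
  rewrite natrD natrM => H; rewrite -(ler_pM2l T'0); nra.
have NB : (N <= #|B|)%N.
  rewrite -(ler_nat R).
  have : wt y B <= #|B|%:R * (eps / (2 * N%:R) * W).
    rewrite /wt mulr_natl -sumr_const; apply: ler_sum => v; rewrite inE => /andP[vU _].
    by apply: le_trans (yW v vU) _; rewrite ler_wpM2r ?ge_min ?lexx ?orbT // ltW.
  have q0 : 0 < eps / (2 * N%:R) by rewrite divr_gt0 ?mulr_gt0.
  have -> : eps / (2 * N%:R) = eps / 2 / N%:R by rewrite invfM mulrA.
  move/(le_trans wB); rewrite mulrA ler_pM2r // mulrA ler_pdivlMr //.
  by rewrite mulrC ler_pM2r // divr_gt0.
pose K := \bigcup_(j : 'I_s.+1) A j.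
have KT : (#|K| <= s.+1 * T')%N.
  apply: leq_trans (card_bigcup_leq _ _) _.
  rewrite -[X in (_ <= X * _)%N](card_ord s.+1) -sum_nat_const; apply: leq_sum => j _.
  by have [-> _] := A1 j (ltn_ord j).
have [||X XK Xn] := @pigeonhole_set _ K B (fun v => nbr v :&: K) T.
- by move=> v _; apply: subsetIr.
- by apply: leq_trans NB; rewrite ltnS leq_mul2r leq_pexp2l ?orbT.
have [v0 v0B] : exists v, v \in [set v in B | nbr v :&: K == X].
  by apply/card_gt0P; apply: leq_ltn_trans Xn.
pose trim (Y : {set G}) := [set x in take T (enum Y)].
have trimS (Y : {set G}) : trim Y \subset Y.
  by apply/subsetP => x; rewrite inE => /mem_take; rewrite mem_enum.
have trimT (Y : {set G}) : (T <= #|Y|)%N -> #|trim Y| = T.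
  move=> TY; rewrite cardsE (card_uniqP _) ?take_uniq ?enum_uniq //.
  by rewrite size_take_min -cardE; apply/minn_idPl.
have [fibB fibX] : [set v in B | nbr v :&: K == X] \subset B /\
    forall v x, v \in [set v in B | nbr v :&: K == X] -> x \in X -> v -- x.
  split; first by apply/subsetP => v; rewrite inE => /andP[].
  by move=> v x; rewrite inE => /andP[_ /eqP <-]; rewrite !inE => /andP[].
set fib := [set v in B | _] in Xn v0B fibB fibX.
have BU : B \subset U by apply/subsetP => v; rewrite inE => /andP[].
exists (fun j => if (j == s.+1)%N then trim fib else trim (X :&: A j)).
have small j : (j < s.+2)%N -> (j == s.+1) = false -> (j < s.+1)%N.
  by rewrite ltnS leq_eqVlt => /orP[->|].
split=> [j js|i j is_ js ij x x'].
  case: ifP => [_|nj].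
    split; first by apply: trimT; apply: ltnW.
    by apply: fintype.subset_trans (trimS _) (fintype.subset_trans fibB BU).
  have {js nj}js := small j js nj; have [_ jU] := A1 j js.
  split; last by apply: fintype.subset_trans (trimS _) (fintype.subset_trans (subsetIr _ _) jU).
  apply: trimT; move: v0B; rewrite !inE => /andP[/andP[_ /forallP/(_ (Ordinal js)) /= h] /eqP <-].
  apply: leq_trans h _; apply: subset_leq_card; apply/subsetP => x.
  rewrite !inE => /andP[-> xA]; rewrite xA andbT /=.
  by apply/bigcupP; exists (Ordinal js).
have cross i' z z' : z \in trim fib -> z' \in trim (X :&: A i') -> z -- z'.
  move=> /(subsetP (trimS _)) zf /(subsetP (trimS _)); rewrite inE => /andP[zX _].
  exact: fibX.
case: ifP => [/eqP ei|ni]; case: ifP => [/eqP ej|nj].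
- by rewrite ei ej eqxx in ij.
- exact: cross.
- by move=> xi xj; rewrite sedge_sym; apply: cross xj xi.
- move=> /(subsetP (trimS _)); rewrite inE => /andP[_ xi].
  move=> /(subsetP (trimS _)); rewrite inE => /andP[_ xj].
  exact: A2 (small i is_ ni) (small j js nj) ij _ _ xi xj.
Qed.

(** Pruning at a level b slightly below the given density yields a set [V] with large minimum
    degree. The surplus c of the quadratic form survives in [V], whence wt V >= c * wt U; this
    explains delta = c * m, as single weights must be small relative to [V]. *)
Lemma multipartite_wquad (s T : nat) (eps : R) : (0 < s)%N -> 0 < eps <= 1 ->
  exists2 delta : R, 0 < delta & forall (G : sgraph) (y : G -> R) (U : {set G}),
    (forall v, v \in U -> 0 <= y v) -> 0 < wt y U ->
    (forall v, v \in U -> y v <= delta * wt y U) ->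
    (s%:R - 1 + eps) * wt y U ^+ 2 <= s%:R * wquad y U ->
    exists A, multipartite s.+1 T A U.
Proof.
move=> s0 /andP[e0 e1].
have sR : 1 <= s%:R :> R by rewrite ler1n.
have [|del' del'0 ES] := @multipartite_min_wdeg s T (eps / 4).
  by apply/andP; split; lra.
pose c : R := eps / (2 * s%:R).
have c0 : 0 < c by rewrite divr_gt0 ?mulr_gt0 //; lra.
have cE : 2 * s%:R * c = eps by rewrite /c mulrC mulfVK // mulf_neq0 // gt_eqF //; lra.
have c1 : c <= 1 by nra.
pose m := Num.min del' (c / 2).
have m0 : 0 < m by rewrite lt_min del'0 divr_gt0.
have md : m <= del' by rewrite ge_min lexx.
have mc : m <= c / 2 by rewrite ge_min lexx orbT.
exists (c * m); first by rewrite mulr_gt0.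
move=> G y U y0 W0 yW QW; pose b := (s%:R - 1 + eps / 2) / s%:R.
have bs : s%:R * b = s%:R - 1 + eps / 2.
  by rewrite /b mulrC mulfVK // gt_eqF //; lra.
have b0 : 0 <= b by rewrite divr_ge0 //; lra.
have [V [VU Vdeg Vq]] := prune y0 b0.
have y0V v : v \in V -> 0 <= y v by move=> vV; apply: y0; apply: (subsetP VU).
have VQ := wquad_le y0V.
have W'0 : 0 <= wt y V by apply: sumr_ge0.
set W := wt y U in W0 yW QW Vq; set W' := wt y V in Vdeg Vq VQ W'0.
set Q := wquad y U in QW Vq; set Q' := wquad y V in Vq VQ.
have h1 : c * W ^+ 2 <= Q - b * W ^+ 2.
  rewrite -(ler_pM2l (_ : 0 < s%:R)); last by lra.
  have -> : s%:R * (Q - b * W ^+ 2) = s%:R * Q - s%:R * b * W ^+ 2 by ring.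
  have -> : s%:R * (c * W ^+ 2) = 2 * s%:R * c * W ^+ 2 / 2 by field.
  by rewrite bs cE; lra.
have h2 : (c * W) ^+ 2 <= W' ^+ 2.
  apply: (@le_trans _ _ (c * W ^+ 2)); first by rewrite exprMn ler_wpM2r ?sqr_ge0 //; nra.
  have := mulr_ge0 b0 (sqr_ge0 W'); lra.
have h3 : c * W <= W'.
  by rewrite -(ler_pXn2r (_ : 0 < 2)%N) ?nnegrE // mulr_ge0 // ltW.
have W'p : 0 < W' by apply: lt_le_trans h3; rewrite mulr_gt0.
have yW' v : v \in V -> y v <= m * W'.
  move=> vV; apply: le_trans (yW v (subsetP VU v vV)) _; rewrite mulrAC.
  by rewrite mulrC ler_wpM2l // ltW.
suff [A [A1 A2]] : exists A, multipartite s.+1 T A V.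
  exists A; split=> // j js; have [Aj AV] := A1 j js; split=> //.
  exact: fintype.subset_trans AV VU.
apply: (ES G y V) => // v vV.
  by apply: le_trans (yW' v vV) _; rewrite ler_wpM2r.
have [yv dv] := Vdeg v vV; have yv' := yW' v vV.
apply: (@le_trans _ _ (s%:R * (b * (W' - y v)))); last by rewrite ler_wpM2l //; lra.
have sy : s%:R * y v <= eps / 4 * W'.
  apply: (@le_trans _ _ (s%:R * (c / 2 * W'))).
    rewrite ler_wpM2l ?ler0n //.
    by apply: le_trans yv' _; rewrite ler_wpM2r.
  have -> : s%:R * (c / 2 * W') = 2 * s%:R * c / 4 * W' by field.
  by rewrite cE.
rewrite mulrA bs -/W'.
have h5 : 0 <= (1 - eps / 2) * y v by rewrite mulr_ge0 ?y0V //; lra.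
lra.
Qed.

End WeightedErdosStone.

(** * Weights and degrees under a large spectral radius *)

Section HighDegree.
Local Open Scope ring_scope.
Variable R : realType.

Definition eigenweight (G : sgraph) (x : G -> R) : Prop :=
  [/\ forall v, 0 <= x v, \sum_v x v ^+ 2 = #|G|%:R
    & forall v, \sum_(u | v -- u) x u = rho R G * x v].

Lemma eigenweight_exists (G : sgraph) : (0 < #|G|)%N -> exists x, @eigenweight G x.
Proof.
move=> G0; have [x [x0 xn xE]] := rho_perron R G0.
pose c := Num.sqrt (#|G|%:R / \sum_v x v ^+ 2).
exists (fun v => c * x v); split.
- by move=> v; rewrite mulr_ge0 ?sqrtr_ge0.
- under eq_bigr do rewrite exprMn.
  rewrite -mulr_sumr sqr_sqrtr; last by rewrite divr_ge0 ?ler0n // ltW.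
  by rewrite divfK // gt_eqF.
- by move=> v; rewrite -mulr_sumr xE mulrCA.
Qed.

Section Weight.
Variables (G : sgraph) (x : G -> R).
Hypothesis xP : eigenweight x.
Let n : R := #|G|%:R.
Let S : R := wt x [set: G].

Lemma eigenweight_wdeg v : wdeg x [set: G] v = rho R G * x v.
Proof. by have [_ _ <-] := xP; apply: eq_bigl => u; rewrite in_setT. Qed.

Lemma eigenweight_wquad : wquad x [set: G] = rho R G * n.
Proof.
have [_ xn xE] := xP; rewrite /wquad /n -xn mulr_sumr; apply: eq_big => [v|v _].
  by rewrite in_setT.
by rewrite eigenweight_wdeg expr2 mulrCA.
Qed.

Lemma eigenweight_sqdist : \sum_v (x v - 1) ^+ 2 = 2 * (n - S).
Proof.
have [_ xn xE] := xP; have -> : 2 * (n - S) = n - 2 * S + n by ring.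
have -> : S = \sum_v x v by apply: eq_bigl => u; rewrite in_setT.
have -> : n - 2 * \sum_v x v + n = \sum_v (x v ^+ 2 - 2 * x v + 1).
  by rewrite big_split sumrB /= xn -mulr_sumr sumr_const cardT -cardE.
by apply: eq_bigr => v _; ring.
Qed.

Lemma eigenweight_wt_le : S <= n.
Proof.
have : 0 <= 2 * (n - S) by rewrite -eigenweight_sqdist sumr_ge0 // => v _; apply: sqr_ge0.
by rewrite pmulr_rge0 // subr_ge0.
Qed.

(** Sum |t| <= b + t^2 / (4 b) with t = x v - 1 over all vertices and use [eigenweight_sqdist]. For
    N a neighbourhood, this converts an eigenvector entry into a degree. *)
Lemma wt_near_card (b : R) (N : {set G}) : 0 < b -> n * (1 - 3 * b ^+ 2) <= S ->
  `|wt x N - #|N|%:R| <= 3 * b * n.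
Proof.
move=> b0 Sn.
have -> : wt x N - #|N|%:R = \sum_(v in N) (x v - 1) by rewrite sumrB sumr_const.
apply: le_trans (ler_norm_sum _ _ _) _.
apply: (@le_trans _ _ (\sum_v (b + (x v - 1) ^+ 2 / (4 * b)))).
  rewrite [leLHS]big_mkcond; apply: ler_sum => v _; set t := x v - 1.
  have t0 : 0 <= t ^+ 2 / (4 * b) by rewrite divr_ge0 ?sqr_ge0 // mulr_ge0 // ltW.
  case: ifP => _; last by rewrite addr_ge0 // ltW.
  have b4 : 0 < 4 * b by rewrite mulr_gt0.
  rewrite -(ler_pM2r b4); have -> : (b + t ^+ 2 / (4 * b)) * (4 * b) = 4 * b ^+ 2 + t ^+ 2.
    by field; rewrite gt_eqF.
  by rewrite -[t ^+ 2]real_normK ?num_real //; have := sqr_ge0 (`|t| - 2 * b); lra.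
rewrite big_split /= -mulr_suml eigenweight_sqdist sumr_const cardT -cardE -mulr_natr -/n.
have n0 : 0 <= n by apply: ler0n.
have h : 2 * (n - S) / (4 * b) <= 2 * b * n.
  by rewrite ler_pdivrMr ?mulr_gt0 //; nra.
lra.
Qed.

End Weight.

(** Erdos-Stone is used twice: [ES1] in contraposition bounds the density of every heavy set, and
    [ES2] finds the r classes inside a pruned set. The loss 7 b consists of b from the pruning
    level, 2 b from the weight outside the pruned set, 3 b from replacing weight by cardinality, and
    b for additive constants. *)
Lemma high_degree_multipartite (r T T0 : nat) (b : R) :
  (1 < r)%N -> 0 < b -> 2 * r%:R ^+ 2 * b <= 1 ->
  exists n1 : nat, forall (G : sgraph) (x : G -> R), (n1 <= #|G|)%N ->
    eigenweight x -> #|G|%:R * (1 - r%:R^-1) - 1 <= rho R G ->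
    ~ (exists A, multipartite r.+1 T0 A [set: G]) ->
    (forall N : {set G}, `|wt x N - #|N|%:R| <= 3 * b * #|G|%:R) /\
    exists A, multipartite r T A [set: G] /\
      forall j w, (j < r)%N -> w \in A j ->
        (1 - r%:R^-1 - 7 * b) * #|G|%:R <= #|nbr w|%:R.
Proof.
move=> r1 b0 rb.
have r2 : 2 <= r%:R :> R by rewrite (ler_nat R 2).
pose ri : R := r%:R^-1.
have riE : r%:R * ri = 1 by rewrite /ri mulfV // gt_eqF //; lra.
have ri0 : 0 < ri by rewrite invr_gt0; lra.
have ri2 : ri <= 1 / 2 by nra.
pose a := 1 - ri.
have r4 : 4 <= r%:R ^+ 2 :> R by nra.
have b8 : b <= 1 / 8 by have := ler_wpM2r (ltW b0) r4; lra.
have b1 : b ^+ 2 <= b / 8 by rewrite expr2; have := ler_wpM2l (ltW b0) b8; lra.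
have [|d1 d10 ES1] := @multipartite_wquad R r T0 (b ^+ 2) (ltnW r1).
  by apply/andP; split; [rewrite exprn_gt0 | nra].
have [|d2 d20 ES2] := @multipartite_min_wdeg R r.-1 T (ri / 4).
  by apply/andP; split; lra.
pose d := Num.min d1 (Num.min d2 (ri ^+ 2 / 4)).
have d0 : 0 < d by rewrite !lt_min d10 d20 divr_gt0 ?exprn_gt0.
have dd1 : d <= d1 by rewrite ge_min lexx.
have dd2 : d <= d2 by rewrite !ge_min lexx orbT.
have dd3 : d <= ri ^+ 2 / 4 by rewrite !ge_min lexx !orbT.
have [n1 n1P] := archi_bound (16 / b ^+ 2 + 16 / (b * d)).
exists n1.+1 => G x nG xP rhoG noK.
pose n : R := #|G|%:R; have [x0 xn xE] := xP.
have n0 : 0 < n by rewrite ltr0n; apply: leq_trans nG.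
have [nb nd] : 16 <= b ^+ 2 * n /\ 16 <= b * d * n.
  have p1 : 0 < 16 / b ^+ 2 by rewrite divr_gt0 ?exprn_gt0.
  have p2 : 0 < 16 / (b * d) by rewrite divr_gt0 ?mulr_gt0.
  have nn : n1%:R <= n by rewrite ler_nat ltnW.
  split; rewrite mulrC -ler_pdivrMr ?exprn_gt0 ?mulr_gt0 //; lra.
have nb1 : 16 * 8 <= b * n by nra.
have n8 : 16 * 8 * 8 <= n by nra.
set rh := rho R G in rhoG.
have {}rhoG : n * a - 1 <= rh by [].
pose S := wt x [set: G].
have Sn : S <= n by apply: eigenweight_wt_le.
have S0 : 0 <= S by apply: sumr_ge0.
have rh4 : n / 4 <= rh by rewrite /a in rhoG; nra.
have xS v : x v * n <= 4 * S.
  have : rh * x v <= S by rewrite -eigenweight_wdeg // wdeg_le.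
  by have := x0 v; nra.
have x4 v : x v <= 4 by have := xS v; have := x0 v; nra.
have Q : wquad x [set: G] = rh * n by apply: eigenweight_wquad.
(* A denser set would contain the (r + 1)-partite graph excluded by [noK]. The weight threshold
   makes the entries of [x], all at most 4, relatively small. *)
have up (U : {set G}) : b * n / 2 <= wt x U -> wquad x U <= (a + b ^+ 2) * wt x U ^+ 2.
  move=> WU; rewrite leNgt; apply/negP => lt; apply: noK.
  have [||||A [A1 A2]] := ES1 G x U.
  - by [].
  - by apply: lt_le_trans WU; rewrite divr_gt0 ?mulr_gt0.
  - move=> v _; apply: le_trans (x4 v) _.
    apply: (@le_trans _ _ (d * wt x U)); last by rewrite ler_wpM2r // (le_trans _ WU) // divr_ge0 // mulr_ge0 // ltW.
    have := ler_wpM2l (ltW d0) WU; lra.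
  - have : r%:R * ((a + b ^+ 2) * wt x U ^+ 2) <= r%:R * wquad x U.
      by rewrite ler_wpM2l ?ler0n // ltW.
    apply: le_trans; rewrite mulrA ler_wpM2r ?sqr_ge0 //.
    by rewrite /a mulrDr mulrBr riE mulr1; have := sqr_ge0 b; nra.
  - by exists A; split=> // j jr; have [-> _] := A1 j jr.
have Wsq : n ^+ 2 * (1 - 3 * b ^+ 2) <= S ^+ 2.
  have SQ : rh * n <= S ^+ 2.
    by rewrite -Q; apply: wquad_le.
  have h : b * n / 2 <= S.
    rewrite -(ler_pXn2r (_ : 0 < 2)%N) ?nnegrE //; last by rewrite divr_ge0 ?mulr_ge0 // ltW.
    apply: le_trans SQ; nra.
  have := up [set: G] h; rewrite -/S Q => H.
  have c0 := sqr_ge0 b; set c := b ^+ 2 in nb H c0 *.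
  have k1 : (a + c) * (1 - 3 * c) <= a - c / 2.
    have : 0 <= (a - 1 / 2) * c by rewrite mulr_ge0 // /a; lra.
    have := sqr_ge0 c; rewrite expr2; lra.
  have k2 : n ^+ 2 * (a - c / 2) <= n * (n * a - 1).
    have := ler_wpM2l (ltW n0) nb; rewrite expr2; lra.
  have k3 := ler_wpM2l (ltW n0) rhoG.
  have k4 := ler_wpM2l (sqr_ge0 n) k1.
  have ac : 0 < a + c by rewrite /a; lra.
  rewrite -(ler_pM2l ac); lra.
have Sb : n * (1 - 3 * b ^+ 2) <= S by nra.
have near N := @wt_near_card G x xP b N b0 Sb.
split=> //.
have bb0 : 0 <= a - b by rewrite /a; lra.
(* Pruning at density a - b leaves a surplus of about b n^2 in [V]. Since [up] caps the density of
   [V] at a + b^2, its weight is at least n (1 - 2 b). *)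
have [V [VU Vdeg VQ]] := @prune R G x [set: G] (a - b) (fun u _ => x0 u) bb0.
rewrite Q -/S in VQ; pose W := wt x V.
have W0 : 0 <= W by apply: sumr_ge0.
have WS : W <= S.
  by rewrite /W /S /wt [leRHS](big_setID V) /= finset.setTI lerDl sumr_ge0.
have low : b * n ^+ 2 - n <= wquad x V - (a - b) * W ^+ 2.
  have k3 := ler_wpM2l (ltW n0) rhoG.
  have k1 : (a - b) * S ^+ 2 <= (a - b) * n ^+ 2.
    by rewrite ler_wpM2l // ler_pXn2r ?nnegrE // ltW.
  apply: le_trans VQ; rewrite !expr2 in k1 *; lra.
have Wb : b * n / 2 <= W.
  have WQ := @wquad_le R G x V (fun v _ => x0 v); rewrite -/W in WQ.
  have k1 : b * n ^+ 2 - n <= W ^+ 2.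
    have : 0 <= (a - b) * W ^+ 2 by rewrite mulr_ge0 ?sqr_ge0.
    lra.
  rewrite -(ler_pXn2r (_ : 0 < 2)%N) ?nnegrE //; last by rewrite divr_ge0 ?mulr_ge0 // ltW.
  apply: le_trans k1.
  have k2 : (b * n / 2) ^+ 2 = b ^+ 2 * n ^+ 2 / 4 by field.
  have k3 := ler_wpM2r (sqr_ge0 n) b1.
  have k4 := ler_wpM2l (ltW n0) nb1.
  have n20 : 0 <= b * n ^+ 2 by rewrite mulr_ge0 ?sqr_ge0 // ltW.
  rewrite k2; rewrite !expr2 in k3 n20 *; lra.
have W2 : n * (1 - 2 * b) <= W.
  have := up V Wb; rewrite -/W => H.
  have bb : 0 < b + b ^+ 2 by rewrite addr_gt0 ?exprn_gt0.
  have WW : W ^+ 2 <= n * W by rewrite expr2 ler_wpM2r // (le_trans WS).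
  have k1 : n * (b * n - 1) <= n * ((b + b ^+ 2) * W).
    have := ler_wpM2l (ltW bb) WW; rewrite !expr2 in low *; lra.
  rewrite ler_pM2l // in k1.
  rewrite -(ler_pM2l bb); apply: le_trans k1.
  have -> : (b + b ^+ 2) * (n * (1 - 2 * b)) = b * n - b ^+ 2 * n - 2 * b * (b ^+ 2 * n) by ring.
  have : 0 <= 2 * b * (b ^+ 2 * n) by rewrite !mulr_ge0 // ?sqr_ge0 // ltW.
  lra.
have W32 : 32 * r%:R ^+ 2 <= W.
  have k1 : 64 <= b * n * ri ^+ 2.
    have := ler_wpM2l (mulr_ge0 (ltW b0) (ltW n0)) dd3; lra.
  have k2 := ler_wpM2l (sqr_ge0 r%:R) k1.
  have k3 : r%:R ^+ 2 * (b * n * ri ^+ 2) = b * n.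
    have -> : r%:R ^+ 2 * (b * n * ri ^+ 2) = (r%:R * ri) ^+ 2 * (b * n) by ring.
    by rewrite riE expr1n mul1r.
  lra.
have [|||A [A1 A2]] := ES2 G x V (fun v _ => x0 v).
- by rewrite -/W; lra.
- move=> v _; rewrite -/W; apply: le_trans (x4 v) _.
  have k1 := ler_wpM2l (ltW d0) Wb; have k2 := ler_wpM2r W0 dd2.
  lra.
- move=> v vV; rewrite -/W; have [_ dv] := Vdeg v vV; rewrite -/W in dv.
  have sE : r.-1%:R = r%:R - 1 :> R by rewrite -subn1 natrB // ltnW.
  have s0 : 0 <= r%:R - 1 :> R by lra.
  rewrite sE; apply: le_trans (ler_wpM2l s0 dv); rewrite mulrA.
  have rb2 : r%:R * b <= ri / 2.
    have := ler_wpM2l (ltW ri0) rb.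
    have -> : ri * (2 * r%:R ^+ 2 * b) = 2 * (r%:R * ri) * (r%:R * b) by ring.
    by rewrite riE; lra.
  have k1 : r%:R - 2 + ri / 2 <= (r%:R - 1) * (a - b).
    have -> : (r%:R - 1) * (a - b) = r%:R - 1 - r%:R * ri + ri - r%:R * b + b by rewrite /a; ring.
    by rewrite riE; lra.
  have Wx : 0 <= W - x v by have := x4 v; lra.
  have k2 := ler_wpM2r Wx k1; apply: le_trans k2.
  have k3 : (r%:R - 2 + ri / 2) * x v <= r%:R * 4.
    by apply: ler_pM => //; have := x4 v; have := x0 v; lra.
  have k4 := ler_wpM2l (ltW ri0) W32.
  have k5 : ri * (32 * r%:R ^+ 2) = 32 * r%:R.
    have -> : ri * (32 * r%:R ^+ 2) = 32 * (r%:R * ri) * r%:R by ring.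
    by rewrite riE mulr1.
  lra.
exists A; split.
  by rewrite -(prednK (ltnW r1)); split=> // j jr; have [-> _] := A1 j jr.
move=> j w; rewrite -{1}(prednK (ltnW r1)) => jr wA.
have [_ /subsetP AV] := A1 j jr; have [_ dw] := Vdeg w (AV w wA).
have := near (nbr w); rewrite ler_norml => /andP[_].
have -> : wt x (nbr w) = rh * x w by rewrite -xE; apply: eq_bigl => u; rewrite inE.
have dW : wdeg x V w <= rh * x w.
  rewrite -eigenweight_wdeg // /wdeg !big_mkcondr /= [leRHS](big_setID V) /= finset.setTI lerDl.
  by apply: sumr_ge0 => u _; case: ifP.
rewrite -/W in dw; have xw := x4 w.
have k1 : n * (1 - 2 * b) - 4 <= W - x w by lra.
have k2 := ler_wpM2l bb0 k1.
have k3 : (a - b) * (n * (1 - 2 * b) - 4) = a * n - b * n - 2 * (a * (b * n)) + 2 * (b ^+ 2 * n) - 4 * (a - b) by ring.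
have k4 : a * (b * n) <= b * n by rewrite ler_piMl ?mulr_ge0 ?(ltW b0) ?(ltW n0) // /a; lra.
rewrite -/n -/ri -/a; have a1 : a <= 1 by rewrite /a; lra.
lra.
Qed.

End HighDegree.

(** * Structure of extremal graphs *)

Lemma exists_inj_ord (T : finType) (A : {set T}) k : k <= #|A| ->
  exists2 e : 'I_k -> T, injective e & forall i, e i \in A.
Proof.
move=> kA; exists (fun i => enum_val (widen_ord kA i)) => [i j /enum_val_inj e|i].
  by apply: val_inj; move/(congr1 val): e.
exact: enum_valP.
Qed.

Lemma cards_setD_setI (T : finType) (A B : {set T}) : #|A :\: B| + #|A :&: B| = #|A|.
Proof. by rewrite cardsD subnK // subset_leq_card // subsetIl. Qed.

Lemma sum_card_nbr (G : sgraph) (A : {set G}) :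
  \sum_v #|A :&: nbr v| = \sum_(w in A) #|nbr w|.
Proof.
under eq_bigr do rewrite -sum1_card; under [RHS]eq_bigr do rewrite -sum1_card.
rewrite (exchange_big_dep (mem A)) /=; last by move=> v u _; rewrite inE => /andP[].
apply: eq_bigr => w wA; apply: eq_bigl => v.
by rewrite !inE wA sedge_sym.
Qed.

Definition inner_in (G : sgraph) r (c : G -> 'I_r) (D : {set G}) : {set {set G}} :=
  [set e in inner c | e \subset D].

Lemma inner_in_setT (G : sgraph) r (c : G -> 'I_r) : inner_in c [set: G] = inner c.
Proof. by apply/setP => e; rewrite inE finset.subsetT andbT. Qed.

Lemma inner_degree (G : sgraph) r (c : G -> 'I_r) (D : {set G}) w : w \in D ->
  #|[set v in D | c v == c w] :&: nbr w| <= #|inner_in c D|.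
Proof.
move=> wD; rewrite -(card_in_imset (f := fun v => [set v; w])); last first.
  move=> v v'; rewrite !inE => /andP[_ wv] _ /set2_eqP[[]|[e]] //.
  by rewrite e sedge_irrefl in wv.
apply/subset_leq_card/subsetP => e /imsetP[v]; rewrite !inE => /andP[/andP[vD /eqP cv] wv] ->.
apply/andP; split; first by apply/innerP; exists v, w; rewrite sedge_sym.
by apply/subsetP => z; rewrite !inE => /orP[]/eqP->.
Qed.

Section Blocks.
Variables (k r : nat) (F : 'I_k -> sgraph).
Hypothesis F_critical : forall i, color_critical (F i) /\ chi (F i) = r.+1.
Hypothesis k_gt0 : 0 < k.
Hypothesis r_gt1 : 1 < r.
Variable G : sgraph.

(** The k distinguished edges form a star at v. The candidate sets depend on the other end u,
    because outside class j0 they must consist of common neighbours of v and u. *)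
Lemma pack_star mu (v : G) (j0 : 'I_r) (U : {set G}) (Z : G -> 'I_r -> {set G}) :
  k <= #|U| -> (forall u, u \in U -> v -- u) ->
  (forall u j, u \in U -> pack_bound r F mu <= #|Z u j|) ->
  (forall u j j' w, u \in U -> j != j' -> w \in Z u j -> #|Z u j' :\: nbr w| <= mu) ->
  (forall u j w, u \in U -> j != j0 -> w \in Z u j -> v -- w /\ u -- w) ->
  packs F G.
Proof.
move=> /exists_inj_ord[e einj eU] vU Zb Zm Zn.
apply: (@pack_blocks k r F F_critical G mu (fun _ => v) e (fun _ => j0) (fun i => Z (e i))).
- by move=> i; apply: vU.
- move=> i i' /set2_eqP[[_ /einj]|[e1 e2]] //.
  by have := vU _ (eU i); rewrite e2 sedge_irrefl.
- by move=> i j; apply: Zb.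
- by move=> i j j' w; apply: Zm.
- by move=> i j w; apply: Zn.
Qed.

Lemma pack_inner mu (c : G -> 'I_r) (D : {set G}) (Z : G -> G -> 'I_r -> {set G}) :
  k <= #|inner_in c D| ->
  (forall u v j, u \in D -> v \in D -> u -- v -> c u = c v ->
     pack_bound r F mu <= #|Z u v j|) ->
  (forall u v j j' w, u \in D -> v \in D -> c u = c v -> j != j' -> w \in Z u v j ->
     #|Z u v j' :\: nbr w| <= mu) ->
  (forall u v j w, j != c u -> w \in Z u v j -> u -- w /\ v -- w) ->
  packs F G.
Proof.
move=> /exists_inj_ord[e einj eI] Zb Zm Zn.
have /(_ _)/cid ex i : exists p : G * G, [/\ p.1 -- p.2, c p.1 = c p.2,
    e i = [set p.1; p.2], p.1 \in D & p.2 \in D].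
  have := eI i; rewrite inE => /andP[/innerP[a [b [ab cab E]]] /subsetP sD].
  by exists (a, b); split=> //; apply: sD; rewrite E ?set21 ?set22.
pose p i := sval (ex i).
have pP i : [/\ (p i).1 -- (p i).2, c (p i).1 = c (p i).2,
    e i = [set (p i).1; (p i).2], (p i).1 \in D & (p i).2 \in D] := svalP (ex i).
apply: (@pack_blocks k r F F_critical G mu (fun i => (p i).1) (fun i => (p i).2)
  (fun i => c (p i).1) (fun i => Z (p i).1 (p i).2)).
- by move=> i; case: (pP i).
- by move=> i i' E; apply: einj; case: (pP i) => _ _ -> _ _; case: (pP i') => _ _ -> _ _; exact: E.
- by move=> i j; case: (pP i) => ab cab _ aD bD; apply: Zb.
- by move=> i j j' w; case: (pP i) => ab cab _ aD bD; apply: Zm.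
- by move=> i j w; apply: Zn.
Qed.

Let M0 := pack_bound r F 0.

Lemma multipartite_miss s T (A : nat -> {set G}) U i j w :
  multipartite s T A U -> i < s -> j < s -> i != j -> w \in A i ->
  A j :\: nbr w = set0.
Proof.
move=> [_ A2] is_ js ij wA; apply/setP => x; rewrite !inE; apply/negbTE.
by rewrite negb_and negbK; case: (boolP (x \in A j)) => xA; rewrite ?orbT // (A2 i j).
Qed.

Lemma multipartite_succ_packs T (A : nat -> {set G}) :
  M0 + k <= T -> multipartite r.+1 T A [set: G] -> packs F G.
Proof.
move=> MT AP; have [A1 A2] := AP.
have rr : r < r.+1 by []. have r0 : 0 < r.+1 by []. have r0' : 0 < r := ltnW r_gt1.
have small (j : 'I_r) : j < r.+1 by apply: ltnW; rewrite ltnS.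
have [v vA] : exists v, v \in A r.
  by apply/card_gt0P; have [-> _] := A1 r rr; apply: leq_trans MT; rewrite addn_gt0 k_gt0 orbT.
apply: (@pack_star 0 v (Ordinal r0') (A 0) (fun _ j => A j)).
- by have [-> _] := A1 0 r0; apply: leq_trans MT; rewrite leq_addl.
- by move=> u uA; apply: (A2 r 0) => //; rewrite -lt0n.
- move=> u j _; have [-> _] := A1 j (small j).
  by apply: leq_trans MT; rewrite leq_addr.
- by move=> u j j' w _ jj' wA; rewrite (@multipartite_miss r.+1 T A setT j j') ?cards0.
- move=> u j w uA j0 wA; split.
    by apply: (A2 r j) => //; rewrite neq_ltn ltn_ord orbT.
  by apply: (A2 0 j) => //; rewrite eq_sym; apply: contra j0 => /eqP e; apply/eqP/val_inj.
Qed.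

Section Classify.
Variables (T : nat) (A : nat -> {set G}).
Hypothesis AP : multipartite r T A [set: G].
Hypothesis no_pack : ~ packs F G.

(** With M0 + k neighbours in every class, v would be the centre of a packed star with leaves in
    [A j0]. Class j0 itself can be used whole, since neither end of a distinguished edge needs
    neighbours there. *)
Lemma sparse_class : M0 <= T -> forall v, exists i : 'I_r, #|A i :&: nbr v| < M0 + k.
Proof.
move=> MT v; apply/existsP; apply: contra_notT no_pack => /existsPn H.
have {}H (i : 'I_r) : M0 + k <= #|A i :&: nbr v| by rewrite leqNgt H.
have [A1 A2] := AP; pose j0 : 'I_r := Ordinal (ltnW r_gt1).
apply: (@pack_star 0 v j0 (A j0 :&: nbr v)
  (fun _ j => if j == j0 then A j0 else A j :&: nbr v)).
- by apply: leq_trans (H j0); rewrite leq_addl.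
- by move=> u; rewrite !inE => /andP[].
- move=> u j _; case: ifP => _; last by apply: leq_trans (H j); rewrite leq_addr.
  by have [-> _] := A1 j0 (ltn_ord _).
- move=> u j j' w _ jj' wA.
  have {}wA : w \in A j by move: wA; case: eqP => [->|_] //; rewrite inE => /andP[].
  rewrite leqn0 cards_eq0; apply/eqP/setP => x; rewrite !inE.
  case xw : (w -- x) => //=; apply/negbTE; apply/negP => xA.
  suff : w -- x by rewrite xw.
  apply: (A2 j j') => //; move: xA; case: eqP => [->|_] //.
  by rewrite inE => /andP[].
- move=> u j w; rewrite !inE => /andP[uA _] /negPf jj0; rewrite jj0 !inE => /andP[wA vw].
  split=> //; apply: (A2 j0 j) => //.
  by rewrite eq_sym; apply/negP => /eqP/val_inj/eqP; rewrite jj0.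
Qed.

Definition good (c : G -> 'I_r) q : {set G} :=
  [set v | [forall j : 'I_r, (j != c v) ==> (#|A j :\: nbr v| <= q)]].

Lemma good_inner c q : M0 + 2 * q <= T -> #|inner_in c (good c q)| < k.
Proof.
move=> qT; rewrite ltnNge; apply/negP => le; apply: no_pack; have [A1 A2] := AP.
apply: (@pack_inner 0 c (good c q)
  (fun u v j => if j == c u then A j else A j :&: nbr u :&: nbr v) le).
- move=> u v j uD vD uv cuv; have [Aj _] := A1 j (ltn_ord j); case: eqP => [_|/eqP jc].
    by rewrite Aj; apply: leq_trans qT; apply: leq_addr.
  move: uD vD; rewrite !inE => /forallP/(_ j); rewrite jc /= => hu.
  move=> /forallP/(_ j); rewrite -cuv jc /= => hv.
  have e1 := cards_setD_setI (A j) (nbr u).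
  have e2 := cards_setD_setI (A j :&: nbr u) (nbr v).
  have e3 : #|(A j :&: nbr u) :\: nbr v| <= #|A j :\: nbr v|.
    by apply/subset_leq_card/finset.setSD/subsetIl.
  rewrite Aj in e1; move: (leq_trans e3 hv) => {}e3; rewrite -/M0.
  clear -e1 e2 e3 hu qT; lia.
- move=> u v j j' w _ _ _ jj' wA.
  have {}wA : w \in A j by move: wA; case: eqP => [->|_] //; rewrite !inE => /andP[/andP[]].
  rewrite leqn0 cards_eq0; apply/eqP/setP => x; rewrite !inE.
  case xw : (w -- x) => //=; apply/negbTE; apply/negP => xA.
  suff : w -- x by rewrite xw.
  apply: (A2 j j') => //; move: xA; case: eqP => [->|_] //.
  by rewrite !inE => /andP[/andP[]].
- by move=> u v j w /negPf ->; rewrite !inE => /andP[/andP[_ ->] ->].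
Qed.

(** Double count of the adjacencies with the classes: every vertex has at most M0 + k in its sparse
    class and T in each other class, and a vertex that is not good falls short of this by more than
    q. *)
Lemma card_bad (c : G -> 'I_r) q : (forall v, #|A (c v) :&: nbr v| <= M0 + k) ->
  #|~: good c q| * q + \sum_(j < r) \sum_(w in A j) #|nbr w| <=
  #|G| * (M0 + k + r.-1 * T).
Proof.
move=> cP; have [A1 A2] := AP.
under [X in _ + X <= _]eq_bigr do rewrite -sum_card_nbr.
rewrite exchange_big /= -[X in X * q]sum1_card big_distrl /=.
rewrite [X in X + _]big_mkcond -big_split /=.
rewrite -[X in _ <= X * _]sum1_card big_distrl /=.
apply: leq_sum => v _; rewrite !mul1n (bigD1 (c v)) //= addnCA; apply: leq_add => //.
have sumT : \sum_(j < r | j != c v) T = r.-1 * T.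
  rewrite sum_nat_const; congr (_ * _).
  have E : #|predC1 (c v)| = r.-1 by rewrite cardC1 card_ord.
  by rewrite -[RHS]E; apply: eq_card.
have le j : #|A j :&: nbr v| <= #|A j| by apply/subset_leq_card/subsetIl.
case: (boolP (v \in ~: good c q)) => [|_]; last first.
  rewrite add0n -sumT; apply: leq_sum => j _.
  by have [<- _] := A1 j (ltn_ord j).
rewrite !inE negb_forall => /existsP[j]; rewrite negb_imply -ltnNge => /andP[jc qj].
rewrite -sumT (bigD1 j) //= [X in _ <= X](bigD1 j) //= addnA.
apply: leq_add.
  have [AT _] := A1 j (ltn_ord j); rewrite -AT -(cards_setD_setI (A j) (nbr v)).
  by rewrite leq_add2r ltnW.
by apply: leq_sum => i _; have [<- _] := A1 i (ltn_ord i).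
Qed.

End Classify.
End Blocks.

(** * Recolouring when all degrees are large *)

Section Reassign.
Local Open Scope ring_scope.
Variables (R : realType) (k r : nat) (F : 'I_k -> sgraph).
Hypothesis F_critical : forall i, color_critical (F i) /\ chi (F i) = r.+1.
Hypothesis k_gt0 : (0 < k)%N.
Hypothesis r_gt1 : (1 < r)%N.
Variable G : sgraph.
Let n : R := #|G|%:R.
Let ri : R := r%:R^-1.

Lemma sum_card_classes (c : G -> 'I_r) (D : {set G}) :
  \sum_(i < r) #|[set v in D | c v == i]| = #|D|.
Proof.
rewrite -[RHS]sum1_card (partition_big c predT) //=; apply: eq_bigr => i _.
by rewrite -sum1_card; apply: eq_bigl => v; rewrite inE.
Qed.

Lemma card_miss_two (A B : {set G}) v : [disjoint A & B] ->
  (#|A :\: nbr v| + #|B :\: nbr v| + #|nbr v| <= #|G|)%N.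
Proof.
move=> dAB; rewrite -cardsT -(cards_setD_setI [set: G] (nbr v)) finset.setTI leq_add2r.
rewrite -cardsUI (_ : _ :&: _ = set0) ?cards0 ?addn0.
  by apply/subset_leq_card/subsetP => x; rewrite !inE => /orP[]/andP[->].
apply/setP => x; rewrite !inE; apply/negbTE/negP => /andP[/andP[_ xA] /andP[_]].
by rewrite (disjointFr dAB xA).
Qed.

Section Sizes.
Variables (c : G -> 'I_r) (D : {set G}) (g : R).
Hypothesis badD : #|~: D|%:R <= g * n.
Hypothesis innD : (#|inner_in c D| < k)%N.
Hypothesis deg : forall v : G, (1 - ri - g) * n <= #|nbr v|%:R.
Hypothesis kg : k%:R <= g * n.

Let V i := [set v in D | c v == i].

Let r2 : 2 <= r%:R :> R. Proof. by rewrite (ler_nat R 2). Qed.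
Let riE : r%:R * ri = 1. Proof. by rewrite /ri mulfV // gt_eqF //; have := r2; lra. Qed.
Let gn : 0 <= g * n. Proof. by apply: le_trans kg; apply: ler0n. Qed.

Lemma card_nonnbr (v : G) : #|G|%:R - #|nbr v|%:R <= (ri + g) * n.
Proof. by have := deg v; rewrite -/n; lra. Qed.

Lemma card_own_class_miss w : w \in D -> #|V (c w)|%:R - g * n <= #|V (c w) :\: nbr w|%:R.
Proof.
move=> wD; have := inner_degree c wD; rewrite -/(V (c w)) => h.
have {}h : (#|V (c w) :&: nbr w| <= k)%N by apply: leq_trans h (ltnW innD).
have e : #|V (c w)|%:R = #|V (c w) :\: nbr w|%:R + #|V (c w) :&: nbr w|%:R :> R.
  by rewrite -natrD cards_setD_setI.
have : #|V (c w) :&: nbr w|%:R <= k%:R :> R by rewrite ler_nat.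
by have := kg; lra.
Qed.

(** A vertex of the class has fewer than k neighbours in it, so almost the whole class lies among
    its non-neighbours, of which there are at most about n / r. *)
Lemma card_class_le i : #|V i|%:R <= (ri + 2 * g) * n.
Proof.
have [/eqP|/card_gt0P[w wV]] := posnP #|V i|.
  move=> /eqP ->; have : 0 <= ri * n by rewrite mulr_ge0 // invr_ge0 ler0n.
  by have := gn; lra.
move: (wV); rewrite inE => /andP[wD /eqP cw].
have := card_own_class_miss wD; rewrite cw => h.
have d0 : [disjoint V i & (set0 : {set G})] by rewrite disjoint_sym disjoint_subset; apply/subsetP => x; rewrite inE.
have := card_miss_two w d0; rewrite set0D cards0 addn0 -(ler_nat R) natrD.
by have := card_nonnbr w; lra.
Qed.

Lemma card_class_ge i : (ri - 2 * r%:R * g) * n <= #|V i|%:R.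
Proof.
have e : #|V i|%:R + \sum_(j < r | j != i) #|V j|%:R = n - #|~: D|%:R :> R.
  rewrite -[RHS](_ : #|D|%:R = _); last first.
    by rewrite /n -(cardsC D) natrD addrK.
  by rewrite -(sum_card_classes c D) natr_sum [RHS](bigD1 i).
have : \sum_(j < r | j != i) #|V j|%:R <= (r%:R - 1) * ((ri + 2 * g) * n).
  apply: (@le_trans _ _ (\sum_(j < r | j != i) (ri + 2 * g) * n)).
    by apply: ler_sum => j _; apply: card_class_le.
  rewrite sumr_const -[leLHS]mulr_natl; have E : #|predC1 i| = r.-1 by rewrite cardC1 card_ord.
  rewrite (eq_card (B := predC1 i)) // E -subn1 natrB; last exact: ltnW.
  by [].
have -> : (r%:R - 1) * ((ri + 2 * g) * n) =
    r%:R * ri * n - ri * n + 2 * r%:R * g * n - 2 * (g * n) by ring.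
rewrite riE; have := badD; have := gn; lra.
Qed.

(** A class has about n / r vertices, as many as v has non-neighbours. Missing nearly all of class i
    therefore leaves v almost none to miss in class j. *)
Lemma card_cross_miss_gen (v : G) i j (y : R) : i != j -> #|V i :&: nbr v|%:R <= y ->
  #|V j :\: nbr v|%:R <= (2 * r%:R + 1) * (g * n) + y.
Proof.
move=> ij iy; have dV : [disjoint V i & V j].
  rewrite disjoint_subset; apply/subsetP => x; rewrite !inE => /andP[_ /eqP ->].
  by rewrite (negPf ij) andbF.
have := card_miss_two v dV; rewrite -(ler_nat R) !natrD.
have := card_nonnbr v; have := card_class_ge i.
have : #|V i|%:R = #|V i :\: nbr v|%:R + #|V i :&: nbr v|%:R :> R.
  by rewrite -natrD cards_setD_setI.
lra.
Qed.

Lemma card_cross_miss w j : w \in D -> j != c w ->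
  #|V j :\: nbr w|%:R <= 3 * r%:R * (g * n).
Proof.
move=> wD jc; have := inner_degree c wD; rewrite -/(V (c w)) => h.
have {}h : #|V (c w) :&: nbr w|%:R <= g * n.
  by apply: le_trans kg; rewrite ler_nat; apply: leq_trans h (ltnW innD).
rewrite eq_sym in jc; apply: le_trans (card_cross_miss_gen jc h) _.
by have := gn; have := r2; nra.
Qed.

End Sizes.

Let h := (\sum_(i < k) #|F i|)%N.

(** The classes V of good vertices serve as a skeleton. Every vertex, good or not, has few
    neighbours in some [V i], else a star at it could be packed; it takes colour i and then misses
    little of the other classes, so k inner edges of the new colouring would pack. *)
Lemma reassign (c : G -> 'I_r) (D : {set G}) (g : R) :
  #|~: D|%:R <= g * n -> (#|inner_in c D| < k)%N ->
  (forall v : G, (1 - ri - g) * n <= #|nbr v|%:R) ->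
  (2 * k + k * (r * h) + h)%:R <= g * n ->
  30 * r%:R ^+ 2 * (r * h + 2)%:R * g <= 1 ->
  ~ packs F G ->
  exists c' : G -> 'I_r, (#|inner c'| < k)%N.
Proof.
move=> badD innD deg Cg g1 npack.
have kg : k%:R <= g * n.
  by apply: le_trans Cg; rewrite ler_nat; lia.
have n0 : 0 <= n by apply: ler0n.
have gn : 0 <= g * n by apply: le_trans kg; apply: ler0n.
have r2 : 2 <= r%:R :> R by rewrite (ler_nat R 2).
have r0 : 0 <= r%:R :> R by lra.
have riE : r%:R * ri = 1 by rewrite /ri mulfV // gt_eqF //; lra.
have ri0 : 0 < ri by rewrite invr_gt0; lra.
pose V i := [set v in D | c v == i].
(* [m] bounds what a vertex of [D] misses in another class. The demand [pack_bound] for mu is at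
   most (H + 1) m, so xi = (H + 2) m neighbours of v in a class still suffice after those missed by
   a leaf are removed. *)
pose m : R := 3 * r%:R * (g * n).
have m0 : 0 <= m by apply: mulr_ge0 => //; apply: mulr_ge0.
pose mu := Num.truncn m.
pose H : R := (r * h)%:R; have H0 : 0 <= H by apply: ler0n.
pose xi := (H + 2) * m.
have xi0 : 0 <= xi by rewrite mulr_ge0 // addr_ge0.
have mxi : 2 * m <= xi by rewrite /xi ler_wpM2r // lerDr.
have pb : (pack_bound r F mu)%:R <= g * n + H * m.
  rewrite /pack_bound -/h [(r * (h * mu))%N]mulnA addnAC.
  rewrite natrD lerD // natrM ler_wpM2l //.
  by rewrite truncn_le.
have gm : g * n <= m by rewrite /m; nra.
(* As xi = 3 r (H + 2) g n, this is the hypothesis with constant 30 multiplied by n / r. *)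
have big : 10 * xi <= ri * n.
  have -> : ri * n = ri * n * 1 by rewrite mulr1.
  have k1 := ler_wpM2l (mulr_ge0 (ltW ri0) n0) g1; apply: le_trans k1.
  rewrite /xi /m natrD -/H.
  have -> : ri * n * (30 * r%:R ^+ 2 * (H + 2%:R) * g) =
    30 * (r%:R * ri) * r%:R * (H + 2%:R) * (g * n) by ring.
  by rewrite riE; nra.
have rgm : r%:R * (g * n) <= m by rewrite /m; nra.
have Vge i : ri * n - 2 * m <= #|V i|%:R.
  by have := card_class_ge badD innD deg kg i; rewrite -/(V i); lra.
have miss w j : w \in D -> j != c w -> (#|V j :\: nbr w| <= mu)%N.
  move=> wD jc; rewrite truncn_ge_nat //.
  exact: (card_cross_miss badD innD deg kg wD jc).
have sparse v : exists i : 'I_r, #|V i :&: nbr v|%:R < xi.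
  apply: contra_notP npack => /forallNP H1.
  have {}H1 i : xi <= #|V i :&: nbr v|%:R by rewrite leNgt; apply/negP; apply: H1.
  pose j0 : 'I_r := Ordinal (ltnW r_gt1).
  apply: (@pack_star k r F F_critical G mu v j0 (V j0 :&: nbr v)
     (fun u j => if j == j0 then V j0 else V j :&: nbr v :&: nbr u)).
  - rewrite -(ler_nat R); apply: le_trans (H1 j0); lra.
  - by move=> u; rewrite !inE => /andP[].
  - move=> u j uU; rewrite -(ler_nat R); apply: le_trans pb _; case: eqP => [_|/eqP jj].
      have := Vge j0; rewrite /xi in big mxi; lra.
    have uV : u \in V j0 by move: uU; rewrite inE => /andP[].
    have [uD cu] : u \in D /\ c u = j0 by move: uV; rewrite inE => /andP[-> /eqP].
    have : (#|(V j :&: nbr v) :\: nbr u| <= mu)%N.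
      apply: leq_trans (miss u j uD _); last by rewrite cu.
      by apply/subset_leq_card/finset.setSD/subsetIl.
    rewrite truncn_ge_nat // => k1.
    have : #|V j :&: nbr v|%:R = #|(V j :&: nbr v) :\: nbr u|%:R + #|V j :&: nbr v :&: nbr u|%:R :> R.
      by rewrite -natrD cards_setD_setI.
    have := H1 j; rewrite /xi; lra.
  - move=> u j j' w uU jj' wZ.
    have {wZ} : w \in V j by move: wZ; case: eqP => [->|_] //; rewrite !inE -!andbA => /and4P[-> ->].
    rewrite inE => /andP[wD /eqP cw].
    apply: leq_trans (miss w j' wD _); last by rewrite cw eq_sym.
    apply/subset_leq_card/finset.setSD; case: eqP => [->|_] //.
    by rewrite -finset.setIA subsetIl.
  - by move=> u j w _ /negPf ->; rewrite !inE => /andP[/andP[_ ->] ->].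
have /(_ _)/cid c'P := sparse.
exists (fun v => sval (c'P v)); set c' := fun v => _.
have c'V v : #|V (c' v) :&: nbr v|%:R < xi := svalP (c'P v).
have miss' v j : j != c' v -> #|V j :\: nbr v|%:R <= 2 * xi.
  rewrite eq_sym => jc.
  apply: le_trans (card_cross_miss_gen badD innD deg kg jc (ltW (c'V v))) _.
  have -> : (2 * r%:R + 1) * (g * n) = 2 * (r%:R * (g * n)) + g * n by ring.
  have : m = 3 * (r%:R * (g * n)) by rewrite /m; ring.
  lra.
rewrite ltnNge; apply/negP => le; apply: npack; rewrite -inner_in_setT in le.
apply: (@pack_inner k r F F_critical G mu c' [set: G]
  (fun u v j => if j == c' u then V j else V j :&: nbr u :&: nbr v) le).
- move=> u v j _ _ uv cuv; rewrite -(ler_nat R); apply: le_trans pb _.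
  have Vj := Vge j; have gxi : g * n + H * m <= xi by rewrite /xi; lra.
  case: eqP => [_|/eqP jc]; first by lra.
  have m1 := miss' u j jc; rewrite cuv in jc; have m2 := miss' v j jc.
  have e1 : #|V j|%:R = #|V j :\: nbr u|%:R + #|V j :&: nbr u|%:R :> R.
    by rewrite -natrD cards_setD_setI.
  have e2 : #|V j :&: nbr u|%:R = #|(V j :&: nbr u) :\: nbr v|%:R + #|V j :&: nbr u :&: nbr v|%:R :> R.
    by rewrite -natrD cards_setD_setI.
  have e3 : #|(V j :&: nbr u) :\: nbr v|%:R <= #|V j :\: nbr v|%:R :> R.
    by rewrite ler_nat; apply/subset_leq_card/finset.setSD/subsetIl.
  lra.
- move=> u v j j' w _ _ _ jj' wZ.
  have {wZ} : w \in V j by move: wZ; case: eqP => [->|_] //; rewrite !inE -!andbA => /and4P[-> ->].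
  rewrite inE => /andP[wD /eqP cw].
  apply: leq_trans (miss w j' wD _); last by rewrite cw eq_sym.
  apply/subset_leq_card/finset.setSD; case: eqP => [->|_] //.
  by rewrite -finset.setIA subsetIl.
- by move=> u v j w /negPf ->; rewrite !inE => /andP[/andP[_ ->] ->].
Qed.

End Reassign.

Lemma turan_part_bound n r (c : 'I_r) j :
  j < n %/ r + (c < n %% r) -> c + r * j < n.
Proof.
move=> jm; have cr := ltn_ord c; rewrite [n in _ < n](divn_eq n r) [r * j]mulnC.
have [jp|pj] := ltnP j (n %/ r).
  apply: leq_trans (leq_addr _ _); apply: (@leq_trans (j.+1 * r)).
    by rewrite mulSn ltn_add2r.
  by rewrite leq_mul2r jp orbT.
move: jm; case: (ltnP c (n %% r)) => cq; last by rewrite addn0 ltnNge pj.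
rewrite addn1 ltnS => jp; have -> : j = n %/ r by apply/eqP; rewrite eqn_leq jp pj.
by rewrite addnC ltn_add2l.
Qed.

Lemma card_turan_part n r (c : 'I_r) : #|turan_part n c| = n %/ r + (c < n %% r).
Proof.
have cr := ltn_ord c; have r0 : 0 < r by apply: leq_ltn_trans cr.
pose f (j : 'I_(n %/ r + (c < n %% r))) : 'I_n := Ordinal (turan_part_bound (ltn_ord j)).
have finj : injective f.
  move=> i j /(congr1 val) /= /eqP; rewrite eqn_add2l eqn_pmul2l // => /eqP e.
  exact: val_inj.
rewrite -[RHS]card_ord -(card_imset _ finj); apply: eq_card => x.
rewrite inE; apply/eqP/imsetP => [xc|[j _ ->]]; last first.
  by rewrite /= mulnC addnC modnMDl modn_small.
have xj : x %/ r < n %/ r + (c < n %% r).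
  have xe := divn_eq x r; rewrite xc in xe.
  have := leq_div2r r (ltnW (ltn_ord x)); rewrite leq_eqVlt => /orP[/eqP e|lt].
    suff -> : c < n %% r by rewrite e addn1.
    by have := ltn_ord x; rewrite [n in _ < n](divn_eq n r) {1}xe e ltn_add2l.
  by apply: leq_trans lt (leq_addr _ _).
exists (Ordinal xj) => //; apply: val_inj => /=.
by rewrite {1}(divn_eq x r) xc addnC mulnC.
Qed.

(** * Test vectors and local modifications of an extremal graph *)

Section Extremal.
Local Open Scope ring_scope.
Variables (R : realType) (k r : nat) (F : 'I_k -> sgraph).
Hypothesis F_critical : forall i, color_critical (F i) /\ chi (F i) = r.+1.
Hypothesis k_gt0 : (0 < k)%N.
Hypothesis r_gt1 : (1 < r)%N.

Lemma few_inner_free (G : sgraph) (c : G -> 'I_r) :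
  (#|inner c| < k)%N -> free (edge_disjoint_copies F) G.
Proof.
move=> lt; apply/free_packs; apply: inner_lt_not_packs lt => i.
by have [_ ->] := F_critical i.
Qed.

Lemma wquad_le_rho (G : sgraph) (y : G -> R) :
  wquad y [set: G] <= rho R G * \sum_v y v ^+ 2.
Proof.
apply: le_trans (rho_quad y); rewrite /wquad le_eqVlt; apply/orP; left; apply/eqP.
apply: eq_big => [v|v _]; first by rewrite in_setT.
by congr (_ * _); apply: eq_bigl => u; rewrite in_setT.
Qed.

(** The Turan graph has no inner edges, hence is free; the all-ones vector bounds its radius below
    by its average degree. *)
Lemma SPEX_rho_ge (n : nat) (G : sgraph) : (0 < n)%N ->
  SPEX R n (edge_disjoint_copies F) G -> n%:R * (1 - r%:R^-1) - 1 <= rho R G.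
Proof.
move=> n0 [_ _ Gmax]; have r0 : (0 < r)%N := ltnW r_gt1.
pose T := turan n r; have cT : #|T| = n by rewrite card_ord.
pose c (x : T) : 'I_r := Ordinal (ltn_pmod x r0).
have c0 : inner c = set0.
  apply/setP => e; rewrite inE; apply/negbTE/negP => /innerP[a [b [ab cab _]]].
  by move: ab; rewrite -[_ -- _]/(a %% r != b %% r)%N; have /(congr1 val) /= -> := cab; rewrite eqxx.
have Tfree : free (edge_disjoint_copies F) T by apply: (@few_inner_free T c); rewrite c0 cards0.
apply: le_trans (Gmax T cT Tfree).
have nR : 0 < n%:R :> R by rewrite ltr0n.
have := wquad_le_rho (fun _ : T => 1).
have -> : \sum_(v : T) 1 ^+ 2 = n%:R :> R by rewrite expr1n sumr_const cardT -cardE cT.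
move=> le; rewrite -(ler_pM2r nR); apply: le_trans le.
rewrite /wquad (eq_bigl predT) => [|v]; last by rewrite in_setT.
apply: (@le_trans _ _ (\sum_(v : T) (n%:R * (1 - r%:R^-1) - 1))).
  by rewrite sumr_const cardT -cardE cT mulr_natr.
apply: ler_sum => v _; rewrite mul1r /wdeg sumr_const.
have E (u : T) : (v -- u) = (u \notin turan_part n (c v)).
  by rewrite inE -[LHS]/(v %% r != u %% r)%N eq_sym.
rewrite (_ : #|_| = #|~: turan_part n (c v)|); last first.
  apply: eq_card => u; transitivity ((u \in [set: T]) && (v -- u)); first by [].
  by rewrite in_setT in_setC -E.
have := cardsC (turan_part n (c v)); rewrite cT card_turan_part => e.
have rp : 0 < r%:R :> R by rewrite ltr0n.
have : (n %/ r)%:R <= n%:R * r%:R^-1 :> R.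
  by rewrite ler_pdivlMr // -natrM ler_nat leq_divM.
have : (c v < n %% r)%:R <= 1 :> R by rewrite lern1 leq_b1.
move/(congr1 (fun m => m%:R : R)): e; rewrite !natrD; lra.
Qed.

Section Reconnect.
Variables (G : sgraph) (v : G) (N : {set G}).
Hypothesis vN : v \notin N.

Definition reconnect_rel : rel G := fun x y =>
  if x == v then y \in N else if y == v then x \in N else x -- y.

Lemma reconnect_sym : symmetric reconnect_rel.
Proof.
move=> x y; rewrite /reconnect_rel.
by case: (eqVneq x v) => [->|_]; case: (eqVneq y v) => [ey|_] //; rewrite ?ey // sedge_sym.
Qed.

Lemma reconnect_irrefl : irreflexive reconnect_rel.
Proof.
move=> x; rewrite /reconnect_rel; case: eqP => [->|_]; first exact/negbTE.
exact: sedge_irrefl.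
Qed.

Definition reconnect := SGraph reconnect_sym reconnect_irrefl.

(** Test vectors equal to [x] except for the value t at v give 2 t s <= rho (x v ^ 2 + t ^ 2) with s
    = wt x N. The best choice t = s / rho yields s <= rho x v. *)
Lemma wt_reconnect_le (x : G -> R) : eigenweight x -> 0 < rho R G ->
  rho R reconnect <= rho R G -> wt x N <= rho R G * x v.
Proof.
move=> xP rh0 le; have [x0 xn xE] := xP; set s := wt x N; set rh := rho R G in rh0 le *.
have s0 : 0 <= s by apply: sumr_ge0.
pose y (t : R) (u : reconnect) : R := if u == v then t else x u.
have Q1 : wquad x [set: G] = wquad x ([set: G] :\ v) + 2 * x v * (rh * x v).
  by rewrite -eigenweight_wdeg // -wquadD1 // in_setT.
have Q2 t : wquad (y t) [set: reconnect] = wquad x ([set: G] :\ v) + 2 * t * s.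
  have yv : y t v = t by rewrite /y eqxx.
  rewrite (wquadD1 _ (in_setT (v : reconnect))) yv; congr (_ + _ * _).
    have yE u : u \in [set: G] :\ v -> y t u = x u.
      by rewrite /y !inE => /andP[/negPf ->].
    apply: eq_bigr => u uv; rewrite yE //; congr (_ * _).
    rewrite /wdeg [LHS]big_mkcondr [RHS]big_mkcondr; apply: eq_bigr => w wv; rewrite yE //.
    move: uv wv; rewrite !inE => /andP[/negPf uv _] /andP[/negPf wv _].
    by rewrite -[@sedge reconnect u w]/(reconnect_rel u w) /reconnect_rel uv wv.
  rewrite /wdeg /s /wt; apply: eq_big => u.
    by rewrite in_setT -[@sedge reconnect v u]/(reconnect_rel v u) /reconnect_rel eqxx.
  rewrite in_setT -[@sedge reconnect v u]/(reconnect_rel v u) /reconnect_rel eqxx /= => uN.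
  by rewrite /y; case: eqP => // e; move: vN; rewrite -e uN.
have Y2 t : \sum_(u : reconnect) y t u ^+ 2 = #|G|%:R - x v ^+ 2 + t ^+ 2.
  rewrite -xn (bigD1 (v : reconnect)) //= [in RHS](bigD1 v) //= {1}/y eqxx.
  rewrite (eq_bigr (fun u => x u ^+ 2)) => [|u /negPf uv]; last by rewrite /y uv.
  by rewrite [x v ^+ 2 + _]addrC addrK addrC.
have main t : 2 * t * s <= rh * (x v ^+ 2 + t ^+ 2).
  have := wquad_le_rho (y t); rewrite Q2 Y2 => h.
  have h2 : rho R reconnect * (#|G|%:R - x v ^+ 2 + t ^+ 2) <= rh * (#|G|%:R - x v ^+ 2 + t ^+ 2).
    by rewrite ler_wpM2r // -Y2 sumr_ge0 // => u _; apply: sqr_ge0.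
  have := eigenweight_wquad xP; rewrite Q1 -/rh.
  move=> h3; clear Q1 Q2 Y2; have {}h := le_trans h h2; lra.
have := main (s / rh).
have e1 : 2 * (s / rh) * s = 2 * (s / rh) ^+ 2 * rh by field; rewrite gt_eqF.
have s1 : s = s / rh * rh by rewrite divfK // gt_eqF.
rewrite e1; set t := s / rh in s1 *; move=> h.
have t0 : 0 <= t by rewrite divr_ge0 // ltW.
have : t ^+ 2 <= x v ^+ 2.
  by rewrite -(ler_pM2l rh0); lra.
by rewrite ler_pXn2r ?nnegrE // s1 mulrC ler_pM2l.
Qed.

Lemma reconnect_packs :
  (forall B : {set G}, (#|B| <= \sum_(i < k) #|F i|)%N ->
     exists v', [/\ v' \notin B, v' != v & forall u, u \in N -> u \in B -> v' -- u]) ->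
  packs F reconnect -> packs F G.
Proof.
move=> rer [phi [emb dis]].
pose B := \bigcup_(i : 'I_k) [set (phi i u : G) | u : F i].
have leB : (#|B| <= \sum_(i < k) #|F i|)%N.
  apply: leq_trans (card_bigcup_leq _ _) _; apply: leq_sum => i _.
  by apply: leq_trans (leq_imset_card _ _) _; rewrite max_card.
have inB i u : (phi i u : G) \in B by apply/bigcupP; exists i => //; apply: imset_f.
have [v' [v'B v'v v'N]] := rer B leB.
pose s (u : G) := if u == v then v' else u.
have sinj i j a b : s (phi i a) = s (phi j b) -> phi i a = phi j b.
  rewrite /s; case: eqP => [->|_]; case: eqP => [->|_] // e.
    by move: v'B; rewrite e inB.
  by move: v'B; rewrite -e inB.
exists (fun i u => s (phi i u)); split=> [i|i j ij a b c d ab cd /sinj e1 /sinj e2].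
  have [ei ee] := emb i; split; first by move=> a b /sinj/ei.
  move=> a b /ee; rewrite -[_ -- _]/(reconnect_rel _ _) /reconnect_rel /s.
  case: eqP => [ea|na].
    case: eqP => [eb|nb]; first by rewrite eb (negPf vN).
    by move=> h; apply: v'N.
  case: eqP => [eb|nb] // h.
  by rewrite sedge_sym; apply: v'N.
exact: dis e1 e2.
Qed.

End Reconnect.
End Extremal.

Section AddEdge.
Variables (G : sgraph) (u v : G).
Hypothesis uv : u != v.

Definition add_edge_rel : rel G := fun x y => (x -- y) || ([set x; y] == [set u; v]).

Lemma add_edge_sym : symmetric add_edge_rel.
Proof. by move=> x y; rewrite /add_edge_rel sedge_sym finset.setUC. Qed.

Lemma add_edge_irrefl : irreflexive add_edge_rel.
Proof.
move=> x; rewrite /add_edge_rel sedge_irrefl /=; apply/negbTE; apply: contra uv.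
by move=> /eqP/set2_eqP[[<- <-]|[<- <-]].
Qed.

Definition add_edge := SGraph add_edge_sym add_edge_irrefl.

Lemma inner_add_edge r (c : G -> 'I_r) :
  inner (c : add_edge -> 'I_r) \subset
  (if c u == c v then [set u; v] |: inner c else inner c).
Proof.
apply/subsetP => e /innerP[a [b [ab cab ->]]].
have {}ab : add_edge_rel a b := ab.
case/orP: ab => [ab|/eqP E].
  have ei : [set a; b] \in inner c by apply/innerP; exists a, b.
  by case: ifP => _ //; rewrite in_setU1 ei orbT.
have -> : c u == c v.
  by move: cab; have /set2_eqP[[-> ->]|[-> ->]] := E => ->.
by rewrite E setU11.
Qed.

Lemma rho_add_edge (R : realType) (x : G -> R) : eigenweight x ->
  (forall w, 0 < x w)%R -> ~~ (u -- v) -> (rho R G < rho R add_edge)%R.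
Proof.
move=> xP xpos nuv; have [x0 xn xE] := xP.
have n0 : (0 < #|G|%:R :> R)%R.
  by rewrite -xn (bigD1 u) //= ltr_pwDl ?exprn_gt0 // sumr_ge0 // => w _; apply: sqr_ge0.
have := wquad_le_rho (x : add_edge -> R); rewrite xn => le.
rewrite -(ltr_pM2r n0); apply: lt_le_trans le; rewrite -(eigenweight_wquad xP).
have mono w : (wdeg x [set: G] w <= wdeg (x : add_edge -> R) [set: add_edge] w)%R.
  rewrite /wdeg !big_mkcondr; apply: ler_sum => z _.
  have : (w -- z) ==> @sedge add_edge w z.
    by rewrite -[@sedge add_edge w z]/(add_edge_rel w z) /add_edge_rel; case: (w -- z).
  by case: (w -- z) => /=; [move=> -> | case: ifP].
have strict : (wdeg x [set: G] u + x v <= wdeg (x : add_edge -> R) [set: add_edge] u)%R.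
  rewrite (wdegD1 x u (in_setT v)) (negPf nuv) add0r addrC.
  rewrite (wdegD1 (x : add_edge -> R) u (in_setT (v : add_edge))).
  have -> : @sedge add_edge u v by apply/orP; right.
  rewrite lerD2l /wdeg !big_mkcondr; apply: ler_sum => z _.
  have : (u -- z) ==> @sedge add_edge u z.
    by rewrite -[@sedge add_edge u z]/(add_edge_rel u z) /add_edge_rel; case: (u -- z).
  by case: (u -- z) => /=; [move=> -> | case: ifP].
rewrite /wquad (big_setD1 u) ?in_setT //= [ltRHS](big_setD1 (u : add_edge)) ?in_setT //=.
apply: ltr_leD; last by apply: ler_sum => z _; rewrite ler_wpM2l.
rewrite ltr_pM2l //; apply: lt_le_trans strict; by rewrite ltrDl.
Qed.

End AddEdge.

(** * Colouring and structure of extremal graphs *)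

Section Structure.
Local Open Scope ring_scope.
Variables (R : realType) (k r : nat) (F : 'I_k -> sgraph).
Hypothesis F_critical : forall i, color_critical (F i) /\ chi (F i) = r.+1.
Hypothesis k_gt0 : (0 < k)%N.
Hypothesis r_gt1 : (1 < r)%N.
Let ri : R := r%:R^-1.
Let h := (\sum_(i < k) #|F i|)%N.

(** The sparse classes give a colouring with few inner edges among the good vertices. Reconnection
    then bounds every entry of [x] from below, even at bad vertices; this yields positivity and the
    minimum degree required by [reassign]. *)
Lemma extremal_coloring (g : R) : 0 < g -> g <= 1 / 8 -> 
  30 * r%:R ^+ 2 * (r * h + 2)%:R * g <= 1 ->
  exists n1 : nat, forall (n : nat) (G : sgraph), (n1 <= n)%N ->
    SPEX R n (edge_disjoint_copies F) G ->
    exists (x : G -> R) (c : G -> 'I_r),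
      [/\ eigenweight x, forall v, 0 < x v, (#|inner c| < k)%N,
        forall v : G, (1 - ri - g) * n%:R <= #|nbr v|%:R & k%:R <= g * n%:R].
Proof.
move=> g0 g8 g30.
have r2 : 2 <= r%:R :> R by rewrite (ler_nat R 2).
have riE : r%:R * ri = 1 by rewrite /ri mulfV // gt_eqF //; lra.
have ri0 : 0 < ri by rewrite invr_gt0; lra.
have ri2 : ri <= 1 / 2.
  by rewrite -(ler_pM2l (_ : 0 < r%:R)) ?riE; lra.
pose gg := g / 4; have gg0 : 0 < gg by rewrite divr_gt0.
pose M0 := pack_bound r F 0.
pose Hf : R := (2 * h + 4)%:R.
have Hf0 : 4 <= Hf by rewrite /Hf (ler_nat R 4) leq_addl.
(* In [card_bad] the degree loss 7 b costs 7 r b T n, where T = Hf * q. This b makes it at most gg q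
   n / 2, so the number of bad vertices is at most gg n. *)
pose b := gg / (14 * r%:R ^+ 2 * Hf).
have r22 : 4 <= r%:R ^+ 2 :> R by rewrite expr2; nra.
have den : 0 < 14 * r%:R ^+ 2 * Hf by rewrite !mulr_gt0 //; lra.
have b0 : 0 < b by rewrite divr_gt0.
have bE : 14 * r%:R ^+ 2 * Hf * b = gg by rewrite mulrC divfK // gt_eqF.
have bE1 : 14 * r%:R * Hf * b <= gg.
  rewrite -bE ler_pM2r // ler_pM2r; last by lra.
  by rewrite ler_pM2l // expr2 ler_peMr //; lra.
have r2b : 0 <= r%:R ^+ 2 * b by rewrite mulr_ge0 ?sqr_ge0 // ltW.
have bE2 : 56 * (r%:R ^+ 2 * b) <= gg.
  by rewrite -bE; have := ler_wpM2r r2b Hf0; lra.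
have rb1 : 2 * r%:R ^+ 2 * b <= 1 by rewrite /gg in bE2; lra.
have bg : 8 * b <= gg by have := ler_wpM2r (ltW b0) r22; lra.
have [q0 q0P] := archi_bound (2 * (M0 + k)%:R / gg : R).
pose q := (q0 + (M0 + h + 2))%N.
have qR : 2 * (M0 + k)%:R <= gg * q%:R.
  rewrite [leRHS]mulrC -ler_pdivrMr //; apply: le_trans q0P _.
  by rewrite ler_nat leq_addr.
have qp : 0 < q%:R :> R by rewrite ltr0n /q !addnS.
(* [qT] is the room [good_inner] needs. [hT] leaves a replacement vertex in [A i] after removing the
   h vertices of a packing and q non-neighbours for each. *)
pose T := ((2 * h + 4) * q)%N.
have qM : (M0 + h + 2 <= q)%N by apply: leq_addl.
have qT : (M0 + 2 * q <= T)%N.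
  rewrite /T; clear -qM; nia.
have hT : (h * q + h + 1 < T)%N.
  rewrite /T; clear -qM; nia.
have [n1 n1P] := @high_degree_multipartite R r T (M0 + k) b r_gt1 b0 rb1.
have [n2 n2P] := archi_bound ((2 * k + k * (r * h) + h)%:R / g + 1 / gg + 1 : R).
exists (n1 + n2 + 1)%N => n G nn Gspex; have [Gn Gfree Gmax] := Gspex.
have n_gt0 : (0 < n)%N by apply: leq_trans nn; rewrite addn1.
have rhoG := SPEX_rho_ge F_critical k_gt0 r_gt1 n_gt0 Gspex.
have np : ~ packs F G by apply/free_packs.
have [|x xP] := @eigenweight_exists R G; first by rewrite Gn.
have nR : 0 < n%:R :> R by rewrite ltr0n.
have [C1 C2] : (2 * k + k * (r * h) + h)%:R <= g * n%:R /\ 1 <= gg * n%:R.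
  have n2n : n2%:R <= n%:R :> R by rewrite ler_nat; apply: leq_trans nn; rewrite addnAC leq_addl.
  have p1 : 0 <= (2 * k + k * (r * h) + h)%:R / g by rewrite divr_ge0 ?ler0n // ltW.
  have p2 : 0 <= 1 / gg by rewrite divr_ge0 // ltW.
  by split; rewrite [leRHS]mulrC -ler_pdivrMr //; lra.
have [|||near [A [AP Adeg]]] := n1P G x _ xP.
- by rewrite Gn; apply: leq_trans nn; rewrite -addnA leq_addr.
- by rewrite Gn.
- by move=> [A]; apply: contra_not np; apply: multipartite_succ_packs.
rewrite Gn in near Adeg.
have MT : (M0 <= T)%N by apply: leq_trans qT; apply: leq_addr.
have /(_ _)/cid scP := sparse_class F_critical r_gt1 AP np MT.
pose c v := sval (scP v).
have cP v : (#|A (c v) :&: nbr v| <= M0 + k)%N by apply: ltnW; apply: (svalP (scP v)).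
pose D := good A c q.
have innD : (#|inner_in c D| < k)%N := good_inner F_critical AP np c qT.
have [A1 A2] := AP.
have badD : #|~: D|%:R <= gg * n%:R.
  have sE : r.-1%:R = r%:R - 1 :> R by rewrite -subn1 natrB // ltnW.
  have E : (n * (M0 + k + r.-1 * T))%:R = n%:R * (M0 + k)%:R + n%:R * ((r%:R - 1) * T%:R) :> R.
    by rewrite natrM [(_ + r.-1 * T)%:R]natrD natrM sE mulrDr.
  have := card_bad AP q cP; rewrite -/D -(ler_nat R) Gn E natrD natrM natr_sum.
  have : \sum_(i < r) (T%:R * ((1 - ri - 7 * b) * n%:R)) <=
         \sum_(i < r) (\sum_(w in A i) #|nbr w|)%:R :> R.
    apply: ler_sum => i _; have [<- _] := A1 i (ltn_ord i).
    rewrite natr_sum mulr_natl -sumr_const; apply: ler_sum => w wA.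
    exact: Adeg (ltn_ord i) wA.
  rewrite sumr_const card_ord -[leLHS]mulr_natl => k1 k2.
  have {k1 k2}k3 := le_trans (lerD (lexx _) k1) k2.
  have TE : T%:R = Hf * q%:R :> R by rewrite natrM.
  have e1 : r%:R * (T%:R * ((1 - ri - 7 * b) * n%:R)) =
     (r%:R - r%:R * ri) * T%:R * n%:R - 7 * r%:R * b * Hf * q%:R * n%:R by rewrite TE; ring.
  rewrite e1 riE in k3.
  have k4 : 7 * r%:R * b * Hf * q%:R * n%:R <= gg / 2 * q%:R * n%:R.
    rewrite ler_pM2r // ler_pM2r //; lra.
  have k5 : n%:R * (M0 + k)%:R <= n%:R * (gg * q%:R / 2) by rewrite ler_pM2l //; lra.
  rewrite -(ler_pM2r qp); lra.
pose V i := [set v in D | c v == i].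
have [i iV] : exists i, (#|V i| * r <= n)%N.
  apply/existsP; apply: contraT => /existsPn H.
  have : (\sum_(i < r) n.+1 <= \sum_(i < r) #|V i| * r)%N.
    by apply: leq_sum => i _; rewrite ltnNge H.
  rewrite -big_distrl /= sum_card_classes sum_nat_const card_ord mulnC leq_pmul2r; last exact: ltnW.
  by rewrite -Gn ltnNge max_card.
have iVR : #|V i|%:R <= ri * n%:R.
  by rewrite mulrC ler_pdivlMr ?ltr0n ?(ltnW r_gt1) // -natrM ler_nat.
have rho0 : 0 < rho R G.
  apply: lt_le_trans rhoG; rewrite -/ri.
  have k1 : n%:R / 2 <= n%:R * (1 - ri) by have := ler_wpM2l (ltW nR) ri2; lra.
  have k2 : gg * n%:R <= n%:R / 32 by rewrite /gg; have := ler_wpM2r (ltW nR) g8; lra.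
  lra.
have key v : n%:R * (1 - ri) - gg * n%:R - 1 - 3 * b * n%:R <= rho R G * x v.
  (* Class i is at most of average size, so N has nearly (1 - 1 / r) n vertices. Each of them is
     good and of colour other than i, hence misses at most q of [A i], where v' is sought. *)
  pose N := [set u in D | c u != i] :\ v.
  have vN : v \notin N by rewrite !inE eqxx.
  have rp : ~ packs F (reconnect vN).
    apply: contra_not np; apply: reconnect_packs => B leB.
    pose Bad := B :|: [set v] :|: \bigcup_(u in N :&: B) (A i :\: nbr u).
    have NA u : u \in N -> (#|A i :\: nbr u| <= q)%N.
      rewrite !inE => /andP[_ /andP[/forallP/(_ i)]].
      by rewrite eq_sym => /implyP h1 h2; apply: h1.
    have leBad : (#|Bad| <= h * q + h + 1)%N.
      apply: leq_trans (leq_card_setU _ _) _; rewrite addnC -addnA; apply: leq_add.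
        apply: leq_trans (card_bigcup_leq _ _) _.
        apply: (@leq_trans (\sum_(u in N :&: B) q)).
          by apply: leq_sum => u; rewrite in_setI => /andP[uN _]; apply: NA.
        rewrite sum_nat_const leq_mul2r; apply/orP; right; apply: leq_trans leB.
        by apply/subset_leq_card/subsetIr.
      apply: leq_trans (leq_card_setU _ _) _; rewrite cards1 leq_add2r.
      exact: leB.
    have [v' v'P] : exists v', v' \in A i :\: Bad.
      apply/card_gt0P; rewrite cardsD subn_gt0.
      have [-> _] := A1 i (ltn_ord i); apply: leq_ltn_trans hT; apply: leq_trans leBad.
      by apply/subset_leq_card/subsetIr.
    move: v'P; rewrite !inE !negb_or => /andP[/andP[/andP[v'B v'v] v'bad] v'A].
    exists v'; split=> // u uN uB; rewrite sedge_sym; apply: contraNT v'bad => nv'.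
    by apply/bigcupP; exists u; rewrite ?in_setI ?uN // !inE nv'.
  have rle : rho R (reconnect vN) <= rho R G.
    by apply: Gmax; [rewrite -Gn | apply/free_packs].
  have := wt_reconnect_le xP rho0 rle; apply: le_trans; clear rle.
  have := near N; rewrite ler_norml => /andP[nearN _].
  have cN : n%:R <= #|N|%:R + 1 + #|~: D|%:R + #|V i|%:R :> R.
    rewrite natr1 -!natrD ler_nat -Gn -cardsT.
    have sub : [set: G] \subset N :|: [set v] :|: ~: D :|: V i.
      apply/subsetP => u _; rewrite !in_setU in_set1 in_setC in_setD1.
      have [uD|uD] := boolP (u \in D); last by rewrite orbT.
      have [->|uv] := eqVneq u v; first by rewrite orbT.
      have inE2 (p : pred G) : u \in [set w in D | p w] = p u by rewrite in_set uD.
      by rewrite !inE2; case: (c u == i); rewrite ?orbT.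
    apply: leq_trans (subset_leq_card sub) _.
    apply: leq_trans (leq_card_setU _ _) _; rewrite leq_add2r.
    apply: leq_trans (leq_card_setU _ _) _; rewrite leq_add2r.
    by apply: leq_trans (leq_card_setU _ _) _; rewrite cards1 addn1.
  lra.
have deg (v : G) : (1 - ri - g) * n%:R <= #|nbr v|%:R.
  have := near (nbr v); rewrite ler_norml => /andP[_].
  have [x0 xn xE] := xP.
  have -> : wt x (nbr v) = rho R G * x v by rewrite -xE; apply: eq_bigl => u; rewrite inE.
  have := key v; have := ler_wpM2r (ltW nR) bg.
  have -> : (1 - ri - g) * n%:R = n%:R * (1 - ri) - 4 * (gg * n%:R) by rewrite /gg; field.
  lra.
have xpos v : 0 < x v.
  have [x0 xn xE] := xP; rewrite lt_neqAle x0 andbT eq_sym; apply/negP => /eqP xv.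
  have := key v; rewrite xv mulr0; have := ler_wpM2r (ltW nR) bg.
  have k1 : n%:R / 2 <= n%:R * (1 - ri) by have := ler_wpM2l (ltW nR) ri2; lra.
  have k2 : gg * n%:R <= n%:R / 32 by rewrite /gg; have := ler_wpM2r (ltW nR) g8; lra.
  lra.
have bad' : #|~: D|%:R <= g * #|G|%:R.
  by apply: le_trans badD _; rewrite Gn ler_pM2r // /gg; lra.
have [||||c' c'P] := @reassign R k r F F_critical k_gt0 r_gt1 G c D g bad' innD.
- by move=> v; rewrite Gn; apply: deg.
- by rewrite Gn.
- by [].
- by [].
exists x, c'; split=> //; apply: le_trans C1; rewrite ler_nat.
by apply: leq_trans (leq_addr _ _); apply: leq_trans (leq_addr _ _); rewrite leq_pmull.
Qed.

(** Since [x] is positive, adding an edge strictly increases rho; so every addition that keeps fewer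
    than k inner edges is already present. *)
Lemma extremal_structure (eps : R) : 0 < eps ->
  exists n1 : nat, forall (n : nat) (G : sgraph), (n1 <= n)%N ->
    SPEX R n (edge_disjoint_copies F) G ->
    exists (x : G -> R) (c : G -> 'I_r),
      [/\ eigenweight x, forall v, 0 < x v,
        forall u v, (c u != c v) -> u -- v, #|inner c| = k.-1
      & forall i, `|#|[set v | c v == i]|%:R - ri * n%:R| <= eps * n%:R].
Proof.
move=> e0; have r2 : 2 <= r%:R :> R by rewrite (ler_nat R 2).
have riE : r%:R * ri = 1 by rewrite /ri mulfV // gt_eqF //; lra.
have ri0 : 0 < ri by rewrite invr_gt0; lra.
pose K : R := 30 * r%:R ^+ 2 * (r * h + 2)%:R.
have K60 : 60 * r%:R ^+ 2 <= K.
  have : 2 <= (r * h + 2)%:R :> R by rewrite (ler_nat R 2) leq_addl.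
  by move/(ler_wpM2l (sqr_ge0 r%:R)); rewrite /K; lra.
have r4 : 2 * r%:R <= r%:R ^+ 2 :> R by rewrite expr2 ler_wpM2r //; lra.
pose g := Num.min (1 / K) (eps / (2 * r%:R)).
have K0 : 0 < K by lra.
have g0 : 0 < g by rewrite lt_min !divr_gt0 // ?mulr_gt0 //; lra.
have gK : K * g <= 1.
  have : g <= 1 / K by rewrite ge_min lexx.
  by rewrite ler_pdivlMr // mulrC.
have ge : 2 * r%:R * g <= eps.
  have : g <= eps / (2 * r%:R) by rewrite ge_min lexx orbT.
  by rewrite ler_pdivlMr ?mulr_gt0 //; [rewrite mulrC | lra].
have r2g : 60 * (r%:R ^+ 2 * g) <= 1.
  by apply: le_trans gK; rewrite mulrA ler_wpM2r // ltW.
have rgi : 60 * (r%:R * g) <= ri.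
  have := ler_wpM2l (ltW ri0) r2g.
  have -> : ri * (60 * (r%:R ^+ 2 * g)) = 60 * (r%:R * ri) * (r%:R * g) by ring.
  by rewrite riE; lra.
have rg : 60 * (r%:R * g) <= 1 by have := ler_wpM2r (ltW g0) r4; nra.
have g8 : g <= 1 / 8 by have := ler_wpM2r (ltW g0) r2; lra.
have [n1 n1P] := extremal_coloring g0 g8 gK.
exists n1.+1 => n G nn Gs; have [Gn Gfree Gmax] := Gs.
have [x [c [xP xpos inn deg kg]]] := n1P n G (ltnW nn) Gs.
exists x, c.
have nR : 0 < n%:R :> R by rewrite ltr0n; apply: leq_trans nn.
have badT : #|~: [set: G]|%:R <= g * #|G|%:R.
  by rewrite setCT cards0 mulr_ge0 ?ler0n // ltW.
have innT : (#|inner_in c [set: G]| < k)%N by rewrite inner_in_setT.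
have degT (v : G) : (1 - r%:R^-1 - g) * #|G|%:R <= #|nbr v|%:R by rewrite Gn; apply: deg.
have kgT : k%:R <= g * #|G|%:R by rewrite Gn.
have VE i : [set v in [set: G] | c v == i] = [set v | c v == i].
  by apply/setP => v; rewrite !inE.
have sle i := card_class_le innT degT kgT i.
have sge i := card_class_ge r_gt1 badT innT degT kgT i.
have add (u v : G) (uv : u != v) : ~~ (u -- v) ->
    (#|inner (c : add_edge uv -> 'I_r)| < k)%N -> False.
  move=> nuv lt; have := Gmax (add_edge uv) Gn (few_inner_free F_critical lt).
  by rewrite leNgt (rho_add_edge uv xP xpos).
split=> //.
- move=> u v cuv; apply: contraT => nuv.
  have uv : u != v by apply: contra cuv => /eqP ->.
  case: (add u v uv nuv); apply: leq_ltn_trans inn.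
  have := inner_add_edge uv c; rewrite (negPf cuv).
  exact: subset_leq_card.
- apply/eqP; rewrite eqn_leq -ltnS prednK // inn /= leqNgt; apply/negP => lt.
  have {}lt : (#|inner c|.+1 < k)%N by rewrite -(prednK k_gt0) ltnS.
  pose i0 : 'I_r := Ordinal (ltnW r_gt1).
  (* With room for one more inner edge all classes would be complete, giving a vertex at least k
     inner neighbours, more than there are inner edges. *)
  have nonadj (u v : G) : u != v -> c u = c v -> u -- v.
    move=> uv cuv; apply: contraT => nuv; case: (add u v uv nuv).
    apply: leq_ltn_trans lt.
    have := subset_leq_card (inner_add_edge uv c); rewrite cuv eqxx => le.
    by apply: leq_trans le _; rewrite cardsU1; case: (_ \notin _).
  have big : k%:R < #|[set v | c v == i0]|%:R :> R.
    have := sge i0; rewrite VE Gn => h1; apply: lt_le_trans h1.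
    apply: le_lt_trans kg _; rewrite ltr_pM2r //.
    rewrite -/ri; have := ler_wpM2r (ltW g0) r2; lra.
  have /card_gt0P[w wi] : (0 < #|[set v | c v == i0]|)%N.
    by rewrite -(ltr_nat R); apply: le_lt_trans big; apply: ler0n.
  have := inner_degree c (in_setT w); rewrite inner_in_setT leqNgt => /negP[].
  apply: leq_trans (ltnW lt) _; rewrite ltr_nat in big.
  rewrite inE in wi; rewrite (cardsD1 w) inE wi add1n ltnS in big.
  apply: leq_trans big _; apply/subset_leq_card/subsetP => v.
  rewrite !inE => /andP[vw cv]; rewrite (eqP wi) cv /=.
  by apply: nonadj; [rewrite eq_sym | rewrite (eqP wi) (eqP cv)].
- move=> i; have := sle i; have := sge i; rewrite !VE Gn -/ri ler_norml => h1 h2.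
  have h3 := ler_wpM2r (ltW nR) ge; apply/andP; split; first by lra.
  have h4 : g * n%:R <= r%:R * (g * n%:R).
    by rewrite ler_peMl ?mulr_ge0 ?ltW //; lra.
  lra.
Qed.

End Structure.

(** * Families of edges *)

Section EdgeFamilies.
Variables (T : finType) (E : {set {set T}}).
Hypothesis E2 : forall e, e \in E -> #|e| = 2.

Definition edge_degree (v : T) := #|[set e in E | v \in e]|.

Lemma sum_edge_degree : \sum_v edge_degree v = 2 * #|E|.
Proof.
under eq_bigr do rewrite /edge_degree -sum1_card.
rewrite (exchange_big_dep (mem E)) /=; last by move=> v e _; rewrite inE => /andP[].
rewrite mulnC -sum_nat_const; apply: eq_bigr => e eE; rewrite -(E2 eE) -sum1_card.
by apply: eq_bigl => v; rewrite inE eE.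
Qed.

Lemma edge_degree_le v : edge_degree v <= #|E|.
Proof. by apply/subset_leq_card/subsetP => e; rewrite inE => /andP[]. Qed.

Lemma sum_edge_degree_sq : \sum_v edge_degree v ^ 2 = \sum_(e in E) \sum_(f in E) #|e :&: f|.
Proof.
have -> : \sum_v edge_degree v ^ 2 = \sum_v \sum_(e in E | v \in e) \sum_(f in E | v \in f) 1.
  apply: eq_bigr => v _; rewrite -mulnn /edge_degree -[X in X * _]sum1_card big_distrl /=.
  apply: eq_big => [e|e _]; first by rewrite inE.
  by rewrite mul1n -sum1_card; apply: eq_bigl => f; rewrite inE.
rewrite (exchange_big_dep (mem E)) /=; last by move=> v e _ /andP[].
apply: eq_bigr => e eE.
rewrite (exchange_big_dep (mem E)) /=; last by move=> v f _ /andP[].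
apply: eq_bigr => f fE; rewrite -sum1_card; apply: eq_bigl => v.
by rewrite inE eE fE.
Qed.

Lemma card_setI_edges e f : e \in E -> f \in E -> e != f -> #|e :&: f| <= 1.
Proof.
move=> eE fE; apply: contra_neqT; rewrite -ltnNge => lt.
have ef : e :&: f = e by apply/eqP; rewrite eqEcard subsetIl E2.
by apply/eqP; rewrite eqEcard (E2 eE) (E2 fE) leqnn andbT -ef subsetIr.
Qed.

Lemma sum_setI_edges e : e \in E -> \sum_(f in E) #|e :&: f| <= #|E|.+1.
Proof.
move=> eE; rewrite (bigD1 e) //= finset.setIid E2 // (cardsD1 e E) eE add1n.
rewrite -[#|E :\ e|.+2]addn2 addnC leq_add2r -sum1_card.
apply: (@leq_trans (\sum_(f in E | f != e) 1)).
  by apply: leq_sum => f /andP[fE fe]; apply: card_setI_edges; rewrite // eq_sym.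
by apply: eq_leq; apply: eq_bigl => f; rewrite !inE andbC.
Qed.

(** Written as a sum of |e :&: f| over pairs of edges, each e contributes 2 for itself and at most 1
    for every other edge. *)
Lemma sum_edge_degree_sq_le : \sum_v edge_degree v ^ 2 <= #|E| ^ 2 + #|E|.
Proof.
rewrite sum_edge_degree_sq -mulnn -mulnSr -sum_nat_const.
by apply: leq_sum => e; apply: sum_setI_edges.
Qed.

Lemma sum_edge_degree_sq_lt e f : e \in E -> f \in E -> e :&: f = set0 ->
  \sum_v edge_degree v ^ 2 < #|E| ^ 2 + #|E|.
Proof.
move=> eE fE ef0; rewrite sum_edge_degree_sq -mulnn -mulnSr -sum_nat_const.
rewrite (bigD1 e) //= [X in _ < X](bigD1 e) //= -addSn; apply: leq_add; last first.
  by apply: leq_sum => g /andP[gE _]; apply: sum_setI_edges.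
have nfe : f != e.
  by apply/negP => /eqP fe; have := E2 eE; rewrite -[e]finset.setIid -{2}fe ef0 cards0.
rewrite (bigD1 e) //= finset.setIid E2 // (bigD1 f) /= ?fE // ef0 cards0 add0n.
have -> : #|E|.+1 = (2 + (#|E :\ e :\ f| + 1)) .
  rewrite (cardsD1 e E) eE (cardsD1 f (E :\ e)) !inE nfe fE /=; lia.
rewrite ltn_add2l addn1 ltnS -sum1_card.
apply: (@leq_trans (\sum_(g in E | (g != e) && (g != f)) 1)).
  rewrite [X in _ <= X](eq_bigl (fun g => (g \in E) && (g != e) && (g != f))); last by move=> g; rewrite andbA.
  apply: leq_sum => g /andP[/andP[gE ge] _].
  by apply: card_setI_edges; rewrite // eq_sym.
by apply: eq_leq; apply: eq_bigl => g; rewrite !inE; case: (g \in E); rewrite ?andbF ?andbT //= andbC.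
Qed.

Lemma two_elements e a : e \in E -> a \in e -> exists2 b, b != a & e = [set a; b].
Proof.
move=> eE ae; have /cards1P[b eb] : #|e :\ a| == 1.
  by have := E2 eE; rewrite (cardsD1 a e) ae add1n => -[->].
exists b.
  have : b \in e :\ a by rewrite eb set11.
  by rewrite !inE => /andP[].
by rewrite -(setD1K ae) eb.
Qed.

(** Let e1 = ab. An edge avoiding b is some ac, and an edge avoiding a must then be bc; any edge
    meeting all three is a side of this triangle. [a0] is the common vertex given for an empty
    family. *)
Lemma intersecting_edges (a0 : T) :
  (forall e f, e \in E -> f \in E -> e :&: f != set0) ->
  (exists a, forall e, e \in E -> a \in e) \/
  (exists a b c, [/\ a != b, b != c, a != c &
     E = [set [set a; b]; [set b; c]; [set a; c]]]).
Proof.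
move=> inter; have [E0|[e1 e1E]] := set_0Vmem E.
  by left; exists a0 => e; rewrite E0 inE.
have /card_gt0P[a ae] : 0 < #|e1| by rewrite E2.
have [b ba e1ab] := two_elements e1E ae.
have meet e f : e \in E -> f \in E -> exists2 x, x \in e & x \in f.
  move=> eE fE; have /set0Pn[x] := inter e f eE fE.
  by rewrite inE => /andP[]; exists x.
have [/forall_inP allb|] := boolP [forall e in E, b \in e]; first by left; exists b.
rewrite negb_forall_in => /exists_inP[e2 e2E nb2].
have [x] := meet _ _ e1E e2E; rewrite e1ab !inE => /orP[]/eqP -> x2; last by rewrite x2 in nb2.
have [c ca e2ac] := two_elements e2E x2.
have cb : c != b by apply: contraNneq nb2 => <-; rewrite e2ac set22.
have [/forall_inP alla|] := boolP [forall e in E, a \in e]; first by left; exists a.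
rewrite negb_forall_in => /exists_inP[e3 e3E na3].
have b3 : b \in e3.
  have [y] := meet _ _ e1E e3E; rewrite e1ab !inE => /orP[]/eqP -> // y3.
  by rewrite y3 in na3.
have c3 : c \in e3.
  have [y] := meet _ _ e2E e3E; rewrite e2ac !inE => /orP[]/eqP -> // y3.
  by rewrite y3 in na3.
have e3bc : e3 = [set b; c].
  by apply/esym/eqP; rewrite eqEcard (E2 e3E) cards2 eq_sym cb andbT subUset !sub1set b3 c3.
right; exists a, b, c; split; rewrite 1?eq_sym //.
apply/setP => f; rewrite !inE -e1ab -e2ac -e3bc.
apply/idP/orP => [fE|]; last first.
  by move=> [/orP[]|] /eqP ->.
have [af|naf] := boolP (a \in f).
  have [y] := meet _ _ e3E fE; rewrite e3bc !inE => /orP[]/eqP -> yf.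
    left; apply/orP; left; rewrite e1ab eq_sym eqEcard (E2 fE) cards2 eq_sym ba andbT.
    by rewrite subUset !sub1set af yf.
  right; rewrite e2ac eq_sym eqEcard (E2 fE) cards2 eq_sym ca andbT.
  by rewrite subUset !sub1set af yf.
have bf : b \in f.
  have [y] := meet _ _ e1E fE; rewrite e1ab !inE => /orP[]/eqP -> // yf.
  by rewrite yf in naf.
have cf : c \in f.
  have [y] := meet _ _ e2E fE; rewrite e2ac !inE => /orP[]/eqP -> // yf.
  by rewrite yf in naf.
left; apply/orP; right; rewrite e3bc eq_sym eqEcard (E2 fE) cards2 eq_sym cb andbT.
by rewrite subUset !sub1set bf cf.
Qed.

End EdgeFamilies.

Section InnerDegree.
Variables (G : sgraph) (r : nat) (c : G -> 'I_r).

Definition inner_nbr (v : G) : {set G} := [set u | (v -- u) && (c u == c v)].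

Lemma inner_nbr_sym u v : (u \in inner_nbr v) = (v \in inner_nbr u).
Proof. by rewrite !inE sedge_sym eq_sym. Qed.

Lemma card_inner_edge e : e \in inner c -> #|e| = 2.
Proof.
move=> /innerP[a [b [ab _ ->]]]; rewrite cards2; case: eqP => // e'.
by rewrite e' sedge_irrefl in ab.
Qed.

Lemma mem_inner u v : ([set u; v] \in inner c) = (v \in inner_nbr u).
Proof.
apply/innerP/idP => [[a [b [ab cab]]]|].
  by case/set2_eqP => -[-> ->]; rewrite inE ?ab ?cab ?eqxx // sedge_sym ab.
by rewrite inE => /andP[uv /eqP cuv]; exists u, v.
Qed.

Lemma card_inner_nbr v : #|inner_nbr v| = edge_degree (inner c) v.
Proof.
rewrite -(card_in_imset (f := fun u => [set v; u]) (D := inner_nbr v)); last first.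
  by move=> u w _ _ /set2_eqP[[]|[<- <-]].
apply: eq_card => e; rewrite !inE; apply/imsetP/andP => [[u vu ->]|[eE ve]].
  by rewrite mem_inner vu set21.
have [u uv ee] := two_elements (@card_inner_edge) eE ve.
by exists u; rewrite // -mem_inner -ee.
Qed.

End InnerDegree.

(** * The eigenvalue equation of a complete multipartite graph with inner edges *)

Section Resolvent.
Local Open Scope ring_scope.
Variables (R : realType) (G : sgraph) (r : nat) (c : G -> 'I_r).
Hypothesis cross : forall u v : G, c u != c v -> u -- v.

Lemma sum_nbr_cross (f : G -> R) v :
  \sum_(u | v -- u) f u =
  \sum_u f u - \sum_(u | c u == c v) f u + \sum_(u in inner_nbr c v) f u.
Proof.
rewrite (bigID (fun u => c u == c v)) /= addrC; congr (_ + _).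
  rewrite [X in _ = X - _](bigID (fun u => c u == c v)) /= addrAC subrr add0r.
  apply: eq_bigl => u; case: eqP => [e|/eqP ne]; rewrite ?andbF // andbT.
  by apply: cross; rewrite eq_sym.
by apply: eq_bigl => u; rewrite inE.
Qed.

Lemma sum_class (f : G -> R) : \sum_v f v = \sum_i \sum_(v | c v == i) f v.
Proof. by rewrite (partition_big c predT). Qed.

Lemma sum_inner_swap (f g : G -> R) i :
  \sum_(v | c v == i) f v * (\sum_(u in inner_nbr c v) g u) =
  \sum_(u | c u == i) (\sum_(v in inner_nbr c u) f v) * g u.
Proof.
under eq_bigr do rewrite mulr_sumr; under [RHS]eq_bigr do rewrite mulr_suml.
rewrite (exchange_big_dep (fun u => c u == i)) /=.
  apply: eq_bigr => u /eqP cu; apply: eq_bigl => v.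
  rewrite inner_nbr_sym andb_idl // !inE cu => /andP[_ /eqP ->].
  by rewrite eqxx.
by move=> v u /eqP <-; rewrite inE => /andP[].
Qed.

Section Equation.
Variables (lam : R) (z : G -> R).
Hypothesis lam0 : 0 < lam.
Hypothesis z0 : forall v, 0 <= z v.
Hypothesis zE : forall v, lam * z v = 1 + \sum_(u in inner_nbr c v) z u.
Let d v : R := #|inner_nbr c v|%:R.

Lemma resolvent_class_sum i : lam * (\sum_(v | c v == i) z v) =
  #|[set v | c v == i]|%:R + \sum_(v | c v == i) d v * z v.
Proof.
rewrite mulr_sumr (eq_bigr _ (fun v _ => zE v)) big_split /=; congr (_ + _).
  by rewrite sumr_const; congr (_%:R); apply: eq_card => v; rewrite inE.
transitivity (\sum_(v | c v == i) 1 * (\sum_(u in inner_nbr c v) z u)).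
  by apply: eq_bigr => v _; rewrite mul1r.
rewrite (sum_inner_swap (fun _ => 1)); apply: eq_bigr => u _.
by rewrite sumr_const.
Qed.

Lemma resolvent_ge v : lam^-1 <= z v.
Proof.
rewrite -(ler_pM2l lam0) mulfV ?gt_eqF // zE lerDl.
by apply: sumr_ge0 => u _.
Qed.

(** Maximum principle: at a maximum w of [z] the equation gives lam * z w <= 1 + m * z w. *)
Lemma resolvent_le (m : nat) : m%:R < lam -> (forall v, (#|inner_nbr c v| <= m)%N) ->
  forall v, z v <= (lam - m%:R)^-1.
Proof.
move=> mlam dm v; pose w := [arg max_(u > v) z u]%O.
have wmax u : z u <= z w by rewrite /w; case: arg_maxP => // i _; apply.
apply: le_trans (wmax v) _; have lm : 0 < lam - m%:R by rewrite subr_gt0.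
rewrite -(ler_pM2l lm) mulfV ?gt_eqF // mulrBl zE lerBlDr lerD2l.
apply: (@le_trans _ _ (\sum_(u in inner_nbr c w) z w)); first by apply: ler_sum.
by rewrite sumr_const -[leLHS]mulr_natl ler_wpM2r // ler_nat.
Qed.

(** The equation for [z] is substituted once before [z] is bounded, which keeps the leading term 2 m
    / lam exact and makes the sum of squared degrees the next coefficient. *)
Lemma resolvent_excess_le (m : nat) : m%:R < lam -> #|inner c| = m ->
  \sum_v d v * z v <=
  (2 * m%:R + (\sum_v #|inner_nbr c v| ^ 2)%N%:R / (lam - m%:R)) / lam.
Proof.
move=> mlam im; have dm v : (#|inner_nbr c v| <= m)%N.
  by rewrite card_inner_nbr -im edge_degree_le.
have zle := resolvent_le mlam dm.
rewrite ler_pdivlMr // mulr_suml.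
have -> : 2 * m%:R = \sum_v d v.
  rewrite -im -natrM -(sum_edge_degree (@card_inner_edge G r c)) natr_sum.
  by apply: eq_bigr => v _; rewrite /d card_inner_nbr.
rewrite natr_sum mulr_suml -big_split; apply: ler_sum => v _ /=.
rewrite -mulrA [z v * _]mulrC zE mulrDr mulr1 lerD2l natrX expr2 -mulrA.
rewrite ler_wpM2l ?ler0n // mulr_natl -sumr_const; apply: ler_sum => u _.
exact: zle.
Qed.

Lemma resolvent_inner_excess u v : u -- v -> c u = c v ->
  2 / lam <= \sum_(w | c w == c u) d w * z w.
Proof.
move=> uv cuv; have nuv : v != u by apply: contraTneq uv => ->; rewrite sedge_irrefl.
have dz w w' : w' \in inner_nbr c w -> lam^-1 <= d w * z w.
  move=> w'w; apply: le_trans (resolvent_ge w) _; rewrite ler_peMl // /d (ler_nat R 1).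
  by apply/card_gt0P; exists w'.
have uiv : v \in inner_nbr c u by rewrite inE uv cuv eqxx.
rewrite (bigD1 u) //= (bigD1 v) /=; last by rewrite cuv eqxx.
have h1 := dz _ _ uiv; have h2 : lam^-1 <= d v * z v by apply: (dz v u); rewrite inner_nbr_sym.
have -> : 2 / lam = lam^-1 + lam^-1 by ring.
apply: lerD => //; rewrite -[leLHS]addr0 lerD // sumr_ge0 // => w _.
by rewrite mulr_ge0 // ler0n.
Qed.

(** The centre value [z a] and the sum L over the leaves solve the linear system lam z = 1 + L, lam
    L = m (1 + z). *)
Lemma resolvent_star a (m : nat) : m%:R < lam ^+ 2 -> #|inner c| = m ->
  (forall e, e \in inner c -> a \in e) ->
  \sum_v d v * z v = (2 * m%:R * lam + m%:R ^+ 2 + m%:R) / (lam ^+ 2 - m%:R).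
Proof.
move=> mlam im star; set L := \sum_(u in inner_nbr c a) z u.
have da : d a = m%:R.
  rewrite /d card_inner_nbr /edge_degree -im; congr (_%:R); apply: eq_card => e.
  by rewrite inE andb_idr //; apply: star.
have leaf u w : u != a -> w \in inner_nbr c u -> w = a.
  rewrite -mem_inner => ua /star; rewrite !inE eq_sym (negPf ua) /=.
  by move/eqP.
have nbr_a u : u \in inner_nbr c a -> inner_nbr c u = [set a].
  move=> ua; have nua : u != a by apply: contraTneq ua => ->; rewrite inE sedge_irrefl.
  apply/setP => w; rewrite inE; apply/idP/eqP => [|->]; first exact: leaf.
  by rewrite inner_nbr_sym.
have za : lam * z a = 1 + L by apply: zE.
have zL : lam * L = m%:R * (1 + z a).
  rewrite -da /L mulr_sumr mulr_natl -sumr_const; apply: eq_bigr => u ua.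
  by rewrite zE (nbr_a u ua) big_set1.
have -> : \sum_v d v * z v = m%:R * z a + L.
  rewrite (bigD1 a) //= da; congr (_ + _).
  rewrite [LHS](bigID (mem (inner_nbr c a))) /= [X in _ + X]big1 ?addr0.
    apply: eq_big => [u|u /andP[_ ua]].
      rewrite andb_idl // => ua; apply: contraTneq ua => ->.
      by rewrite inE sedge_irrefl.
    by rewrite /d nbr_a // cards1 mul1r.
  move=> u /andP[ua nua]; rewrite /d (_ : inner_nbr c u = set0) ?cards0 ?mul0r //.
  apply/setP => w; rewrite in_set0; apply/negbTE; apply: contra nua => wu.
  by rewrite inner_nbr_sym -{1}(leaf u w ua wu).
have den : lam ^+ 2 - m%:R != 0 by rewrite gt_eqF // subr_gt0.
have zaE : z a * (lam ^+ 2 - m%:R) = lam + m%:R.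
  have -> : z a * (lam ^+ 2 - m%:R) = lam * (lam * z a) - m%:R * z a by ring.
  by rewrite za mulrDr zL; ring.
have -> : L = lam * z a - 1 by rewrite za; ring.
apply: (mulIf den); rewrite divfK //.
have -> : (m%:R * z a + (lam * z a - 1)) * (lam ^+ 2 - m%:R) =
   (m%:R + lam) * (z a * (lam ^+ 2 - m%:R)) - (lam ^+ 2 - m%:R) by ring.
by rewrite zaE; ring.
Qed.

End Equation.

(** With S the total weight and S_i that of class i, put z = x / (S - S_i) on class i. The
    neighbours in other classes then contribute exactly 1, and 1 / (1 + sum of z over class i) = 1 -
    S_i / S; these terms add up to r - 1. *)
Lemma eigenweight_resolvent (x : G -> R) : (1 < r)%N -> eigenweight x ->
  (forall v, 0 < x v) -> (forall i, exists v, c v = i) ->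
  exists z : G -> R, [/\ forall v, 0 <= z v,
    forall v, rho R G * z v = 1 + \sum_(u in inner_nbr c v) z u
    & \sum_i (1 + \sum_(v | c v == i) z v)^-1 = r%:R - 1].
Proof.
move=> r1 xP xpos surj; have [x0 xn xE] := xP.
pose S := \sum_v x v; pose Sc i := \sum_(v | c v == i) x v.
have SE : S = \sum_i Sc i by apply: sum_class.
have Sc0 i : 0 < Sc i.
  have [v cv] := surj i; rewrite /Sc (bigD1 v) ?cv //= ltr_pwDl //.
  by apply: sumr_ge0 => u _.
have SS i : 0 < S - Sc i.
  have [j ji] : exists j, j != i.
    have /card_gt0P[j] : (0 < #|predC1 i|)%N by rewrite cardC1 card_ord -subn1 subn_gt0.
    by exists j.
  rewrite SE (bigD1 i) //= addrAC subrr add0r (bigD1 j) //= ltr_pwDl //.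
  by apply: sumr_ge0 => u _; apply: ltW.
exists (fun v => x v / (S - Sc (c v))); split.
- by move=> v; rewrite divr_ge0 // ltW.
- move=> v; rewrite mulrA -xE sum_nbr_cross mulrDl; congr (_ + _).
    by rewrite mulfV // gt_eqF //; apply: SS.
  rewrite mulr_suml; apply: eq_bigr => u; rewrite inE => /andP[_ /eqP ->].
  by [].
- have wE i : \sum_(v | c v == i) x v / (S - Sc (c v)) = Sc i / (S - Sc i).
    by rewrite [in RHS]mulr_suml; apply: eq_bigr => v /eqP ->.
  have S0 : 0 < S by have := SS (Ordinal (ltnW r1)); have := Sc0 (Ordinal (ltnW r1)); lra.
  rewrite (eq_bigr (fun i => 1 - Sc i / S)); last first.
    move=> i _; rewrite wE; have h1 := SS i.
    have : 1 + Sc i / (S - Sc i) = S / (S - Sc i) by field; rewrite gt_eqF.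
    by move=> ->; rewrite invf_div mulrBl mulfV // gt_eqF.
  by rewrite sumrB sumr_const card_ord -mulr_suml -SE mulfV // gt_eqF.
Qed.

(** The converse construction: y = z / (1 + w i) has total phi > 1 and satisfies A y >= lam y + (phi
    - 1), so its Rayleigh quotient exceeds lam. The inequality for [z] suffices here. *)
Lemma rho_gt_resolvent (lam : R) (z : G -> R) : 0 < lam -> (forall v, 0 <= z v) ->
  (forall v, lam * z v <= 1 + \sum_(u in inner_nbr c v) z u) ->
  \sum_i (1 + \sum_(v | c v == i) z v)^-1 < r%:R - 1 -> lam < rho R G.
Proof.
move=> lam0 z0 zE lt; pose w i := \sum_(v | c v == i) z v.
have w0 i : 0 <= w i by apply: sumr_ge0.
have w1 i : 0 < 1 + w i by rewrite ltr_pwDl.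
pose y v := z v / (1 + w (c v)).
have y0 v : 0 <= y v by rewrite divr_ge0 // ltW.
have yc i : \sum_(v | c v == i) y v = 1 - (1 + w i)^-1.
  rewrite (eq_bigr (fun v => z v / (1 + w i))); last by move=> v /eqP <-.
  rewrite -mulr_suml -/(w i) -{1}[w i](addKr 1) mulrDl mulfV ?gt_eqF //.
  by rewrite addrC mulN1r.
pose phi := \sum_v y v.
have phiE : phi = r%:R - \sum_i (1 + w i)^-1.
  by rewrite /phi sum_class (eq_bigr _ (fun i _ => yc i)) sumrB sumr_const card_ord.
have phi1 : 1 < phi by rewrite phiE ltrBrDr -ltrBrDl.
have Ay v : lam * y v + (phi - 1) <= \sum_(u | v -- u) y u.
  rewrite sum_nbr_cross -/phi yc.
  have -> : \sum_(u in inner_nbr c v) y u = (\sum_(u in inner_nbr c v) z u) / (1 + w (c v)).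
    by rewrite mulr_suml; apply: eq_bigr => u; rewrite inE => /andP[_ /eqP cu]; rewrite /y cu.
  have := ler_wpM2r (ltW (_ : 0 < (1 + w (c v))^-1)) (zE v).
  rewrite invr_gt0 => /(_ (w1 _)); rewrite mulrDl mul1r -mulrA -/(y v); lra.
have := rho_quad y; set A := \sum_u y u * _; set N := \sum_u y u ^+ 2 => h1.
have h2 : lam * N + (phi - 1) * phi <= A.
  rewrite /A /N {2}/phi !mulr_sumr -big_split; apply: ler_sum => v _ /=.
  have := ler_wpM2l (y0 v) (Ay v); rewrite expr2; lra.
have h3 : 0 < (phi - 1) * phi by rewrite mulr_gt0 ?subr_gt0 //; apply: lt_trans phi1.
have N0 : 0 <= N by apply: sumr_ge0 => v _; apply: sqr_ge0.
rewrite ltNge; apply/negP => le.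
have := ler_wpM2r N0 le; lra.
Qed.

End Resolvent.

(** * The target graph and a lower bound for its spectral radius *)

Section Embed.
Variables (T H : sgraph) (h : H -> T).
Hypothesis h_inj : injective h.

Definition embed_rel : rel T := fun x y =>
  (x -- y) || [exists u, exists v, [&& u -- v, h u == x & h v == y]].

Lemma embed_relP x y : reflect (x -- y \/ exists u v : H, [/\ u -- v, h u = x & h v = y])
  (embed_rel x y).
Proof.
apply: (iffP orP) => -[->|]; try by left.
  by case/existsP=> u /existsP[v /and3P[uv /eqP hu /eqP hv]]; right; exists u, v.
case=> u [v [uv hu hv]]; right; apply/existsP; exists u; apply/existsP; exists v.
by rewrite uv hu hv !eqxx.
Qed.

Lemma embed_sym : symmetric embed_rel.
Proof.
move=> x y; apply/embed_relP/embed_relP => -[xy|[u [v [uv hu hv]]]].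
- by left; rewrite sedge_sym.
- by right; exists v, u; rewrite sedge_sym.
- by left; rewrite sedge_sym.
- by right; exists v, u; rewrite sedge_sym.
Qed.

Lemma embed_irrefl : irreflexive embed_rel.
Proof.
move=> x; apply/negbTE/negP => /embed_relP[|[u [v [uv hu hv]]]].
  by rewrite sedge_irrefl.
by move: uv; rewrite (h_inj (etrans hu (esym hv))) sedge_irrefl.
Qed.

Definition embed_graph := SGraph embed_sym embed_irrefl.

Section EmbedClass.
Variables (r : nat) (c : T -> 'I_r) (i0 : 'I_r).
Hypothesis T_multi : forall x y : T, (x -- y) = (c x != c y).
Hypothesis h_class : forall u, c (h u) = i0.
Let cG : embed_graph -> 'I_r := c.

Lemma embed_cross (x y : embed_graph) : cG x != cG y -> x -- y.
Proof. by move=> cxy; apply/embed_relP; left; rewrite T_multi. Qed.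

Lemma embed_inner_nbr (x y : embed_graph) : (y \in inner_nbr cG x) =
  [exists u, exists v, [&& u -- v, h u == x & h v == y]].
Proof.
rewrite inE; apply/andP/idP => [[xy /eqP cxy]|].
  by case/orP: (xy : embed_rel x y) => //; rewrite T_multi -[c y]/(cG y) cxy eqxx.
move=> ex; split; first by apply/orP; right.
by case/existsP: ex => u /existsP[v /and3P[_ /eqP <- /eqP <-]]; rewrite /cG !h_class.
Qed.

Lemma embed_inner_nbr_image u : inner_nbr cG (h u) = [set h v | v in nbr u].
Proof.
apply/setP => y; rewrite embed_inner_nbr; apply/existsP/imsetP => [[u']|[v vu ->]].
  by case/existsP=> v /and3P[uv /eqP/h_inj <- /eqP <-]; exists v; rewrite // inE.
by exists u; apply/existsP; exists v; rewrite inE in vu; rewrite vu !eqxx.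
Qed.

Lemma card_embed_inner : #|inner cG| <= #|edges H|.
Proof.
pose f (e : {set H}) : {set embed_graph} := [set h u | u in e].
apply: leq_trans (leq_imset_card f _); apply/subset_leq_card/subsetP => e.
case/innerP=> x [y [xy cxy ->]].
have : y \in inner_nbr cG x by rewrite inE xy cxy eqxx.
rewrite embed_inner_nbr => /existsP[u /existsP[v /and3P[uv /eqP hu /eqP hv]]].
apply/imsetP; exists [set u; v]; first by apply/edgesP; exists u, v.
by rewrite /f imsetU1 imset_set1 hu hv.
Qed.

Lemma obtained_embed (A : {set T}) : (forall u, h u \in A) ->
  obtained_by_embedding A H embed_graph.
Proof.
move=> hA; exists id, h; split=> //; first by exists id.
by move=> x y; split=> [/embed_relP|/embed_relP].
Qed.

Local Open Scope ring_scope.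

Lemma rho_embed_gt (R : realType) (lam : R) (zeta : H -> R) : 0 < lam ->
  (forall u, 0 <= zeta u) ->
  (forall u, lam * zeta u <= 1 + \sum_(v | u -- v) zeta v) ->
  \sum_i (lam + #|[set x | c x == i]|%:R +
    (if i == i0 then \sum_u (lam * zeta u - 1) else 0))^-1 < (r%:R - 1) / lam ->
  lam < rho R embed_graph.
Proof.
move=> lam0 zeta0 zetaE lt.
(* Away from the copy there are no inner neighbours, and lam^-1 solves the equation there. *)
pose z (x : embed_graph) := if [pick u | h u == x] is Some u then zeta u else lam^-1.
have zh u : z (h u) = zeta u.
  by rewrite /z; case: pickP => [v /eqP/h_inj -> //|/(_ u)]; rewrite eqxx.
have zn (x : embed_graph) : x \notin codom h -> z x = lam^-1.
  by rewrite /z; case: pickP => // u /eqP <-; rewrite codom_f.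
have z0 x : 0 <= z x.
  by rewrite /z; case: pickP => // _; rewrite invr_ge0 ltW.
apply: (@rho_gt_resolvent R embed_graph r cG embed_cross lam z) => //.
  move=> x; have [/codomP[u ->]|nx] := boolP (x \in codom h).
    rewrite zh embed_inner_nbr_image big_imset /=; last by move=> v w _ _ /h_inj.
    apply: le_trans (zetaE u) _; rewrite lerD2l le_eqVlt; apply/orP; left; apply/eqP.
    by apply: eq_big => v; rewrite ?zh // inE.
  by rewrite zn // mulfV ?gt_eqF // lerDl sumr_ge0.
have wE i : lam * (\sum_(x | cG x == i) z x) = #|[set x | c x == i]|%:R +
    (if i == i0 then \sum_u (lam * zeta u - 1) else 0).
  have -> : #|[set x | c x == i]|%:R = \sum_(x | cG x == i) 1 :> R.
    by rewrite sumr_const; congr (_%:R); apply: eq_card => x; rewrite inE.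
  apply: (addrI (- \sum_(x | cG x == i) 1)); rewrite addKr addrC mulr_sumr -sumrB.
  have [->|ni] := eqVneq i i0.
    rewrite (bigID (fun x => x \in codom h)) /= [X in _ + X]big1 ?addr0; last first.
      by move=> x /andP[_ nx]; rewrite zn // mulfV ?subrr // gt_eqF.
    transitivity (\sum_(x in [set (h u : embed_graph) | u in [set: H]]) (lam * z x - 1)).
      apply: eq_bigl => x; apply/andP/imsetP => [[_ /codomP[u ->]]|[u _ ->]].
        by exists u; rewrite ?in_setT.
      by rewrite codom_f /cG h_class eqxx.
    rewrite big_imset /=; last by move=> v w _ _ /h_inj.
    by apply: eq_big => u; rewrite ?in_setT // zh.
  apply: big1 => x /eqP cx; rewrite zn; first by rewrite mulfV ?subrr // gt_eqF.
  by apply/negP => /codomP[u xu]; move: ni; rewrite -cx xu /cG h_class eqxx.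
move: lt; rewrite ltr_pdivlMr // mulr_suml; apply: le_lt_trans.
rewrite le_eqVlt; apply/orP; left; apply/eqP; apply: eq_bigr => i _.
rewrite -addrA -wE -[X in X + lam * _]mulr1 -mulrDr invfM mulrAC mulVf ?mul1r //.
by rewrite gt_eqF.
Qed.

End EmbedClass.
End Embed.

(** * Comparison with the target graph *)

Section Comparison.
Local Open Scope ring_scope.
Variable R : realType.
Implicit Types (tau s b : R).

(** The secant of s |-> 1 / (tau + s) through s = 0 and s = 1. It is affine in s, so its sum over
    the classes depends only on the number of vertices, and it is exact at both balanced sizes p and
    p + 1. *)
Definition chord tau s : R := (tau + 1 - s) / (tau * (tau + 1)).

Lemma inv_chord_0 tau : 0 < tau -> tau^-1 = chord tau 0.
Proof. by move=> t0; rewrite /chord; field; rewrite !gt_eqF //; lra. Qed.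

Lemma inv_chord_1 tau : 0 < tau -> (tau + 1)^-1 = chord tau 1.
Proof. by move=> t0; rewrite /chord; field; rewrite !gt_eqF //; lra. Qed.

Lemma inv_shift_ge (A b : R) : 0 < A -> 0 <= b -> A^-1 - b / A ^+ 2 <= (A + b)^-1.
Proof.
move=> A0 b0; have Ab : 0 < A + b by lra.
rewrite -subr_ge0.
have -> : (A + b)^-1 - (A^-1 - b / A ^+ 2) = b ^+ 2 / (A ^+ 2 * (A + b)).
  by field; rewrite !gt_eqF.
by rewrite divr_ge0 ?mulr_ge0 ?sqr_ge0 // ltW.
Qed.

Lemma gap_at_0 tau b : 0 < tau -> 0 <= b -> chord tau 0 - b / tau ^+ 2 <= (tau + b)^-1.
Proof. by move=> t0 b0; rewrite -inv_chord_0 // inv_shift_ge. Qed.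

Lemma gap_at_1 tau b : 0 < tau -> 0 <= b ->
  chord tau 1 - (b - b / (tau + 1)) / tau ^+ 2 <= (tau + 1 + b)^-1.
Proof.
move=> t0 b0; have t1 : 0 < tau + 1 by lra.
rewrite -inv_chord_1 //; apply: le_trans (inv_shift_ge t1 b0).
rewrite lerD2l lerN2 -subr_ge0.
have -> : (b - b / (tau + 1)) / tau ^+ 2 - b / (tau + 1) ^+ 2 = b / (tau * (tau + 1) ^+ 2).
  by field; rewrite !gt_eqF.
by rewrite divr_ge0 // mulr_ge0 ?sqr_ge0 // ltW.
Qed.

(** For s beyond 0 and 1, convexity lifts 1 / (tau + s) above the chord by s (s - 1) / (tau (tau +
    1) (tau + s)) >= |s| / (2 tau^3). With b <= 1/16, evaluating the b-term at tau + s instead of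
    tau costs at most half of this. *)
Lemma gap_far tau s b : 8 <= tau -> 0 <= b <= 1 / 16 -> `|s| <= tau / 4 ->
  1 <= `|s| -> `|s| <= s * (s - 1) ->
  chord tau s - (b - 1 / (4 * tau)) / tau ^+ 2 <= (tau + s + b)^-1.
Proof.
move=> t8 /andP[b0 b16] st s1 ss; have t0 : 0 < tau by lra.
set a := `|s| in st s1 ss.
have [sa sa'] : s <= a /\ - s <= a by split; [exact: ler_norm | rewrite /a -normrN ler_norm].
have A0 : 3 / 4 * tau <= tau + s by lra.
have A1 : tau + s <= 5 / 4 * tau by lra.
have Ap : 0 < tau + s by lra.
apply: le_trans (inv_shift_ge Ap b0).
set A := tau + s in A0 A1 Ap *.
have T3 : 0 < tau ^+ 3 by rewrite exprn_gt0.
have h2 : a / (2 * tau ^+ 3) <= A^-1 - chord tau s.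
  have -> : A^-1 - chord tau s = s * (s - 1) / (tau * (tau + 1) * A).
    by rewrite /chord /A; field; rewrite !gt_eqF //; lra.
  have D0 : 0 < tau * (tau + 1) * A by rewrite !mulr_gt0 //; lra.
  have DD : tau * (tau + 1) * A <= 2 * tau ^+ 3.
    have k1 : tau * (tau + 1) <= tau * (9 / 8 * tau) by rewrite ler_pM2l //; lra.
    have k2 : tau * (tau + 1) * A <= tau * (9 / 8 * tau) * (5 / 4 * tau).
      by rewrite ler_pM // ?mulr_ge0 //; lra.
    apply: le_trans k2 _; have -> : tau * (9 / 8 * tau) * (5 / 4 * tau) = 45 / 32 * tau ^+ 3 by field.
    lra.
  rewrite ler_pM //; [lra | by rewrite invr_ge0 ltW // mulr_gt0 |].
  by rewrite lef_pV2 // posrE // mulr_gt0.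
have h3 : b / A ^+ 2 - b / tau ^+ 2 <= 4 * b * a / tau ^+ 3.
  have -> : b / A ^+ 2 - b / tau ^+ 2 = b * (- s * (2 * tau + s)) / (tau ^+ 2 * A ^+ 2).
    by rewrite /A; field; rewrite !gt_eqF.
  have k1 : - s * (2 * tau + s) <= a * (9 / 4 * tau).
    apply: (@le_trans _ _ (a * (2 * tau + s))); first by rewrite ler_wpM2r //; lra.
    by rewrite ler_wpM2l //; lra.
  have k2 : 9 / 16 * tau ^+ 4 <= tau ^+ 2 * A ^+ 2.
    have -> : 9 / 16 * tau ^+ 4 = tau ^+ 2 * (3 / 4 * tau) ^+ 2 by field.
    rewrite ler_wpM2l ?sqr_ge0 // ler_pXn2r // nnegrE; lra.
  have D0 : 0 < tau ^+ 2 * A ^+ 2 by rewrite mulr_gt0 ?exprn_gt0.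
  rewrite ler_pdivrMr //.
  apply: (@le_trans _ _ (4 * b * a / tau ^+ 3 * (9 / 16 * tau ^+ 4))); last first.
    by rewrite ler_wpM2l // divr_ge0 ?mulr_ge0 //; lra.
  have -> : 4 * b * a / tau ^+ 3 * (9 / 16 * tau ^+ 4) = b * (a * (9 / 4 * tau)).
    by field; rewrite gt_eqF.
  by rewrite ler_wpM2l.
have h4 : 4 * b * a / tau ^+ 3 <= a / (4 * tau ^+ 3).
  have -> : a / (4 * tau ^+ 3) = 4 * (1 / 16) * a / tau ^+ 3 by field; rewrite gt_eqF.
  rewrite ler_pM2r ?invr_gt0 // ler_pM2r; lra.
have h5 : 1 / (4 * tau ^+ 3) <= a / (4 * tau ^+ 3).
  by rewrite ler_pM2r ?invr_gt0 ?mulr_gt0 //.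
have e1 : (b - 1 / (4 * tau)) / tau ^+ 2 = b / tau ^+ 2 - 1 / (4 * tau ^+ 3).
  by field; rewrite gt_eqF.
have e2 : a / (2 * tau ^+ 3) = 2 * (a / (4 * tau ^+ 3)) by field; rewrite gt_eqF.
rewrite e1; rewrite e2 in h2; lra.
Qed.

(** The amount, in units of tau^-2, by which a class of size N and excess b lies above the chord
    corrected by - b / tau^2. For size p + 1 it reflects that an excess weighs less in a larger
    class, for other sizes the convexity of 1 / t. *)
Definition gain tau p (N : nat) b : R :=
  if N == p then 0 else if N == p.+1 then b / (tau + 1) else 1 / (4 * tau).

Lemma gap tau p (N : nat) b : 8 <= tau -> 0 <= b <= 1 / 16 ->
  `|N%:R - p%:R| <= tau / 4 ->
  chord tau (N%:R - p%:R) - (b - gain tau p N b) / tau ^+ 2 <=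
  (tau + (N%:R - p%:R) + b)^-1.
Proof.
move=> t8 bb Np; have t0 : 0 < tau by lra.
have b0 : 0 <= b by case/andP: bb.
rewrite /gain; case: eqP => [->|N0].
  by rewrite subrr subr0 addr0 gap_at_0.
case: eqP => [->|N1].
  by rewrite -natr1 addrAC subrr add0r gap_at_1.
have cases : N%:R - p%:R <= -1 :> R \/ 2 <= N%:R - p%:R :> R.
  have [lt|le] := ltnP N p.
    left; have : N.+1%:R <= p%:R :> R by rewrite ler_nat.
    by rewrite -natr1; lra.
  right; have : p.+2%:R <= N%:R :> R by rewrite ler_nat; clear -N0 N1 le; lia.
  by rewrite -!natr1; lra.
apply: gap_far => //.
  by case: cases => h; [rewrite ler0_norm | rewrite ger0_norm]; lra.
case: cases => h; [rewrite ler0_norm; last by lra | rewrite ger0_norm; last by lra].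
  by have := sqr_ge0 (N%:R - p%:R : R); rewrite expr2; nra.
by nra.
Qed.

(** The chord contributions cancel because both families have the same total size, leaving a
    comparison of excesses of order tau^-2. The lower bound [bl] of the target excess [bs] lets one
    estimate serve stars and triangle. *)
Lemma target_sum_lt (r p : nat) (N t : 'I_r -> nat) (b : 'I_r -> R) (i0 : 'I_r)
    (lam bl bs : R) :
  0 <= lam -> 8 <= lam + p%:R -> (\sum_i N i = \sum_i t i)%N ->
  (forall i, t i = p \/ t i = p.+1) -> t i0 = p ->
  (forall i, 0 <= b i <= 1 / 16) ->
  (forall i, `|(N i)%:R - p%:R| <= (lam + p%:R) / 4) -> 0 <= bl -> bl <= bs ->
  \sum_i (b i - gain (lam + p%:R) p (N i) (b i)) < bl - bl ^+ 2 / (lam + p%:R) ->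
  \sum_i (lam + (t i)%:R + (if i == i0 then bs else 0))^-1 <
  \sum_i (lam + (N i)%:R + b i)^-1.
Proof.
set tau := lam + p%:R => lam0 t8 Nt tp ti0 b16 Np bl0 bls main.
have t0 : 0 < tau by lra.
have chordD (f : 'I_r -> nat) : \sum_i chord tau ((f i)%:R - p%:R) =
    (r%:R * (tau + 1 + p%:R) - (\sum_i f i)%N%:R) / (tau * (tau + 1)).
  rewrite -mulr_suml natr_sum; congr (_ / _).
  have -> : r%:R * (tau + 1 + p%:R) = \sum_(i < r) (tau + 1 + p%:R) :> R.
    by rewrite sumr_const card_ord -[RHS]mulr_natl.
  by rewrite -sumrB; apply: eq_bigr => i _; ring.
have lower : \sum_i chord tau ((N i)%:R - p%:R) -
    (\sum_i (b i - gain tau p (N i) (b i))) / tau ^+ 2 <= \sum_i (lam + (N i)%:R + b i)^-1.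
  rewrite mulr_suml -sumrB; apply: ler_sum => i _.
  have -> : lam + (N i)%:R + b i = tau + ((N i)%:R - p%:R) + b i by rewrite /tau; ring.
  exact: gap.
have upper : \sum_i (lam + (t i)%:R + (if i == i0 then bs else 0))^-1 <=
    \sum_i chord tau ((t i)%:R - p%:R) - (bl - bl ^+ 2 / tau) / tau ^+ 2.
  rewrite (bigD1 i0) //= [X in _ <= X - _](bigD1 i0) //= eqxx ti0 subrr -/tau.
  have -> : \sum_(i < r | i != i0) (lam + (t i)%:R + (if i == i0 then bs else 0))^-1 =
      \sum_(i < r | i != i0) chord tau ((t i)%:R - p%:R).
    apply: eq_bigr => i /negPf ->; rewrite addr0; case: (tp i) => ->.
      by rewrite subrr -inv_chord_0.
    by rewrite -natr1 [p%:R + 1]addrC addrK -inv_chord_1 // /tau addrA addrAC.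
  rewrite [leRHS]addrAC lerD2r.
  apply: (@le_trans _ _ (tau + bl)^-1).
    by rewrite lef_pV2 ?posrE ?lerD2l //; lra.
  rewrite -inv_chord_0 // -subr_ge0.
  have -> : tau^-1 - (bl - bl ^+ 2 / tau) / tau ^+ 2 - (tau + bl)^-1 =
      bl ^+ 3 / (tau ^+ 3 * (tau + bl)).
    by field; rewrite !gt_eqF //; lra.
  by rewrite divr_ge0 ?mulr_ge0 ?exprn_ge0 //; lra.
apply: le_lt_trans upper (lt_le_trans _ lower).
rewrite !chordD Nt ltrD2l ltrN2 ltr_pM2r // invr_gt0 exprn_gt0 //.
Qed.

(* Both sides are expanded to order [lam ^- 3]; the hypothesis is the gap at order [lam ^- 2]. *)
Lemma excess_lt (m D : nat) (lam tau beta gn : R) :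
  1 <= lam -> lam <= tau -> (2 * m%:R <= lam) -> (D <= m ^ 2 + m)%N ->
  2 * (9 * m%:R ^+ 2 + 2 * m%:R * (m%:R ^+ 2 + m%:R) + 1) < lam ->
  beta <= (2 * m%:R + D%:R / (lam - m%:R)) / lam ->
  1 / 2 <= m%:R ^+ 2 + m%:R - D%:R + gn * lam ^+ 2 ->
  let bl := (2 * m%:R * lam + m%:R ^+ 2 + m%:R) / lam ^+ 2 in
  beta - gn < bl - bl ^+ 2 / tau.
Proof.
move=> l1 lt ml Dm Cl bb g /=; set M : R := m%:R in ml Cl bb g *; set d : R := D%:R in bb g *.
have M0 : 0 <= M by apply: ler0n.
have d0 : 0 <= d by apply: ler0n.
have l0 : 0 < lam by lra.
have dM : d <= M ^+ 2 + M by rewrite /d /M -natrX -natrD ler_nat.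
have lM : 0 < lam - M by lra.
have L3 : 0 < lam ^+ 3 by rewrite exprn_gt0.
have L2 : 0 < lam ^+ 2 by rewrite exprn_gt0.
have h1 : d / (lam - M) / lam <= d / lam ^+ 2 + 2 * M * d / lam ^+ 3.
  rewrite -subr_ge0.
  have -> : d / lam ^+ 2 + 2 * M * d / lam ^+ 3 - d / (lam - M) / lam =
     d * M * (lam - 2 * M) / (lam ^+ 3 * (lam - M)) by field; rewrite !gt_eqF.
  by rewrite divr_ge0 ?mulr_ge0 //; lra.
have h2 : 2 * M * d / lam ^+ 3 <= 2 * M * (M ^+ 2 + M) / lam ^+ 3.
  by rewrite ler_pM2r ?invr_gt0 // ler_wpM2l //; lra.
set bl := _ / lam ^+ 2.
have bl3 : 0 <= bl <= 3 * M / lam.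
  apply/andP; split; first by rewrite divr_ge0 ?sqr_ge0 // !addr_ge0 ?mulr_ge0 ?sqr_ge0 //; lra.
  rewrite /bl ler_pdivrMr //.
  have -> : 3 * M / lam * lam ^+ 2 = 3 * M * lam by field; rewrite gt_eqF.
  have h : M + 1 <= lam by have := sqr_ge0 M; have := mulr_ge0 M0 (sqr_ge0 M); lra.
  by have := ler_wpM2l M0 h; rewrite !expr2; lra.
have h3 : bl ^+ 2 / tau <= 9 * M ^+ 2 / lam ^+ 3.
  case/andP: bl3 => b0 b3.
  have k1 : bl ^+ 2 <= (3 * M / lam) ^+ 2 by rewrite ler_pXn2r // nnegrE // (le_trans b0).
  have -> : 9 * M ^+ 2 / lam ^+ 3 = (3 * M / lam) ^+ 2 / lam by field; rewrite gt_eqF.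
  by rewrite ler_pM ?sqr_ge0 ?invr_ge0 ?lef_pV2 ?posrE //; lra.
have e1 : bl = 2 * M / lam + (M ^+ 2 + M) / lam ^+ 2 by rewrite /bl; field; rewrite gt_eqF.
have h4 : beta <= 2 * M / lam + d / (lam - M) / lam by apply: le_trans bb _; rewrite mulrDl.
have h5 : (9 * M ^+ 2 + 2 * M * (M ^+ 2 + M)) / lam ^+ 3 < 1 / 2 / lam ^+ 2.
  have -> : 1 / 2 / lam ^+ 2 = lam / 2 / lam ^+ 3 by field; rewrite gt_eqF.
  by rewrite ltr_pM2r ?invr_gt0 //; lra.
have h6 : 1 / 2 / lam ^+ 2 <= (M ^+ 2 + M - d) / lam ^+ 2 + gn.
  have -> : (M ^+ 2 + M - d) / lam ^+ 2 + gn = (M ^+ 2 + M - d + gn * lam ^+ 2) / lam ^+ 2.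
    by field; rewrite gt_eqF.
  by rewrite ler_pM2r ?invr_gt0.
have e2 : (9 * M ^+ 2 + 2 * M * (M ^+ 2 + M)) / lam ^+ 3 =
   9 * M ^+ 2 / lam ^+ 3 + 2 * M * (M ^+ 2 + M) / lam ^+ 3 by rewrite mulrDl.
have e3 : (M ^+ 2 + M - d) / lam ^+ 2 = (M ^+ 2 + M) / lam ^+ 2 - d / lam ^+ 2 by rewrite mulrBl.
rewrite e1 in h3 *; lra.
Qed.

End Comparison.

(** * Inner edges and subsolutions of the two possible targets *)

Lemma card_edges_star m : #|edges (star m)| <= m.
Proof.
pose f (j : 'I_m) : {set star m} := [set (ord0 : 'I_m.+1); lift ord0 j].
rewrite -[X in _ <= X]card_ord; apply: leq_trans (leq_imset_card f _).
apply/subset_leq_card/subsetP => e /edgesP[a [b [ab ->]]].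
have {}ab : ((a : 'I_m.+1) == ord0) != ((b : 'I_m.+1) == ord0) := ab.
case: (unliftP ord0 (a : 'I_m.+1)) ab => [a' ->|->]; case: (unliftP ord0 (b : 'I_m.+1)) => [b' ->|->].
- by [].
- by move=> _; apply/imsetP; exists a'; rewrite // /f finset.setUC.
- by move=> _; apply/imsetP; exists b'.
- by [].
Qed.

Lemma card_edges_complete3 : #|edges (complete 3)| <= 3.
Proof.
apply: leq_trans (_ : #|[set A : {set 'I_3} | #|A| == 2]| <= 3); last by rewrite card_draws card_ord.
apply/subset_leq_card/subsetP => e /edgesP[a [b [ab ->]]].
by rewrite inE cards2 (ab : (a : 'I_3) != b).
Qed.

Section Targets.
Local Open Scope ring_scope.
Variable R : realType.

(** [z0] and [z1] are the centre and leaf values of the exact solution. *)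
Lemma star_subsolution (m : nat) (lam : R) : 0 < lam -> m%:R < lam ^+ 2 ->
  exists zeta : star m -> R, [/\ forall u, 0 <= zeta u,
    forall u, lam * zeta u <= 1 + \sum_(v | u -- v) zeta v
  & \sum_u (lam * zeta u - 1) = (2 * m%:R * lam + m%:R ^+ 2 + m%:R) / (lam ^+ 2 - m%:R)].
Proof.
move=> l0 ml; have m0 : 0 <= m%:R :> R by apply: ler0n.
set M : R := m%:R in ml m0 *.
have den : 0 < lam ^+ 2 - M by rewrite subr_gt0.
pose z0 := (lam + M) / (lam ^+ 2 - M); pose z1 := (lam + 1) / (lam ^+ 2 - M).
pose zeta (u : 'I_m.+1) := if u == ord0 then z0 else z1.
have zE (u : 'I_m.+1) : u != ord0 -> zeta u = z1 by rewrite /zeta => /negPf ->.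
have sum1 : \sum_(u | u != ord0) zeta u = M * z1.
  rewrite (eq_bigr _ zE) sumr_const -[LHS]mulr_natl; congr (_%:R * _).
  by rewrite -[RHS](_ : #|predC1 (ord0 : 'I_m.+1)| = m) ?cardC1 ?card_ord //; apply: eq_card.
exists zeta; split.
- by move=> u; rewrite /zeta; case: ifP => _; rewrite divr_ge0 //; lra.
- move=> u; have [->|nu] := eqVneq (u : 'I_m.+1) ord0.
    rewrite (eq_bigl (fun v : 'I_m.+1 => v != ord0)) ?sum1; last first.
      by move=> v; rewrite -[@sedge (star m) _ _]/((ord0 == ord0 :> 'I_m.+1) != (v == ord0 :> 'I_m.+1)) eqxx; case: (v == ord0 :> 'I_m.+1).
    rewrite /zeta eqxx le_eqVlt; apply/orP; left; apply/eqP; rewrite /z0 /z1.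
    by field; rewrite gt_eqF.
  rewrite (eq_bigl (fun v : 'I_m.+1 => v == ord0)); last first.
    by move=> v; rewrite -[@sedge (star m) _ _]/((u == ord0 :> 'I_m.+1) != (v == ord0 :> 'I_m.+1)) (negPf nu); case: (v == ord0 :> 'I_m.+1).
  rewrite big_pred1_eq zE // /zeta eqxx le_eqVlt; apply/orP; left; apply/eqP; rewrite /z0 /z1.
  by field; rewrite gt_eqF.
- rewrite (bigD1 (ord0 : 'I_m.+1)) //= sumrB -mulr_sumr sum1 sumr_const.
  rewrite (_ : #|_| = m); last first.
    by rewrite -[RHS](_ : #|predC1 (ord0 : 'I_m.+1)| = m) ?cardC1 ?card_ord //; apply: eq_card.
  rewrite -/M /zeta eqxx /z0 /z1; by field; rewrite gt_eqF.
Qed.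

Lemma triangle_subsolution (lam : R) : 2 < lam ->
  exists zeta : complete 3 -> R, [/\ forall u, 0 <= zeta u,
    forall u, lam * zeta u <= 1 + \sum_(v | u -- v) zeta v
  & \sum_u (lam * zeta u - 1) = 6 / (lam - 2)].
Proof.
move=> l2; have den : 0 < lam - 2 by lra.
exists (fun _ => (lam - 2)^-1); split.
- by move=> u; rewrite invr_ge0 ltW.
- move=> u; rewrite sumr_const.
  have -> : #|[pred v : complete 3 | u -- v]| = 2%N.
    have E : #|predC1 (u : 'I_3)| = 2%N by rewrite cardC1 card_ord.
    rewrite -[RHS]E; apply: eq_card => v.
    by rewrite !inE -[@sedge (complete 3) _ _]/((u : 'I_3) != v) eq_sym.
  rewrite le_eqVlt; apply/orP; left; apply/eqP; rewrite -[(lam - 2)^-1 *+ 2]mulr_natl.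
  by field; rewrite gt_eqF.
- rewrite sumr_const card_ord -[LHS]mulr_natl.
  by field; rewrite gt_eqF.
Qed.

(* When the sizes are balanced the two sums differ only in the classes carrying the inner edges. *)
Lemma balanced_sum_lt (r p : nat) (N t : 'I_r -> nat) (b : 'I_r -> R) (i0 j : 'I_r)
    (lam bs : R) :
  0 < lam -> (\sum_i N i = \sum_i t i)%N ->
  (forall i, t i = p \/ t i = p.+1) -> (forall i, N i = p \/ N i = p.+1) ->
  t i0 = p -> N j = p -> (forall i, i != j -> b i = 0) -> 0 <= b j -> b j < bs ->
  \sum_i (lam + (t i)%:R + (if i == i0 then bs else 0))^-1 <
  \sum_i (lam + (N i)%:R + b i)^-1.
Proof.
move=> lam0 Nt tp Np ti0 Nj b0 bj0 bbs.
have p0 : 0 <= p%:R :> R by apply: ler0n.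
set tau := lam + p%:R; have t0 : 0 < tau by rewrite /tau; lra.
have inv (a : nat) : a = p \/ a = p.+1 -> (lam + a%:R)^-1 = chord tau (a%:R - p%:R).
  case=> ->; first by rewrite subrr -inv_chord_0.
  by rewrite -natr1 [p%:R + 1]addrC addrK -inv_chord_1 // /tau addrA addrAC.
have E : \sum_i (lam + (N i)%:R)^-1 = \sum_i (lam + (t i)%:R)^-1.
  rewrite (eq_bigr _ (fun i _ => inv _ (Np i))) [RHS](eq_bigr _ (fun i _ => inv _ (tp i))).
  rewrite -!mulr_suml; congr (_ / _).
  transitivity (\sum_(i < r) (tau + 1 + p%:R) - (\sum_i N i)%N%:R).
    by rewrite natr_sum -sumrB; apply: eq_bigr => i _; ring.
  by rewrite Nt natr_sum -sumrB; apply: eq_bigr => i _; ring.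
rewrite (bigD1 i0) //= [X in _ < X](bigD1 j) //= eqxx ti0 Nj -/tau.
rewrite (eq_bigr (fun i => (lam + (t i)%:R)^-1)); last by move=> i /negPf ->; rewrite addr0.
rewrite [X in _ < _ + X](eq_bigr (fun i => (lam + (N i)%:R)^-1)); last first.
  by move=> i /b0 ->; rewrite addr0.
move: E; rewrite (bigD1 j) //= [RHS](bigD1 i0) //= ti0 Nj -/tau => /addrI ->.
by rewrite ltrD2r ltf_pV2 ?posrE ?ltrD2l //; lra.
Qed.

End Targets.

Section TuranColor.
Variables (n r : nat).
Hypothesis r_gt0 : 0 < r.

Definition turan_color (x : turan n r) : 'I_r := Ordinal (ltn_pmod (x : 'I_n) r_gt0).

Lemma turan_colorE (x y : turan n r) : (x -- y) = (turan_color x != turan_color y).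
Proof. by []. Qed.

Lemma turan_part_color i : turan_part n i = [set x | turan_color x == i].
Proof. by apply/setP => x; rewrite !inE. Qed.

Lemma last_color_lt : r.-1 < r.
Proof. by rewrite ltn_predL. Qed.

Definition last_color : 'I_r := Ordinal last_color_lt.

Lemma card_turan_last : #|turan_part n last_color| = n %/ r.
Proof.
rewrite card_turan_part /= ltnNge -ltnS prednK // ltn_pmod // addn0.
by [].
Qed.

End TuranColor.

(** * Shape of the inner edges of an extremal graph *)

Section Shape.
Local Open Scope ring_scope.
Variables (R : realType) (k r : nat) (F : 'I_k -> sgraph).
Hypothesis F_critical : forall i, color_critical (F i) /\ chi (F i) = r.+1.
Hypothesis k_gt0 : (0 < k)%N.
Hypothesis r_gt1 : (1 < r)%N.
Let r_gt0 : (0 < r)%N := ltnW r_gt1.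
Let m := k.-1.
Let M : R := m%:R.

Let star_excess (lam : R) := (2 * M * lam + M ^+ 2 + M) / (lam ^+ 2 - M).

(** H is the candidate inner graph and [bs] its excess. [strict] marks a candidate that beats the
    star, the triangle for k = 4, and then stars are excluded as well. *)
Lemma extremal_shape (H : sgraph) (bs : R -> R) (L0 : R) (strict : bool) :
  (#|edges H| < k)%N ->
  (forall lam, L0 <= lam -> (2 * M * lam + M ^+ 2 + M) / lam ^+ 2 <= bs lam /\
    exists zeta : H -> R, [/\ forall u, 0 <= zeta u,
    forall u, lam * zeta u <= 1 + \sum_(v | u -- v) zeta v
    & \sum_u (lam * zeta u - 1) = bs lam]) ->
  (strict -> (1 < k)%N /\ forall lam, L0 <= lam -> star_excess lam < bs lam) ->
  exists n1 : nat, forall (n : nat) (h : H -> turan n r) (G : sgraph), (n1 <= n)%N ->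
    injective h -> (forall u, h u \in turan_part n (last_color r_gt0)) ->
    SPEX R n (edge_disjoint_copies F) G ->
    exists c : G -> 'I_r,
    [/\ forall u v, c u != c v -> u -- v, #|inner c| = m,
        forall i, #|[set v | c v == i]| = (n %/ r)%N \/ #|[set v | c v == i]| = (n %/ r).+1%N,
        forall u v, u -- v -> c u = c v -> #|[set w | c w == c u]| = (n %/ r)%N
      & (forall e f, e \in inner c -> f \in inner c -> e :&: f != set0) /\
        (strict -> ~ exists a, forall e, e \in inner c -> a \in e)].
Proof.
move=> HE HZ Hs; have r2 : 2 <= r%:R :> R by rewrite (ler_nat R 2).
pose ri : R := r%:R^-1.
have riE : r%:R * ri = 1 by rewrite /ri mulfV // gt_eqF //; lra.
have ri0 : 0 < ri by rewrite invr_gt0; lra.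
have ri2 : ri <= 1 / 2.
  by rewrite -(ler_pM2l (_ : 0 < r%:R)) ?riE; lra.
have M0 : 0 <= M by apply: ler0n.
have [|n1 n1P] := @extremal_structure R k r F F_critical k_gt0 r_gt1 (ri / 8); first by lra.
(* The first summand is the bound on lam asked by [excess_lt], the second makes every excess [b i]
   at most 1/16. *)
pose K : R := 2 * (9 * M ^+ 2 + 2 * M * (M ^+ 2 + M) + 1) + 16 * (M ^+ 2 + 3 * M) + 16.
have [n2 n2P] := archi_bound (2 * (Num.max L0 K) + 100).
exists (n1 + n2)%N => n h G nn hinj hA Gs; have [Gn Gfree Gmax] := Gs.
have [x [c [xP xpos cross inn' sizes]]] := n1P n G (leq_trans (leq_addr _ _) nn) Gs.
have {inn'}inn : #|inner c| = m := inn'.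
have nK : 2 * (Num.max L0 K) + 100 <= n%:R.
  by apply: le_trans n2P _; rewrite ler_nat; apply: leq_trans nn; apply: leq_addl.
have n_gt0 : (0 < n)%N.
  case: (posnP n) => // n0; move: nK; rewrite n0.
  have : K <= Num.max L0 K by rewrite le_max lexx orbT.
  have : 0 <= M ^+ 2 by apply: sqr_ge0.
  have : 0 <= 2 * M * (M ^+ 2 + M) by rewrite !mulr_ge0 ?addr_ge0 ?sqr_ge0.
  rewrite /K; lra.
have rhoG := SPEX_rho_ge F_critical k_gt0 r_gt1 n_gt0 Gs.
set lam := rho R G in rhoG.
have lamK : Num.max L0 K <= lam.
  apply: le_trans rhoG; rewrite -/ri.
  have h1 : n%:R * ri <= n%:R * (1 / 2) by rewrite ler_wpM2l.
  lra.
have lamn : n%:R / 2 - 1 <= lam.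
  apply: le_trans rhoG; rewrite -/ri.
  have h1 : n%:R * ri <= n%:R * (1 / 2) by rewrite ler_wpM2l.
  lra.
have [lL lK] : L0 <= lam /\ K <= lam by move: lamK; rewrite ge_max => /andP[].
have n100 : 100 <= n%:R :> R.
  have : K <= Num.max L0 K by rewrite le_max lexx orbT.
  have : 0 <= M ^+ 2 by apply: sqr_ge0.
  have : 0 <= 2 * M * (M ^+ 2 + M) by rewrite !mulr_ge0 ?addr_ge0 ?sqr_ge0.
  rewrite /K; lra.
have M20 : 0 <= M ^+ 2 by apply: sqr_ge0.
have M30 : 0 <= 2 * M * (M ^+ 2 + M) by rewrite !mulr_ge0 ?addr_ge0 ?sqr_ge0.
have lC : 2 * (9 * M ^+ 2 + 2 * M * (M ^+ 2 + M) + 1) < lam by rewrite /K in lK; lra.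
have l16 : 16 * (M ^+ 2 + 3 * M) <= lam by rewrite /K in lK; lra.
have l49 : 49 <= lam by lra.
clear nK lamK n2P n1P K lK.
have lam0 : 0 < lam by lra.
pose p := (n %/ r)%N.
have pn : p%:R <= n%:R * ri /\ n%:R * ri <= p%:R + 1 :> R.
  split; first by rewrite ler_pdivlMr ?ltr0n // -natrM ler_nat leq_divM.
  rewrite ler_pdivrMr ?ltr0n // natr1 -natrM ler_nat ltnW //.
  by rewrite ltn_ceil.
set tau := lam + p%:R.
have p0 : 0 <= p%:R :> R by apply: ler0n.
have nri : n%:R * ri <= n%:R * (1 / 2) by rewrite ler_wpM2l //; lra.
have tau4 : tau + 1 <= 4 * lam by rewrite /tau; lra.
have ltau : lam <= tau by rewrite /tau; lra.
pose N i := #|[set v | c v == i]|.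
pose t (i : 'I_r) := (p + (i < n %% r))%N.
pose cT := @turan_color n r r_gt0.
pose i0 := last_color r_gt0.
have tE i : t i = #|[set y | cT y == i]|.
  by rewrite -turan_part_color card_turan_part.
have ti0 : t i0 = p by rewrite tE -turan_part_color card_turan_last.
have tp i : t i = p \/ t i = p.+1.
  by rewrite /t; case: (_ < _)%N; rewrite ?addn1 ?addn0; [right|left].
have sumt : (\sum_i t i = n)%N.
  rewrite (eq_bigr _ (fun i _ => tE i)) -[RHS](card_ord n) -sum1_card.
  rewrite [RHS](partition_big cT predT) //=; apply: eq_bigr => i _.
  by rewrite -sum1_card; apply: eq_bigl => y; rewrite inE.
have sumN : (\sum_i N i = n)%N.
  rewrite -Gn -[RHS]sum1_card [RHS](partition_big c predT) //=; apply: eq_bigr => i _.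
  by rewrite /N -sum1_card; apply: eq_bigl => y; rewrite inE.
have sumNt : (\sum_i N i = \sum_i t i)%N by rewrite sumN sumt.
have Np i : `|(N i)%:R - p%:R| <= tau / 4.
  have := sizes i; rewrite -/(N i) -/ri => s1.
  have e : (N i)%:R - p%:R = ((N i)%:R - ri * n%:R) + (n%:R * ri - p%:R) by ring.
  rewrite e; apply: le_trans (ler_normD _ _) _.
  have : `|n%:R * ri - p%:R| <= 1 by rewrite ler_norml; apply/andP; split; lra.
  rewrite /tau; lra.
have surj i : exists v, c v = i.
  have : 0 < (N i)%:R :> R.
    have := sizes i; rewrite -/(N i) -/ri ler_norml => /andP[s1 _].
    have : 0 < ri * n%:R by rewrite mulr_gt0 // ltr0n.
    lra.
  by rewrite ltr0n => /card_gt0P[v]; rewrite inE => /eqP <-; exists v.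
have [z [z0 zE zsum]] := eigenweight_resolvent cross r_gt1 xP xpos surj.
rewrite -/lam in zE.
pose d v : R := #|inner_nbr c v|%:R.
pose b i := \sum_(v | c v == i) d v * z v.
have dz v : 0 <= d v * z v by rewrite mulr_ge0 // ler0n.
have b0 i : 0 <= b i by apply: sumr_ge0.
have bsum : \sum_i b i = \sum_v d v * z v by rewrite [RHS](sum_class c).
have rhs : \sum_i (lam + (N i)%:R + b i)^-1 = (r%:R - 1) / lam.
  rewrite -zsum mulr_suml; apply: eq_bigr => i _.
  rewrite -addrA /b /d -(resolvent_class_sum zE) -[X in X + lam * _]mulr1 -mulrDr invfM mulrC.
  by [].
pose Gt := embed_graph hinj.
have hT u : cT (h u) = i0.
  by have := hA u; rewrite turan_part_color inE => /eqP.
have rhoGt : rho R Gt <= lam.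
  apply: Gmax; first by rewrite card_ord.
  apply: (few_inner_free F_critical (c := (cT : Gt -> 'I_r))).
  apply: leq_ltn_trans HE.
  by have := @card_embed_inner _ _ h hinj r cT i0; apply; [apply: turan_colorE | apply: hT].
have [blb [zeta [zeta0 zetaE zetas]]] := HZ lam lL.
(* A smaller sum for the target would give it a radius above lam, against extremality. Everything
   below contradicts this inequality. *)
have noLT : ~ (\sum_i (lam + (t i)%:R + (if i == i0 then bs lam else 0))^-1 <
    \sum_i (lam + (N i)%:R + b i)^-1).
  rewrite rhs -zetas; under eq_bigr do rewrite tE.
  move/(rho_embed_gt hinj (turan_colorE r_gt0) hT lam0 zeta0 zetaE).
  by rewrite -/Gt ltNge rhoGt.
clear rhoGt Gmax.
pose D := (\sum_v #|inner_nbr c v| ^ 2)%N.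
have DE : D = (\sum_v edge_degree (inner c) v ^ 2)%N.
  by apply: eq_bigr => v _; rewrite card_inner_nbr.
have Dm : (D <= m ^ 2 + m)%N.
  by rewrite DE -inn; apply: sum_edge_degree_sq_le; apply: card_inner_edge.
have mlam : M < lam by lra.
have bbound := resolvent_excess_le lam0 z0 zE mlam inn.
rewrite -/D -/M -bsum in bbound.
have dM : D%:R <= M ^+ 2 + M by rewrite /M -natrX -natrD ler_nat.
have b16 i : 0 <= b i <= 1 / 16.
  rewrite b0 /=; apply: (@le_trans _ _ (\sum_i b i)).
    by rewrite (bigD1 i) //= lerDl sumr_ge0.
  apply: le_trans bbound _; rewrite ler_pdivrMr //.
  have : D%:R / (lam - M) <= M ^+ 2 + M.
    rewrite ler_pdivrMr; last by lra.
    apply: le_trans dM _; rewrite ler_peMr //; lra.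
  lra.
pose gn i := gain tau p (N i) (b i).
have gn0 i : 0 <= gn i.
  rewrite /gn /gain; case: ifP => // _; case: ifP => _; rewrite divr_ge0 //; lra.
(* The defect of [G] in units of lam^-2. Its terms are nonnegative, so each of the following claims
   is read off from a single one. *)
have small : M ^+ 2 + M - D%:R + (\sum_i gn i) * lam ^+ 2 < 1 / 2.
  rewrite ltNge; apply/negP => ge; apply: noLT.
  have t8 : 8 <= lam + p%:R by rewrite -/tau; lra.
  have bl0 : 0 <= (2 * M * lam + M ^+ 2 + M) / lam ^+ 2.
    rewrite divr_ge0 ?sqr_ge0 // addr_ge0 // addr_ge0 // mulr_ge0 ?mulr_ge0 //.
    exact: ltW.
  apply: (target_sum_lt (ltW lam0) t8 sumNt tp ti0 b16 Np bl0 blb).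
  rewrite sumrB -/gn; apply: excess_lt Dm lC bbound ge => //; lra.
have gle i : gn i * lam ^+ 2 < 1 / 2.
  apply: le_lt_trans small; apply: (@le_trans _ _ ((\sum_i gn i) * lam ^+ 2)).
    by rewrite ler_wpM2r ?sqr_ge0 // (bigD1 i) //= lerDl sumr_ge0.
  by lra.
have tau0 : 0 < tau by lra.
have Ncase i : N i = p \/ N i = p.+1.
  have := gle i; rewrite /gn /gain; case: eqP => [->|_]; first by left.
  case: eqP => [->|_]; first by right.
  have -> : 1 / (4 * tau) * lam ^+ 2 = lam ^+ 2 / (4 * tau) by field; rewrite gt_eqF.
  rewrite ltr_pdivrMr ?mulr_gt0 // => h1.
  have h2 : 49 * lam <= lam ^+ 2 by rewrite expr2 ler_wpM2r // ltW.
  exfalso; lra.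
(* An inner edge gives its class excess at least 2 / lam. In a class of size p + 1 the gain would be
   at least 2 lam / (tau + 1) >= 1/2 in these units. *)
have Ninner u v : u -- v -> c u = c v -> N (c u) = p.
  move=> uv cuv; have := gle (c u); have := resolvent_inner_excess lam0 z0 zE uv cuv.
  rewrite -/(b (c u)) /gn /gain; case: (Ncase (c u)) => [-> //|->].
  rewrite gtn_eqF // eqxx => h1; set y := b (c u) in h1 *.
  have t1 : 0 < tau + 1 by lra.
  rewrite mulrAC ltr_pdivrMr // => h2.
  have : 2 / lam * lam ^+ 2 <= y * lam ^+ 2 by rewrite ler_wpM2r ?sqr_ge0.
  have -> : 2 / lam * lam ^+ 2 = 2 * lam by field; rewrite gt_eqF.
  by move=> h3; exfalso; lra.
have Deq : D = (m ^ 2 + m)%N.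
  apply/eqP; rewrite eqn_leq Dm leqNgt; apply/negP => lt.
  have : D%:R + 1 <= M ^+ 2 + M by rewrite /M -natrX -natrD natr1 ler_nat.
  have : 0 <= (\sum_i gn i) * lam ^+ 2 by rewrite mulr_ge0 ?sqr_ge0 // sumr_ge0.
  lra.
exists c; split=> //; split.
- move=> e f eE fE; apply/negP => /eqP ef0.
  have := sum_edge_degree_sq_lt (@card_inner_edge _ _ c) eE fE ef0.
  by rewrite -DE inn Deq ltnn.
(* For a star the excess is known exactly and sits in a single class of size p, so the strict
   inequality between the excesses decides. *)
- move=> st [a star]; have [k1 lt] := Hs st; apply: noLT.
  have [e eE] : exists e, e \in inner c.
    by apply/card_gt0P; rewrite inn -ltnS prednK.
  have aj : N (c a) = p.
    have [w wa ew] := two_elements (@card_inner_edge _ _ c) eE (star e eE).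
    move: eE; rewrite ew mem_inner inE => /andP[aw /eqP cw].
    exact: (Ninner a w).
  have bo i : i != c a -> b i = 0.
    move=> ic; apply: big1 => v /eqP cv; rewrite /d card_inner_nbr.
    rewrite (_ : edge_degree _ _ = 0%N) ?mul0r //; apply/eqP; rewrite cards_eq0.
    apply/eqP/setP => f; rewrite in_set0; apply/negbTE/negP; rewrite inE => /andP[fE vf].
    have [w wv fw] := two_elements (@card_inner_edge _ _ c) fE vf.
    have := star f fE; rewrite fw !inE => /orP[]/eqP aw.
      by move: ic; rewrite -cv aw eqxx.
    move: fE; rewrite fw mem_inner inE -aw => /andP[_ /eqP cw].
    by move: ic; rewrite -cv cw eqxx.
  have lM2 : M < lam ^+ 2.
    by apply: lt_trans mlam _; rewrite expr2 ltr_pMr //; lra.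
  have ba : b (c a) = star_excess lam.
    rewrite /star_excess -(resolvent_star zE lM2 inn star) -bsum (bigD1 (c a)) //= big1 ?addr0 //.
  apply: (balanced_sum_lt lam0 sumNt tp Ncase ti0 aj bo (b0 _)).
  by rewrite ba; apply: lt.
Qed.

End Shape.

(** * Existence and uniqueness *)

Lemma label_injection (X Y : finType) (I : eqType) (cx : X -> I) (cy : Y -> I) :
  (forall i, #|[set x | cx x == i]| = #|[set y | cy y == i]|) ->
  exists2 f : X -> Y, injective f & forall x, cy (f x) = cx x.
Proof.
move=> cE; pose X_ i := [set x | cx x == i]; pose Y_ i := [set y | cy y == i].
have xX x : x \in X_ (cx x) by rewrite inE.
have lt x : index x (enum (X_ (cx x))) < size (enum (Y_ (cx x))).
  by rewrite -cardE -cE cardE index_mem mem_enum.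
have /(_ _)/cid wit x : exists y, y \in Y_ (cx x).
  by apply/card_gt0P; rewrite -cE; apply/card_gt0P; exists x.
have [w _] : exists w : X -> Y, w = fun x => sval (wit x) by eexists.
pose f x := nth (w x) (enum (Y_ (cx x))) (index x (enum (X_ (cx x)))).
have fc x : cy (f x) = cx x.
  by apply/eqP; have := mem_nth (w x) (lt x); rewrite mem_enum inE.
exists f => // x x' e; have ce : cx x = cx x' by rewrite -!fc e.
have := lt x; have := lt x'; move: e; rewrite /f ce => e lt1 lt2.
rewrite (set_nth_default (w x') (w x)) // in e.
move/eqP: e; rewrite nth_uniq ?enum_uniq // => /eqP e.
have xx : x \in enum (X_ (cx x')) by rewrite mem_enum inE ce.
by rewrite -(nth_index x xx) e nth_index // mem_enum inE.
Qed.

Lemma label_bijection (X Y : finType) (I : eqType) (cx : X -> I) (cy : Y -> I) :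
  (forall i, #|[set x | cx x == i]| = #|[set y | cy y == i]|) ->
  exists2 f : X -> Y, bijective f & forall x, cy (f x) = cx x.
Proof.
move=> cE; have [f fi fc] := label_injection cE.
have [g gi _] := label_injection (fun i => esym (cE i)).
by exists f => //; apply: inj_card_bij fi (leq_card g gi).
Qed.

Lemma graph_iso_sym (G H : sgraph) : graph_iso G H -> graph_iso H G.
Proof.
move=> [f [g fg gf] fE]; exists g; first by exists f.
by move=> x y; rewrite -fE !gf.
Qed.

Section IsoInvariance.
Local Open Scope ring_scope.
Variable R : realType.

Lemma rho_iso_le (G H : sgraph) : graph_iso G H -> (0 < #|G|)%N -> rho R G <= rho R H.
Proof.
move=> [f fbij fE] G0; have [x [x0 xn xE]] := rho_perron R G0.
have [g fg gf] := fbij.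
have := rho_quad (fun v : H => x (g v)).
have -> : \sum_u x (g u) ^+ 2 = \sum_u x u ^+ 2.
  by rewrite (reindex f) /=; [apply: eq_bigr => u _; rewrite fg | apply: onW_bij].
have -> : \sum_u x (g u) * (\sum_(v | u -- v) x (g v)) = rho R G * \sum_u x u ^+ 2.
  rewrite (reindex f) /=; last exact: onW_bij.
  rewrite mulr_sumr; apply: eq_bigr => u _; rewrite fg expr2 mulrCA -xE; congr (_ * _).
  rewrite (reindex f) /=; last exact: onW_bij.
  by apply: eq_big => v; rewrite ?fE // fg.
by rewrite ler_pM2r.
Qed.

Lemma rho_iso (G H : sgraph) : graph_iso G H -> (0 < #|G|)%N -> rho R G = rho R H.
Proof.
move=> GH G0; have [f fbij _] := GH.
apply/eqP; rewrite eq_le (rho_iso_le GH) //= (rho_iso_le (graph_iso_sym GH)) //.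
by rewrite -(bij_eq_card fbij).
Qed.

End IsoInvariance.

Lemma packs_iso k (F : 'I_k -> sgraph) (G H : sgraph) : graph_iso G H -> packs F G -> packs F H.
Proof.
move=> [f fbij fE] [phi [emb dis]]; have fi := bij_inj fbij.
exists (fun i u => f (phi i u)); split=> [i|i j ij a b c d ab cd /fi e1 /fi e2].
  have [ei ee] := emb i; split; first by move=> a b /fi/ei.
  by move=> a b /ee; rewrite fE.
exact: dis e1 e2.
Qed.

(** * Finitely many graphs of a given order *)

Section Codes.
Variable n : nat.
Implicit Type f : {ffun 'I_n * 'I_n -> bool}.

Definition code_rel f : rel 'I_n := fun x y => (x != y) && (f (x, y) || f (y, x)).

Lemma code_sym f : symmetric (code_rel f).
Proof. by move=> x y; rewrite /code_rel eq_sym orbC. Qed.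

Lemma code_irrefl f : irreflexive (code_rel f).
Proof. by move=> x; rewrite /code_rel eqxx. Qed.

Definition code_graph f := SGraph (code_sym f) (code_irrefl f).

Lemma code_graph_iso (G : sgraph) : #|G| = n -> exists f, graph_iso G (code_graph f).
Proof.
move=> Gn; pose g (x : G) : 'I_n := cast_ord Gn (enum_rank x).
pose g' (i : 'I_n) : G := enum_val (cast_ord (esym Gn) i).
have gg' : cancel g g' by move=> x; rewrite /g' /g cast_ordK enum_rankK.
have g'g : cancel g' g by move=> i; rewrite /g' /g enum_valK cast_ordKV.
exists [ffun p => g' p.1 -- g' p.2], g; first by exists g'.
move=> x y; rewrite -[LHS]/(code_rel _ (g x) (g y)) /code_rel !ffunE /= !gg'.
rewrite [y -- x]sedge_sym orbb (can_eq gg'); case: eqP => // ->.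
by rewrite sedge_irrefl.
Qed.

End Codes.

Section Existence.
Variables (R : realType) (k r : nat) (F : 'I_k -> sgraph).
Hypothesis F_critical : forall i, color_critical (F i) /\ chi (F i) = r.+1.
Hypothesis k_gt0 : 0 < k.
Hypothesis r_gt0 : 0 < r.

Lemma SPEX_iso n (G H : sgraph) : 0 < n -> graph_iso G H ->
  SPEX R n (edge_disjoint_copies F) G -> SPEX R n (edge_disjoint_copies F) H.
Proof.
move=> n0 GH [Gn Gfree Gmax]; have [f fbij _] := GH; split.
- by rewrite -(bij_eq_card fbij).
- apply/free_packs => pH; move/free_packs: Gfree; apply.
  exact: packs_iso (graph_iso_sym GH) pH.
- move=> G' G'n G'free; rewrite -(rho_iso R GH) ?Gn //.
  exact: Gmax.
Qed.

(** A maximum needs a finite type, which [sgraph] is not: it is taken over adjacency codes on 'I_n,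
    and invariance under isomorphism extends it to all graphs. *)
Lemma SPEX_exists n : 0 < n -> exists G, SPEX R n (edge_disjoint_copies F) G.
Proof.
move=> n0; pose P (f : {ffun 'I_n * 'I_n -> bool}) := `[< free (edge_disjoint_copies F) (code_graph f) >].
pose f0 : {ffun 'I_n * 'I_n -> bool} := [ffun _ => false].
have P0 : P f0.
  apply/asboolP; apply: (few_inner_free F_critical (c := fun _ => Ordinal r_gt0)).
  rewrite (_ : inner _ = set0) ?cards0 //.
  apply/setP => e; rewrite in_set0; apply/negbTE/negP => /innerP[a [b [ab _ _]]].
  have : code_rel f0 a b := ab.
  by rewrite /code_rel !ffunE andbF.
have [f /asboolP Pf fmax] : exists2 f, P f &
    forall g, P g -> (rho R (code_graph g) <= rho R (code_graph f))%R.
  pose f := [arg max_(g > f0 | P g) rho R (code_graph g)]%O.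
  by exists f; rewrite /f; case: arg_maxP.
exists (code_graph f); split; [by rewrite card_ord | exact: Pf |].
move=> G' G'n G'free; have [g G'g] := code_graph_iso G'n.
have -> : rho R G' = rho R (code_graph g) by apply: rho_iso G'g _; rewrite G'n.
apply: fmax; apply/asboolP/free_packs => pg.
by move/free_packs: G'free; apply; apply: packs_iso (graph_iso_sym G'g) pg.
Qed.

End Existence.

(** Two label-preserving bijections are composed: one matches the classes, respecting sizes and the
    class of the inner edges, the other matches the vertices along it and carries [g] to [h]. *)
Lemma iso_embed_graph (G T H : sgraph) r p (c : G -> 'I_r) (cT : T -> 'I_r)
    (h : H -> T) (h_inj : injective h) (g : H -> G) (j i0 : 'I_r) :
  #|G| = #|T| ->
  (forall x y : T, (x -- y) = (cT x != cT y)) -> (forall u, cT (h u) = i0) ->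
  (forall i, #|[set x | cT x == i]| = p \/ #|[set x | cT x == i]| = p.+1) ->
  #|[set x | cT x == i0]| = p ->
  (forall i, #|[set x | c x == i]| = p \/ #|[set x | c x == i]| = p.+1) ->
  #|[set x | c x == j]| = p -> injective g -> (forall u, c (g u) = j) ->
  (forall x y, c x != c y -> x -- y) ->
  (forall x y, c x = c y -> (x -- y) <-> exists u v, [/\ u -- v, g u = x & g v = y]) ->
  graph_iso G (embed_graph h_inj).
Proof.
move=> GT TE hi0 tp ti0 Np Nj ginj gj cross inn.
pose N i := #|[set x | c x == i]|; pose t i := #|[set x | cT x == i]|.
(* With sizes p and p + 1 only, the total number of vertices fixes how many classes have each
   size. *)
have cnt1 (f : 'I_r -> nat) : (forall i, f i = p \/ f i = p.+1) ->
    \sum_i f i = r * p + #|[set i | f i == p.+1]|.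
  move=> fp; rewrite -sum1_card -[in r * p](card_ord r) -sum_nat_const.
  rewrite [X in _ = _ + X]big_mkcond -big_split; apply: eq_bigr => i _ /=.
  by rewrite inE; case: (fp i) => ->; rewrite ?eqxx ?addn1 // ltn_eqF // addn0.
have sumc (X : finType) (f : X -> 'I_r) : \sum_i #|[set x | f x == i]| = #|X|.
  rewrite -[RHS]sum1_card [RHS](partition_big f predT) //=; apply: eq_bigr => i _.
  by rewrite -sum1_card; apply: eq_bigl => x; rewrite inE.
have c1 : #|[set i | N i == p.+1]| = #|[set i | t i == p.+1]|.
  apply/eqP; rewrite -(eqn_add2l (r * p)) -!cnt1 // /N /t !sumc; exact/eqP.
have compl (f : 'I_r -> nat) : (forall i, f i = p \/ f i = p.+1) ->
    [set i | f i == p] = ~: [set i | f i == p.+1].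
  move=> fp; apply/setP => i; rewrite !inE; case: (fp i) => ->; rewrite eqxx.
    by rewrite ltn_eqF.
  by rewrite gtn_eqF.
have c0 : #|[set i | N i == p]| = #|[set i | t i == p]|.
  rewrite (compl N Np) (compl t tp) [LHS]cardsCs [RHS]cardsCs !finset.setCK.
  by rewrite c1.
have cc a : #|[set i | N i == a]| = #|[set i | t i == a]|.
  have [->|a0] := eqVneq a p; first exact: c0.
  have [->|a1] := eqVneq a p.+1; first exact: c1.
  have e0 (f : 'I_r -> nat) : (forall i, f i = p \/ f i = p.+1) -> [set i | f i == a] = set0.
    move=> fp; apply/setP => i; rewrite !inE; case: (fp i) => ->; rewrite eq_sym; exact: negbTE.
  by rewrite !e0.
have lab1 (l : nat * bool) : #|[set i | (N i, i == j) == l]| = #|[set i | (t i, i == i0) == l]|.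
  case: l => a bo.
  have split (f : 'I_r -> nat) (i1 : 'I_r) : f i1 = p ->
      #|[set i | (f i, i == i1) == (a, bo)]| =
      if bo then nat_of_bool (a == p) else #|[set i | f i == a]| - (a == p).
    move=> fi1; case: bo.
      have -> : [set i | (f i, i == i1) == (a, true)] = if a == p then [set i1] else set0.
        apply/setP => i; rewrite !inE xpair_eqE eqb_id.
        have [->|ni] := eqVneq i i1; last by rewrite andbF; case: ifP; rewrite !inE ?(negPf ni).
        by rewrite andbT fi1 eq_sym; case: ifP; rewrite !inE ?eqxx.
      by case: ifP; rewrite ?cards1 ?cards0.
    have -> : [set i | (f i, i == i1) == (a, false)] = [set i | f i == a] :\ i1.
      by apply/setP => i; rewrite !inE xpair_eqE eqbF_neg andbC.
    by rewrite [X in _ = X - _](cardsD1 i1) inE fi1 eq_sym addKn.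
  by rewrite (split N j Nj) (split t i0 ti0) cc.
have [s sbij sE] := label_bijection lab1.
have sN i : t (s i) = N i by have [] := sE i.
have sj i : (s i == i0) = (i == j) by have [] := sE i.
(* The second label names the vertex of H that x represents, so equal labels force f (g u) = h u. *)
pose lG (x : G) := (s (c x), [pick u | g u == x]).
pose lT (y : T) := (cT y, [pick u | h u == y]).
have lab2 (l : 'I_r * option H) : #|[set x | lG x == l]| = #|[set y | lT y == l]|.
  case: l => i ou.
  have gen (X : finType) (a : H -> X) (lab : X -> 'I_r) (i1 : 'I_r) (ainj : injective a) :
      (forall u, lab (a u) = i1) ->
      #|[set x | (lab x, [pick u | a u == x]) == (i, ou)]| =
      if ou is Some u then nat_of_bool (i == i1)
      else #|[set x | lab x == i]| - (if i == i1 then #|H| else 0).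
    move=> lai; have pa u : [pick v | a v == a u] = Some u.
      by case: pickP => [v /eqP/ainj -> //|/(_ u)]; rewrite eqxx.
    have sa x u : [pick v | a v == x] = Some u -> a u = x.
      by case: pickP => // v /eqP <- [->].
    case: ou => [u|].
      have -> : [set x | (lab x, [pick v | a v == x]) == (i, Some u)] =
          if i == i1 then [set a u] else set0.
        apply/setP => x; rewrite inE xpair_eqE; apply/andP/idP => [[/eqP <- /eqP/sa <-]|].
          by rewrite lai eqxx inE.
        by case: eqP => [->|_]; rewrite inE // => /eqP ->; rewrite lai pa !eqxx.
      by case: ifP; rewrite ?cards1 ?cards0.
    have -> : [set x | (lab x, [pick v | a v == x]) == (i, None)] =
        [set x | lab x == i] :\: [set a u | u : H].
      apply/setP => x; rewrite !inE xpair_eqE andbC; congr (_ && _).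
      apply/eqP/negP => [np /imsetP[u _ xu]|nx]; first by rewrite xu pa in np.
      by case: pickP => // u /eqP au; case: nx; apply/imsetP; exists u.
    rewrite cardsD; congr (_ - _); case: eqP => [->|ni].
      rewrite (setIidPr _) ?card_imset //.
      by apply/subsetP => x /imsetP[u _ ->]; rewrite inE lai.
    apply/eqP; rewrite cards_eq0; apply/eqP/setP => x; rewrite !inE.
    apply/negbTE/negP => /andP[/eqP lx /imsetP[u _ xu]].
    by case: ni; rewrite -lx xu lai.
  have sji0 : s j = i0 by apply/eqP; rewrite sj.
  rewrite (gen G g (fun x => s (c x)) i0 ginj) => [|u]; last by rewrite gj.
  rewrite (gen T h cT i0 h_inj hi0).
  clear gen; case: ou => [//|]; congr (_ - _).
  have [s' ss' s's] := sbij; rewrite -/(t i) -[i in RHS]s's sN /N.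
  by apply: eq_card => x; rewrite !inE (can2_eq ss' s's).
have [f fbij fE] := label_bijection lab2.
have fc x : cT (f x) = s (c x) by have := fE x; rewrite /lT /lG => -[].
have fg u : f (g u) = h u.
  have : [pick v | h v == f (g u)] = [pick v | g v == g u].
    by have := fE (g u); rewrite /lT /lG => -[].
  have -> : [pick v | g v == g u] = Some u.
    by case: pickP => [v /eqP/ginj -> //|/(_ u)]; rewrite eqxx.
  by case: pickP => // v /eqP <- [->].
exists f => // x y; have fi := bij_inj fbij; have si := bij_inj sbij.
apply/embed_relP/idP.
  case=> [|[u [v [uv hu hv]]]].
    rewrite TE !fc => ne; apply: cross; apply: contra ne => /eqP ->.
    by rewrite eqxx.
  have gx : g u = x by apply: fi; rewrite fg.
  have gy : g v = y by apply: fi; rewrite fg.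
  by apply/inn; [rewrite -gx -gy !gj | exists u, v].
move=> xy; have [cxy|ne] := eqVneq (c x) (c y); last first.
  by left; rewrite TE !fc (inj_eq si).
have /(inn _ _ cxy)[u [v [uv gu gv]]] := xy.
by right; exists u, v; rewrite -!fg gu gv.
Qed.

Definition inner_copy (G H : sgraph) r (c : G -> 'I_r) (j : 'I_r) (g : H -> G) : Prop :=
  [/\ injective g, forall u, c (g u) = j &
    forall x y, c x = c y -> (x -- y) <-> exists u v, [/\ u -- v, g u = x & g v = y]].

(** The centre goes to the hub and the leaves enumerate its inner neighbours. Without inner edges
    the star is a single vertex, placed at a. *)
Lemma star_inner_copy (G : sgraph) r (c : G -> 'I_r) (a : G) :
  (forall e, e \in inner c -> a \in e) ->
  exists g : star #|inner c| -> G, inner_copy c (c a) g.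
Proof.
move=> hub.
have ca : #|inner_nbr c a| = #|inner c|.
  by rewrite card_inner_nbr; apply: eq_card => e; rewrite inE andb_idr //; apply: hub.
have [e einj eN] := exists_inj_ord (eq_leq (esym ca)).
have eonto y : y \in inner_nbr c a -> exists i, y = e i.
  move=> ya; have : y \in [set e i | i : 'I_#|inner c|].
    suff -> : [set e i | i : 'I_#|inner c|] = inner_nbr c a by [].
    have ce : #|[set e i | i : 'I_#|inner c|]| = #|inner c| by rewrite card_imset // card_ord.
    apply/eqP; rewrite eqEcard ce ca leqnn andbT.
    by apply/subsetP => z /imsetP[i _ ->].
  by case/imsetP=> i _ ->; exists i.
pose g (u : 'I_#|inner c|.+1) := if unlift ord0 u is Some i then e i else a.
have g0 : g ord0 = a by rewrite /g unlift_none.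
have gl i : g (lift ord0 i) = e i by rewrite /g liftK.
have nea i : e i != a.
  by apply/eqP => ea; have := eN i; rewrite inE ea sedge_irrefl.
exists g; split.
- move=> u v; case: (unliftP ord0 (u : 'I__.+1)) => [i ->|->];
    case: (unliftP ord0 (v : 'I__.+1)) => [i' ->|->] //; rewrite ?gl ?g0.
  + by move/einj ->.
  + by move/eqP; rewrite (negPf (nea _)).
  + by move/esym/eqP; rewrite (negPf (nea _)).
- move=> u; case: (unliftP ord0 (u : 'I__.+1)) => [i ->|->]; rewrite ?gl ?g0 //.
  by have := eN i; rewrite inE => /andP[_ /eqP].
- move=> x y cxy; split=> [xy|[u [v [uv <- <-]]]].
    have : [set x; y] \in inner c by rewrite mem_inner inE xy cxy eqxx.
    move=> xyE; have := hub _ xyE; rewrite !inE => /orP[]/eqP ea.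
      have /eonto[i yi] : y \in inner_nbr c a by rewrite ea -mem_inner.
      by exists ord0, (lift ord0 i); rewrite g0 gl.
    have /eonto[i xi] : x \in inner_nbr c a by rewrite ea inner_nbr_sym -mem_inner.
    by exists (lift ord0 i), ord0; rewrite g0 gl.
  have {}uv : ((u : 'I__.+1) == ord0) != ((v : 'I__.+1) == ord0) := uv.
  have ae i : a -- e i by have := eN i; rewrite inE => /andP[].
  case: (unliftP ord0 (u : 'I__.+1)) uv => [i ->|->];
    case: (unliftP ord0 (v : 'I__.+1)) => [i' ->|->] // _; rewrite gl g0 //.
  by rewrite sedge_sym.
Qed.

Lemma triangle_inner_copy (G : sgraph) r (c : G -> 'I_r) (x0 x1 x2 : G) :
  x0 != x1 -> x1 != x2 -> x0 != x2 ->
  inner c = [set [set x0; x1]; [set x1; x2]; [set x0; x2]] ->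
  exists g : complete 3 -> G, inner_copy c (c x0) g.
Proof.
move=> n01 n12 n02 E; pose g (u : 'I_3) := nth x0 [:: x0; x1; x2] u.
have e01 : [set x0; x1] \in inner c by rewrite E !inE eqxx.
have e12 : [set x1; x2] \in inner c by rewrite E !inE eqxx orbT.
have e02 : [set x0; x2] \in inner c by rewrite E !inE eqxx !orbT.
have adj x y : [set x; y] \in inner c -> x -- y /\ c y = c x.
  by rewrite mem_inner inE => /andP[-> /eqP].
have [a01 c01] := adj _ _ e01; have [a12 c12] := adj _ _ e12; have [a02 c02] := adj _ _ e02.
have gadj (u v : 'I_3) : u != v -> g u -- g v.
  case: u v => [[|[|[|u]]] hu] [[|[|[|v]]] hv] //= _; rewrite /g //= sedge_sym //.
exists g; split.
- move=> u v e; apply/eqP; apply: contraT => /gadj.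
  by rewrite e sedge_irrefl.
- by case=> [[|[|[|u]]] hu] //=; rewrite /g //= c12.
- move=> x y cxy; split=> [xy|[u [v [uv <- <-]]]]; last exact: gadj.
  have : [set x; y] \in inner c by rewrite mem_inner inE xy cxy eqxx.
  pose i0 : 'I_3 := ord0; pose i1 : 'I_3 := Ordinal (isT : 1 < 3); pose i2 : 'I_3 := ord_max.
  rewrite E !inE => /orP[/orP[]|] /eqP/set2_eqP[[-> ->]|[-> ->]].
  + by exists i0, i1.
  + by exists i1, i0.
  + by exists i1, i2.
  + by exists i2, i1.
  + by exists i0, i2.
  + by exists i2, i0.
Qed.

Section Unique.
Variables (R : realType) (k r : nat) (F : 'I_k -> sgraph).
Hypothesis F_critical : forall i, color_critical (F i) /\ chi (F i) = r.+1.
Hypothesis k_gt0 : 0 < k.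
Hypothesis r_gt1 : 1 < r.
Let M : R := k.-1%:R%R.
Let star_excess (lam : R) : R := ((2 * M * lam + M ^+ 2 + M) / (lam ^+ 2 - M))%R.

(** The last hypothesis is the combinatorial part left open by [extremal_shape]: to recognise the
    inner edges as a copy of H lying in a class of the smaller size. *)
Lemma extremal_unique (H : sgraph) (bs : R -> R) (L0 : R) (strict : bool) :
  #|edges H| < k ->
  (forall lam, (L0 <= lam)%R -> ((2 * M * lam + M ^+ 2 + M) / lam ^+ 2 <= bs lam)%R /\
    exists zeta : H -> R, [/\ forall u, (0 <= zeta u)%R,
    forall u, (lam * zeta u <= 1 + \sum_(v | u -- v) zeta v)%R
    & (\sum_u (lam * zeta u - 1))%R = bs lam]) ->
  (strict -> 1 < k /\ forall lam, (L0 <= lam)%R -> (star_excess lam < bs lam)%R) ->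
  (forall (G : sgraph) (c : G -> 'I_r) p,
    #|inner c| = k.-1 -> (exists a, #|[set v | c v == c a]| = p) ->
    (forall u v, u -- v -> c u = c v -> #|[set w | c w == c u]| = p) ->
    (forall e f, e \in inner c -> f \in inner c -> e :&: f != set0) ->
    (strict -> ~ exists a, forall e, e \in inner c -> a \in e) ->
    exists j (g : H -> G), #|[set v | c v == j]| = p /\ inner_copy c j g) ->
  exists n0 : nat, forall n : nat, n0 <= n ->
    exists G : sgraph,
      [/\ SPEX R n (edge_disjoint_copies F) G,
          forall G' : sgraph, SPEX R n (edge_disjoint_copies F) G' -> graph_iso G' G
        & exists c : 'I_r, #|turan_part n c| = n %/ r /\
            obtained_by_embedding (turan_part n c) H G].
Proof.
move=> HE HZ Hs HG; have r_gt0 := ltnW r_gt1.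
have [n1 n1P] := extremal_shape F_critical k_gt0 r_gt1 HE HZ Hs.
(* The second summand makes each part large enough to hold H. *)
exists (n1 + r * #|H|.+1) => n nn.
have n1n : n1 <= n by apply: leq_trans nn; apply: leq_addr.
have Hn : #|H|.+1 <= n %/ r.
  by rewrite leq_divRL // mulnC; apply: leq_trans nn; apply: leq_addl.
have n0 : 0 < n by have := leq_trans Hn (leq_div n r); apply: leq_trans.
pose i0 := last_color (ltnW r_gt1).
have [e einj eP] : exists2 e : 'I_#|H| -> turan n r, injective e &
    forall i, e i \in turan_part n i0.
  by apply: exists_inj_ord; rewrite card_turan_last ltnW.
pose h (u : H) := e (enum_rank u).
have hinj : injective h by move=> u v /einj/enum_rank_inj.
have hA u : h u \in turan_part n i0 by apply: eP.
have iso G : SPEX R n (edge_disjoint_copies F) G -> graph_iso G (embed_graph hinj).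
  move=> Gs; have [Gn _ _] := Gs.
  have [c [cross inn sizes psize [inter nostar]]] := n1P n h G n1n hinj hA Gs.
  have [a aP] : exists a, #|[set v | c v == c a]| = n %/ r.
    have [i iP] : exists i, #|[set v | c v == i]| = n %/ r.
      suff : [exists i, #|[set v | c v == i]| == n %/ r] by case/existsP=> i /eqP; exists i.
      apply: contraT => /existsPn nex.
      have : \sum_(i < r) (n %/ r).+1 <= \sum_(i < r) #|[set v | c v == i]|.
        by apply: leq_sum => i _; case: (sizes i) => [e'|-> //]; have := nex i; rewrite e' eqxx.
      rewrite sum_nat_const card_ord (_ : \sum_(i < r) _ = n).
        by rewrite leqNgt mulnC ltn_ceil.
      rewrite -[RHS]Gn -[RHS]sum1_card [RHS](partition_big c predT) //=; apply: eq_bigr => i _.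
      by rewrite -sum1_card; apply: eq_bigl => x; rewrite inE.
    have /card_gt0P[a] : 0 < #|[set v | c v == i]| by rewrite iP; apply: leq_trans Hn.
    by rewrite inE => /eqP ca; exists a; rewrite ca.
  have [j [g [jp [ginj gj gE]]]] := HG G c (n %/ r) inn (ex_intro _ a aP) psize inter nostar.
  have tE i : #|[set x | @turan_color n r (ltnW r_gt1) x == i]| = n %/ r + (i < n %% r).
    by rewrite -turan_part_color card_turan_part.
  apply: (iso_embed_graph hinj (p := n %/ r) (c := c) (cT := @turan_color n r (ltnW r_gt1))
    (g := g) (j := j) (i0 := i0)) => //.
  - by rewrite Gn card_ord.
  - by move=> u; have := hA u; rewrite (turan_part_color _ (ltnW r_gt1)) inE => /eqP.
  - by move=> i; rewrite tE; case: (_ < _); rewrite ?addn1 ?addn0; [right | left].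
  - by rewrite -turan_part_color card_turan_last.
have [G0 G0s] := SPEX_exists R F_critical k_gt0 r_gt0 n0.
exists (embed_graph hinj); split=> //.
  exact: SPEX_iso n0 (iso G0 G0s) G0s.
exists i0; split; first exact: card_turan_last.
exact: obtained_embed.
Qed.

End Unique.

Theorem theorem1p7 (R : realType) (r k : nat) (F : 'I_k -> sgraph)
    (hr : 2 <= r) (hk : 1 <= k)
    (hF : forall i : 'I_k, color_critical (F i) /\ chi (F i) = r.+1) :
  exists n0 : nat, forall n : nat, n0 <= n ->
    exists G : sgraph,
      [/\ SPEX R n (edge_disjoint_copies F) G,
          forall G' : sgraph,
            SPEX R n (edge_disjoint_copies F) G' -> graph_iso G' G
        & exists c : 'I_r,
            #|turan_part n c| = n %/ r /\
            obtained_by_embedding (turan_part n c)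
              (if k == 4 then complete 3 else star k.-1) G].
Proof.
case: eqP => [k4|k4].
  pose bs (lam : R) : R := (6 / (lam - 2))%R.
  apply: (@extremal_unique R k r F hF hk hr (complete 3) bs 10%R true).
  - by rewrite k4; apply: leq_ltn_trans card_edges_complete3 _.
  - move=> lam l10; split; last by apply: triangle_subsolution; lra.
    rewrite k4 /= /bs ler_pdivrMr ?exprn_gt0 //; last by lra.
    rewrite [leRHS]mulrAC ler_pdivlMr; last by lra.
    rewrite expr2; lra.
  - move=> _; split; first by rewrite k4.
    (* Cleared of denominators, this is 6 lam^2 - 24 < 6 lam^2 - 18; triangle and star agree to
       order lam^-2. *)
    move=> lam l10; rewrite k4 /= /bs.
    have l0 : (0 < lam ^+ 2 - 3)%R by rewrite expr2; nra.
    rewrite ltr_pdivrMr // [ltRHS]mulrAC ltr_pdivlMr; last by lra.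
    by rewrite !expr2; lra.
  - move=> G c p inn [a0 _] psize inter nostar.
    have [|[a [b [d [ab bd ad E]]]]] := intersecting_edges (@card_inner_edge _ _ c) a0 inter.
      by move=> st; case: (nostar isT st).
    have [g gP] := triangle_inner_copy ab bd ad E.
    exists (c a), g; split=> //.
    have : [set a; b] \in inner c by rewrite E !inE eqxx.
    by rewrite mem_inner inE => /andP[adj /eqP cab]; apply: (psize a b).
pose M : R := (k.-1%:R)%R.
pose bs (lam : R) : R := ((2 * M * lam + M ^+ 2 + M) / (lam ^+ 2 - M))%R.
have M0 : (0 <= M)%R by apply: ler0n.
apply: (@extremal_unique R k r F hF hk hr (star k.-1) bs (M + 1)%R false) => //.
- by apply: leq_ltn_trans (card_edges_star _) _; rewrite prednK.
- move=> lam lM; have l0 : (0 < lam)%R by lra.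
  have lM2 : (M < lam ^+ 2)%R by rewrite expr2; nra.
  split; last exact: star_subsolution.
  rewrite /bs ler_wpM2l //.
    by rewrite !addr_ge0 ?sqr_ge0 // !mulr_ge0 // ltW.
  by rewrite lef_pV2 ?posrE ?exprn_gt0 ?subr_gt0 // gerBl.
- move=> G c p inn [a0 a0p] psize inter _.
  have [[a aP]|[a [b [d [ab bd ad E]]]]] := intersecting_edges (@card_inner_edge _ _ c) a0 inter; last first.
    (* A triangle has three edges, which means k = 4. *)
    case: k4; rewrite -(prednK hk) -inn E; congr _.+1.
    have n1 : [set a; b] != [set b; d].
      apply/eqP => /set2_eqP[[e _]|[e _]]; first by rewrite e eqxx in ab.
      by rewrite e eqxx in ad.
    have n2 : [set a; d] != [set a; b].
      apply/eqP => /set2_eqP[[_ e]|[e _]]; first by rewrite e eqxx in bd.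
      by rewrite e eqxx in ab.
    have n3 : [set a; d] != [set b; d].
      apply/eqP => /set2_eqP[[e _]|[e _]]; first by rewrite e eqxx in ab.
      by rewrite e eqxx in ad.
    by rewrite finset.setUC cardsU1 cards2 !inE n1 (negPf n2) (negPf n3).
  rewrite -inn.
  (* For k = 1 there is no inner edge to locate the class, and the vertex [a0] of a class of size p
     takes its place. *)
  have [E0|[e eE]] := set_0Vmem (inner c).
    have [|g gP] := @star_inner_copy G r c a0; first by move=> e; rewrite E0 inE.
    by exists (c a0), g.
  have [g gP] := star_inner_copy aP; exists (c a), g; split=> //.
  have [w wa ew] := two_elements (@card_inner_edge _ _ c) eE (aP e eE).
  by move: eE; rewrite ew mem_inner inE => /andP[aw /eqP cw]; apply: (psize a w).
Qed.
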